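(* Let $\Omega\subset\mathbb R^n$ be a bounded convex set with nonempty interior, and for $\alpha>0$ let $PW_{\alpha\Omega}$ and $T_\alpha(\sigma)$ be as defined in the context. Let $\sigma\in L^1(\mathbb R^n)\cap L^2(\mathbb R^n)$ be non-negative. Let $\psi\in C([0,\infty))$ be real-valued with $\psi(0)=0$, and suppose that the function $$\phi(t):=\begin{cases}\psi(t)/t,&t>0,\\ \lim_{s\downarrow0}\psi(s)/s,&t=0\end{cases}$$ is (well defined and) continuous on $[0,\infty)$. Assume also that $\lim_{t\to\infty}\psi(t)/t$ exists and is finite. Then $$\lim_{\alpha\to\infty}\frac1{c(\alpha)}\operatorname{Tr}\psi\bigl(T_\alpha(\sigma)\bigr)=\int_{\mathbb R^n}\psi(\sigma(x))\,dx,\qquad c(\alpha)=(2\pi)^{-n}\alpha^n|\Omega|.$$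
   Context: $|\Omega|$ is the Lebesgue measure of $\Omega$ and $\alpha\Omega=\{\alpha\xi:\xi\in\Omega\}$. $PW_{\alpha\Omega}=\{f\in L^2(\mathbb R^n):\operatorname{supp}(\widehat f)\subset\alpha\Omega\}$ (i.e. $\widehat f=0$ a.e. outside $\alpha\Omega$), with $\widehat f(\xi)=\int f(x)e^{-i\xi\cdot x}\,dx$; it is a closed subspace of $L^2(\mathbb R^n)$ and a reproducing kernel Hilbert space with kernel $K_\alpha(x,y)=(2\pi)^{-n}\int_{\alpha\Omega}e^{i\xi\cdot(x-y)}\,d\xi$, so $K_\alpha(x,x)=c(\alpha)$. Let $k_{\alpha,x}(y)=K_\alpha(y,x)/\sqrt{K_\alpha(x,x)}$ be the normalized kernels. $T_\alpha(\sigma)$ is the Toeplitz operator on $PW_{\alpha\Omega}$ defined weakly by $T_\alpha(\sigma)f=\int_{\mathbb R^n}\sigma(x)\langle f,k_{\alpha,x}\rangle k_{\alpha,x}\,c(\alpha)\,dx$. It is positive and trace class, and $\psi(T_\alpha(\sigma))$ is defined by functional calculus. *)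

(* Defs.v *)
From HB Require Import structures.
From mathcomp Require Import all_boot all_order all_algebra.
From mathcomp Require Import all_classical all_reals all_analysis.
From mathcomp Require Import complex.

Set Implicit Arguments.
Unset Strict Implicit.
Unset Printing Implicit Defensive.

Import Order.TTheory GRing.Theory Num.Theory.
Import numFieldNormedType.Exports.

Local Open Scope classical_set_scope.
Local Open Scope ring_scope.
Local Open Scope complex_scope.

Section measurable_rV.
Context {R : realType} {n : nat}.

Let coord (i : 'I_n) (x : 'rV[R]_n) : R := x ord0 i.

Let rV_set0 : g_sigma_preimage coord set0.
Proof. exact: sigma_algebra0. Qed.

Let rV_setC A : g_sigma_preimage coord A -> g_sigma_preimage coord (~` A).
Proof. exact: sigma_algebraC. Qed.

Let rV_bigcup (F : (set 'rV[R]_n)^nat) :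
  (forall i, g_sigma_preimage coord (F i)) ->
  g_sigma_preimage coord (\bigcup_i (F i)).
Proof. exact: sigma_algebra_bigcup. Qed.

(* The product of the Borel sigma-algebras of the coordinates, that is the
   Borel sigma-algebra of R^n. *)
HB.instance Definition _ := @isMeasurable.Build default_measure_display
  'rV[R]_n (g_sigma_preimage coord) rV_set0 rV_setC rV_bigcup.

Lemma measurable_coord (i : 'I_n) :
  measurable_fun [set: 'rV[R]_n] (fun x => x ord0 i).
Proof.
move=> _ Y mY; rewrite setTI; apply: sub_sigma_algebra => /=.
rewrite -bigcup_seq/=; exists i => /=; first by rewrite mem_index_enum.
by exists Y => //; rewrite setTI.
Qed.

Lemma measurable_fun_rV d (T : measurableType d) (f : T -> 'rV[R]_n) :
  (forall i, measurable_fun [set: T] (fun x => f x ord0 i)) ->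
  measurable_fun [set: T] f.
Proof.
move=> mf _ A mA; rewrite setTI; move: A mA.
suff : g_sigma_preimage coord `<=` [set A | measurable (f @^-1` A)] by [].
apply: smallest_sub.
  split=> /=.
  - by rewrite preimage_set0.
  - by move=> A mA; rewrite setTD preimage_setC; exact: measurableC.
  - by move=> F mF; rewrite preimage_bigcup; exact: bigcup_measurable.
move=> A; rewrite -bigcup_seq/= => -[i _ [B mB <-]] /=.
by rewrite setTI; have := mf i measurableT B mB; rewrite setTI.
Qed.

End measurable_rV.

Section lebesgue_rV.
Context {R : realType}.
Local Open Scope ereal_scope.

Definition cons_rV n (p : R * 'rV[R]_n) : 'rV[R]_n.+1 :=
  \row_i oapp (p.2 ord0) p.1 (unlift ord0 i).

Lemma measurable_cons_rV n :
  measurable_fun [set: R * 'rV[R]_n] (@cons_rV n).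
Proof.
apply: measurable_fun_rV => i; case: (unliftP ord0 i) => [j|] ->.
  rewrite (_ : (fun x => _) = (fun y : 'rV[R]_n => y ord0 j) \o snd).
    by apply: measurableT_comp; [exact: measurable_coord|exact: measurable_snd].
  by apply/funext => x; rewrite mxE liftK.
rewrite (_ : (fun x => _) = fst); first exact: measurable_fst.
by apply/funext => x; rewrite mxE unlift_none.
Qed.

Section step.
Variables (n : nat) (m : {sigma_finite_measure set 'rV[R]_n -> \bar R}).

Definition lebesgue_step (A : set 'rV[R]_n.+1) : \bar R :=
  (lebesgue_measure \x m) (@cons_rV n @^-1` A).

Let lebesgue_step0 : lebesgue_step set0 = 0.
Proof. by rewrite /lebesgue_step preimage_set0 measure0. Qed.

Let lebesgue_step_ge0 A : 0 <= lebesgue_step A.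
Proof. exact: measure_ge0. Qed.

Let mpre A : measurable A -> measurable (@cons_rV n @^-1` A).
Proof.
by move=> mA; have := @measurable_cons_rV n measurableT A mA; rewrite setTI.
Qed.

Let lebesgue_step_sigma_additive : semi_sigma_additive lebesgue_step.
Proof.
move=> F mF tF mUF; rewrite /lebesgue_step preimage_bigcup.
apply: measure_semi_sigma_additive.
- by move=> k; exact: mpre.
- apply/trivIsetP => /= i j _ _ ij; rewrite -preimage_setI.
  by move/trivIsetP : tF => /(_ _ _ _ _ ij) ->//; rewrite preimage_set0.
- by rewrite -preimage_bigcup; exact: mpre.
Qed.

HB.instance Definition _ := isMeasure.Build _ _ _ lebesgue_step
  lebesgue_step0 lebesgue_step_ge0 lebesgue_step_sigma_additive.

Definition uncons_rV (x : 'rV[R]_n.+1) : R * 'rV[R]_n :=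
  (x ord0 ord0, \row_i x ord0 (lift ord0 i)).

Lemma cons_rVK : cancel (@cons_rV n) uncons_rV.
Proof.
move=> [a v]; rewrite /uncons_rV mxE unlift_none/=; congr pair.
by apply/rowP => i; rewrite !mxE liftK.
Qed.

Lemma measurable_uncons_rV : measurable_fun [set: 'rV[R]_n.+1] uncons_rV.
Proof.
apply/measurable_fun_pair; first exact: measurable_coord.
apply: measurable_fun_rV => i.
rewrite (_ : (fun x => _) = (fun x : 'rV[R]_n.+1 => x ord0 (lift ord0 i))).
  exact: measurable_coord.
by apply/funext => x; rewrite mxE.
Qed.

Let lebesgue_step_sigma_finite : sigma_finite setT lebesgue_step.
Proof.
have /sigma_finiteP[F [TF ndF Foo]] := sigma_finiteT (@lebesgue_measure R).
have /sigma_finiteP[G [TG ndG Goo]] := sigma_finiteT m.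
exists (fun k => uncons_rV @^-1` (F k `*` G k)).
  apply/seteqP; split => // x _.
  have [i _ Fi] : (\bigcup_i F i) (uncons_rV x).1 by rewrite -TF.
  have [j _ Gj] : (\bigcup_i G i) (uncons_rV x).2 by rewrite -TG.
  exists (maxn i j) => //; split.
    by move: Fi; apply/subsetPset/ndF/leq_maxl.
  by move: Gj; apply/subsetPset/ndG/leq_maxr.
move=> k; have [mF Fk] := Foo k; have [mG Gk] := Goo k; split.
  have := measurable_uncons_rV measurableT (measurableX mF mG).
  by rewrite setTI.
rewrite /lebesgue_step -comp_preimage (_ : _ \o _ = id); last first.
  by apply/funext => x /=; rewrite cons_rVK.
by rewrite product_measure1E// lte_mul_pinfty// ge0_fin_numE.
Qed.

HB.instance Definition _ := Measure_isSigmaFinite.Build _ _ _ lebesgue_step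
  lebesgue_step_sigma_finite.

End step.

(* Lebesgue measure on R^n is the n-fold product of [lebesgue_measure];
   R^0 carries the unit mass. *)
Fixpoint lebesgue_rV (n : nat) : {sigma_finite_measure set 'rV[R]_n -> \bar R} :=
  if n is k.+1 then lebesgue_step (lebesgue_rV k) else \d_(0%R : 'rV[R]_0).

Lemma lebesgue_rV_box n (A : 'I_n -> set R) : (forall i, measurable (A i)) ->
  lebesgue_rV n [set x | forall i, A i (x ord0 i)] =
  \prod_(i < n) lebesgue_measure (A i).
Proof.
elim: n A => [|n IHn] A mA.
  by rewrite /= big_ord0 diracE mem_set// => -[].
rewrite big_ord_recl/= -IHn; last by move=> i; exact: mA.
rewrite -product_measure1E; last 2 first.
- exact: (mA ord0).
- set B := (X in measurable X).
  have -> : B = \bigcap_(i in [set: 'I_n])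
      ((fun x : 'rV[R]_n => x ord0 i) @^-1` A (lift ord0 i)).
    by apply/seteqP; split => [x Bx i _|x Bx i]; [exact: Bx|exact: (Bx i I)].
  apply: fin_bigcap_measurable => // i _.
  by have := measurable_coord i measurableT (mA (lift ord0 i)); rewrite setTI.
rewrite /lebesgue_step; congr (_ _); apply/seteqP; split => -[a v] /= Av.
- split => [|i]; first by have := Av ord0; rewrite mxE unlift_none.
  by have := Av (lift ord0 i); rewrite mxE liftK.
- move=> i; rewrite mxE; case: (unliftP ord0 i) => [j|] ->.
  + exact: Av.2.
  + exact: Av.1.
Qed.

End lebesgue_rV.

(* The Hilbert space is the subspace [H] of [V] with the inner product [ip], linear in
   its first argument.  Elements at distance zero are not identified in [V]
   (functions are only taken up to almost everywhere equality), hence all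
   identities below are stated through the norm or the inner product. *)
Section hilbert.
Context {R : realType} {V : lmodType R[i]}.
Variables (ip : V -> V -> R[i]) (H : set V).
Implicit Types (S T : V -> V) (e : nat -> V).

Definition ip_norm (f : V) : R := Num.sqrt (complex.Re (ip f f)).

Definition orthonormal_basis e :=
  [/\ forall j, H (e j),
      forall j k, ip (e j) (e k) = (j == k)%:R &
      forall f, H f ->
        ip_norm (f - \sum_(j < N) ip f (e j) *: e j) @[N --> \oo] --> 0].

(* For a bounded operator [S], convergence for every orthonormal basis (hence
   for every reordering of a basis) forces absolute convergence, so that [S] is
   trace class.  [H] is meant to be separable and infinite-dimensional. *)
Definition has_trace S (t : R[i]) :=
  (exists e, orthonormal_basis e) /\
  forall e, orthonormal_basis e ->
    (\sum_(j < N) ip (S (e j)) (e j) : R[i]^o) @[N --> \oo] --> (t : R[i]^o).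

(* [0] if [S] has no trace. *)
Definition trace S : R[i] := xget 0 [set t | has_trace S t].

Definition op_bound T (M : R) :=
  forall f, H f -> H (T f) /\ ip_norm (T f) <= M * ip_norm f.

Definition op_horner (p : {poly R}) T (f : V) : V :=
  \sum_(k < size p) (p`_k)%:C *: iter k T f.

(* Continuous functional calculus of a bounded positive operator [T]: [psi(T)]
   is the limit in operator norm of [p(T)], for polynomials [p] converging to
   [psi] uniformly on an interval [0, M] with [M >= |T|], which contains the
   spectrum of [T]. *)
Definition is_fcalc (psi : R -> R) T S := exists M : R,
  [/\ 0 <= M, op_bound T M &
      forall eps : R, 0 < eps -> exists p : {poly R},
        (forall t, 0 <= t <= M -> `|p.[t] - psi t| <= eps) /\
        op_bound (fun f => S f - op_horner p T f) eps].

(* An arbitrary choice of representatives; zero if there is none. *)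
Definition fcalc (psi : R -> R) T : V -> V :=
  xget (fun=> 0) [set S | is_fcalc psi T S].

End hilbert.

Section paley_wiener.
Context {R : realType} {n : nat}.
Local Notation V := 'rV[R]_n.
Local Notation mu := (@lebesgue_rV R n).
Implicit Types (x y xi : V) (f g h : V -> R[i]) (A Omega : set V).

Definition dotv x y : R := \sum_(i < n) x ord0 i * y ord0 i.

Definition expi (t : R) : R[i] := cos t +i* sin t.

Definition normsq (z : R[i]) : R := complex.Re z ^+ 2 + complex.Im z ^+ 2.

(* [D] may fail to be a Borel set below.  As soon as it is Lebesgue measurable
   (for instance convex), [\int[mu]_(x in D)] is the Lebesgue integral over
   [D], since [integral] is defined by approximation from below by simple
   functions. *)
Definition cintegral (D : set V) f : R[i] :=
  (\int[mu]_(x in D) complex.Re (f x)) +i*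
  (\int[mu]_(x in D) complex.Im (f x)).

Definition L2 : set (V -> R[i]) := [set f |
  (fun x => complex.Re (f x)) \in Lfun mu 2%:E /\
  (fun x => complex.Im (f x)) \in Lfun mu 2%:E].

Definition inner f g : R[i] := cintegral setT (fun x => f x * (g x)^*).

(* [g] is the Fourier-Plancherel transform of [f]. *)
Definition is_fourier f g := [/\ L2 f, L2 g &
  (\int[mu]_xi (normsq (g xi - cintegral [set x | `|x| <= r]
     (fun x => f x * expi (- dotv xi x))))%:E)%E @[r --> +oo] --> 0%E].

Definition PW A : set (V -> R[i]) := [set f |
  exists2 g, is_fourier f g & {ae mu, forall xi, ~ A xi -> g xi = 0}].

Definition reproducing_kernel A x y : R[i] :=
  ((2 * pi) ^- n)%:C * cintegral A (fun xi => expi (dotv xi (x - y))).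

Definition normalized_kernel A x y : R[i] :=
  reproducing_kernel A y x / (Num.sqrt (complex.Re (reproducing_kernel A x x)))%:C.

(* Lebesgue measure of a Lebesgue measurable set that may fail to be Borel,
   as the outer measure of [mu]. *)
Definition volume A : R := fine (mu_ext mu A).

Definition dilation (alpha : R) Omega : set V :=
  [set alpha *: xi | xi in Omega].

Definition density Omega (alpha : R) : R :=
  (2 * pi) ^- n * alpha ^+ n * volume Omega.

(* [h] is T_alpha(sigma) f. *)
Definition is_toeplitz Omega (sigma : V -> R) (alpha : R) f h :=
  let A := dilation alpha Omega in
  PW A h /\ forall g, PW A g -> inner h g =
    cintegral setT (fun x => (sigma x)%:C * inner f (normalized_kernel A x) *
      inner (normalized_kernel A x) g * (density Omega alpha)%:C).

(* A representative of T_alpha(sigma) f, which is determined up to almost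
   everywhere equality. *)
Definition toeplitz Omega (sigma : V -> R) (alpha : R) f : V -> R[i] :=
  xget 0 [set h | is_toeplitz Omega sigma alpha f h].

End paley_wiener.

Definition phi {R : realType} (psi : R -> R) (t : R) : R :=
  if t == 0 then lim (psi s / s @[s --> 0^'+]) else psi t / t.

(* Main.v *)
(* Put Q = phi(T), so that psi(T) = T Q.  Parseval's identity turns the trace of
   T Q over any orthonormal basis into c(alpha) times the integral of
   sigma(x) <Q k_x, k_x>.  As phi is bounded and uniformly continuous,
   |phi(t) - phi(s)| <= eps + C |t - s|, and this modulus, made quadratic, gives
   |<Q k_x, k_x> - phi(sigma(x))| <= eps' + C' |(T - sigma(x)) k_x|^2 once
   positivity of f |-> f(T) is known.  The integral over x of
   |(T - sigma(x)) k_x|^2 equals |sigma|_2^2 minus the integral of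
   sigma(x) <T k_x, k_x>, by the trace formula for T T.  It tends to 0, because
   <T k_x, k_x> is the convolution of sigma with the approximate identity
   c(alpha) |<k_x, k_y>|^2, whose mass is 1 by Plancherel.

   Positivity of f |-> f(T) for polynomials f >= 0 on [0, M] follows from the
   Bernstein expansion, since T and M - T are positive; no spectral theorem is
   needed.  Plancherel comes from Abel summation with the weight
   exp(- eps (|x_1| + ... + |x_n|)), whose transform is a product of Poisson
   kernels.  It also shows that f belongs to the Paley-Wiener space of A exactly
   when f is almost everywhere the inverse transform of a square integrable
   function supported in A.  The dilated convex set differs from its interior by
   a null set, so it may be replaced by an open set throughout. *)
Require Import Defs.
From mathcomp Require Import all_boot all_order all_algebra.
From mathcomp Require Import all_classical all_reals all_analysis.
From mathcomp Require Import measurable_realfun complex.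
From mathcomp Require Import zify ring lra.

Set Implicit Arguments.
Unset Strict Implicit.
Unset Printing Implicit Defensive.

Import Order.TTheory GRing.Theory Num.Theory.
Import numFieldNormedType.Exports.

Local Open Scope classical_set_scope.
Local Open Scope ring_scope.
Local Open Scope complex_scope.

(** * Bernstein polynomials and positive functionals *)

(** The norm bound used for [T] is twice c(alpha) times the integral of sigma, as sigma is only
    integrable and square integrable. It grows with alpha, and so does the interval [0, M] on which
    phi is approximated by polynomials; hence no constant of the final estimate may depend on M.
    This is what the finite limit of psi(t)/t at infinity buys: for each eps there is one C with
    |phi(s) - phi(t)| <= eps + C |s - t| on the whole half line. The error then has three parts, eps
    times the integral of sigma, C tau / 2 times the integral of sigma^2, and C / (2 tau) times the
    integral of |(T - sigma(x)) k_x|^2, made small by choosing eps (hence C), tau and alpha in this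
    order. A second obstacle is that everything is defined up to null sets: [T] and the functional
    calculus are arbitrary choices of representatives, so [T] need not be linear as a map on
    functions. Only its symmetry, positivity and boundedness are used, and products of operators are
    compared after pairing with a vector. *)

Section bernstein.
Variable R : realType.
Implicit Types (M t : R) (p q : {poly R}) (L : {poly R} -> R).

(** The ratio is the product over j < i of (k - j)/(N - j). Each factor lies in [0, 1] and differs
    from k/N by at most j/N, so the errors of the factors add up; i^2 is a generous bound for their
    sum. *)
Lemma bin_ratio_le (N k i : nat) : (0 < N)%N -> (k <= N)%N -> (i <= N)%N ->
  `|'C(k, i)%:R / 'C(N, i)%:R - (k%:R / N%:R) ^+ i| <= (i ^ 2)%:R / N%:R :> R.
Proof.
move=> N0 kN; elim: i => [|i IHi] iN.
  by rewrite !bin0 divr1 expr0 subrr normr0 mul0r.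
have {}IHi := IHi (ltnW iN).
have N0' : 0 < N%:R :> R by rewrite ltr0n.
have Ni0 : 0 < (N - i)%:R :> R by rewrite ltr0n subn_gt0.
have CN0 : 0 < 'C(N, i)%:R :> R by rewrite ltr0n bin_gt0 ltnW.
have CN1 : 0 < 'C(N, i.+1)%:R :> R by rewrite ltr0n bin_gt0.
have eN := mul_bin_left N i; have ek := mul_bin_left k i.
have -> : 'C(k, i.+1)%:R / 'C(N, i.+1)%:R =
    'C(k, i)%:R / 'C(N, i)%:R * ((k - i)%:R / (N - i)%:R) :> R.
  apply: (@mulfI _ (i.+1%:R * 'C(N, i.+1)%:R)).
    by rewrite mulf_neq0// gt_eqF.
  rewrite -[in RHS]natrM eN natrM.
  transitivity ((i.+1 * 'C(k, i.+1))%:R : R).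
    by rewrite natrM; field; rewrite gt_eqF.
  by rewrite ek natrM; field; rewrite !gt_eqF.
have d1 : `|(k - i)%:R / (N - i)%:R - k%:R / N%:R| <= i%:R / N%:R :> R.
  (* Subtraction of naturals truncates: for k <= i the factor is 0 and the distance is k/N
     itself. *)
  have [ki|ik] := leqP k i.
    rewrite (eqP (_ : k - i == 0)%N) ?subn_eq0// mul0r sub0r normrN ger0_norm//.
    by rewrite ler_pM2r ?invr_gt0// ler_nat.
  rewrite distrC ger0_norm; last first.
    rewrite subr_ge0 ler_pdivrMr// mulrAC ler_pdivlMr// -!natrM ler_nat.
    rewrite mulnBl mulnBr leq_sub2l// [leqRHS]mulnC [leqRHS]mulnC.
    by rewrite mulnC leq_mul.
  rewrite ler_pdivlMr// mulrBl divfK ?gt_eqF//.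
  rewrite lerBlDr -lerBlDl mulrAC ler_pdivlMr//.
  rewrite natrB 1?ltnW// natrB 1?ltnW//.
  have : k%:R <= N%:R :> R by rewrite ler_nat.
  have : i%:R <= k%:R :> R by rewrite ler_nat ltnW.
  have : 0 <= i%:R :> R by [].
  nra.
have r01 : 0 <= ((k - i)%:R / (N - i)%:R : R) <= 1.
  rewrite divr_ge0//= ler_pdivrMr// mul1r ler_nat; exact: leq_sub2r.
have x01 : 0 <= (k%:R / N%:R : R) <= 1.
  by rewrite divr_ge0//= ler_pdivrMr// mul1r ler_nat.
set r := _ / (N - i)%:R in d1 r01 *; set x := k%:R / _ in d1 x01 IHi *.
set b := _ / _ in IHi *.
move: r x b IHi d1 r01 x01 => r x b IHi d1 r01 x01.
have -> : b * r - x ^+ i.+1 = (b - x ^+ i) * r + x ^+ i * (r - x).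
  by rewrite exprSr; ring.
apply: (le_trans (ler_normD _ _)); rewrite !normrM.
have xi01 : `|x ^+ i| <= 1.
  by rewrite ger0_norm ?exprn_ge0 ?exprn_ile1//; lra.
have -> : (i.+1 ^ 2)%:R / N%:R = (i ^ 2)%:R / N%:R + i%:R / N%:R + i.+1%:R / N%:R :> R.
  rewrite -!mulrDl -!natrD; congr (_%:R / _); by rewrite -addn1 sqrnD; ring.
have : 0 <= i.+1%:R / N%:R :> R by rewrite divr_ge0.
have r0 : `|r| <= 1 by rewrite ger0_norm; lra.
have : `|b - x ^+ i| * `|r| <= (i ^ 2)%:R / N%:R.
  by rewrite -[leRHS]mulr1 ler_pM.
have : `|x ^+ i| * `|r - x| <= i%:R / N%:R.
  by rewrite -[leRHS]mul1r ler_pM.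
lra.
Qed.

(** Bernstein basis polynomial of [0, M], without the positive factor 'C(N, k) / M^N. *)
Definition bern M N k : {poly R} := 'X^k * (M%:P - 'X) ^+ (N - k).

(** Write M^(N-i) as ((M - X) + X)^(N-i) and expand. Matching coefficients is 'C(N, k) 'C(k, i) =
    'C(N, i) 'C(N-i, k-i), and the terms with k < i vanish because 'C(k, i) = 0. *)
Lemma bern_monomial M N i : (i <= N)%N ->
  \sum_(k < N.+1) ('C(N, k)%:R * ('C(k, i)%:R / 'C(N, i)%:R)) *: bern M N k =
  M ^+ (N - i) *: 'X^i.
Proof.
move=> iN; have CN0 : 'C(N, i)%:R != 0 :> R by rewrite pnatr_eq0 -lt0n bin_gt0.
apply: (@scalerI _ _ 'C(N, i)%:R CN0); rewrite scaler_sumr.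
move: CN0; rewrite -(subnKC iN); set n := (N - i)%N => CN0.
rewrite addKn -addnS big_split_ord/= big1 ?add0r; last first.
  by move=> k _; rewrite (bin_small (ltn_ord k)) mul0r mulr0 scale0r scaler0.
have -> : M ^+ n *: 'X^i = \sum_(j < n.+1) 'C(n, j)%:R *: bern M (i + n) (i + j).
  have -> : M ^+ n *: 'X^i = 'X^i * ((M%:P - 'X) + 'X) ^+ n :> {poly R}.
    by rewrite subrK -polyC_exp mulrC mul_polyC.
  rewrite exprDn mulr_sumr; apply: eq_bigr => j _.
  rewrite -mulr_natl scaler_nat -mulr_natr /bern.
  rewrite (_ : i + n - (i + j) = n - j)%N; last by rewrite subnDl.
  by rewrite exprD; ring.
rewrite scaler_sumr; apply: eq_bigr => j _; rewrite !scalerA; congr (_ *: _).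
have jn : (j <= n)%N by rewrite -ltnS.
rewrite mulrCA [X in _ * X]mulrC divfK//.
rewrite -!natrM; congr _%:R; apply/eqP.
have F : forall m, (0 < m`!)%N := fact_gt0.
(* Multiplied by i! j! (n - j)!, both sides become (i + n)!. *)
rewrite -(eqn_pmul2r (F i)) -(eqn_pmul2r (F j)) -(eqn_pmul2r (F (n - j)%N)).
have e1 := bin_fact (leq_addr j i); rewrite addKn in e1.
have e2 := bin_fact (_ : (i + j <= i + n)%N); rewrite subnDl leq_add2l in e2.
have {}e2 := e2 jn.
have e3 := bin_fact (leq_addr n i); rewrite addKn in e3.
have e4 := bin_fact jn.
apply/eqP; transitivity ((i + n)`!)%N.
  by rewrite -e2 -e1; ring.
by rewrite -e3 -e4; ring.
Qed.

(** The exact Bernstein coefficient of [p] in degree N. It differs from the sample p(k M / N) only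
    in that (k/N)^i is replaced by 'C(k, i) / 'C(N, i). *)
Definition bern_coef M N p k : R :=
  \sum_(i < size p) p`_i * M ^+ i * ('C(k, i)%:R / 'C(N, i)%:R).

Lemma bern_expansion M N p : (size p <= N)%N ->
  M ^+ N *: p = \sum_(k < N.+1) ('C(N, k)%:R * bern_coef M N p k) *: bern M N k.
Proof.
move=> pN; rewrite -{1}[p]coefK poly_def scaler_sumr.
have -> : \sum_(k < N.+1) ('C(N, k)%:R * bern_coef M N p k) *: bern M N k =
  \sum_(i < size p) (p`_i * M ^+ i) *: \sum_(k < N.+1)
     ('C(N, k)%:R * ('C(k, i)%:R / 'C(N, i)%:R)) *: bern M N k.
  under [RHS]eq_bigr => i _ do rewrite scaler_sumr.
  rewrite exchange_big/=; apply: eq_bigr => k _.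
  rewrite /bern_coef mulr_sumr scaler_suml; apply: eq_bigr => i _.
  by rewrite scalerA; congr (_ *: _); ring.
apply: eq_bigr => i _; have iN : (i <= N)%N by rewrite ltnW// (leq_trans _ pN).
rewrite bern_monomial// !scalerA; congr (_ *: _).
by rewrite -{1}(subnK iN) exprD; ring.
Qed.

Definition bern_err M p : R := \sum_(i < size p) `|p`_i| * M ^+ i * (i ^ 2)%:R.

Lemma bern_coef_le M N p k : 0 <= M -> (0 < N)%N -> (size p <= N)%N ->
  (k <= N)%N ->
  `|bern_coef M N p k - p.[k%:R / N%:R * M]| <= bern_err M p / N%:R.
Proof.
move=> M0 N0 pN kN; rewrite horner_coef -sumrB.
apply: (le_trans (ler_norm_sum _ _ _)); rewrite /bern_err mulr_suml.
apply: ler_sum => i _; rewrite exprMn.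
have -> : p`_i * M ^+ i * ('C(k, i)%:R / 'C(N, i)%:R) -
    p`_i * ((k%:R / N%:R) ^+ i * M ^+ i) =
    (p`_i * M ^+ i) * ('C(k, i)%:R / 'C(N, i)%:R - (k%:R / N%:R) ^+ i) by ring.
rewrite normrM normrM (ger0_norm (exprn_ge0 _ M0)) -[leRHS]mulrA ler_wpM2l//.
  by rewrite mulr_ge0// exprn_ge0.
by apply: bin_ratio_le => //; rewrite ltnW// (leq_trans _ pN).
Qed.

Section positive_functional.
Variables (M : R) (L : {poly R} -> R).
Hypothesis M0 : 0 < M.
Hypothesis Llin : forall a p q, L (a *: p + q) = a * L p + L q.
Hypothesis Lsq : forall q, 0 <= L (q ^+ 2).
Hypothesis LXsq : forall q, 0 <= L ('X * q ^+ 2).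
Hypothesis LMXsq : forall q, 0 <= L ((M%:P - 'X) * q ^+ 2).

Let L0 : L 0 = 0.
Proof. by have := Llin 1 0 0; rewrite scale1r addr0 => h; lra. Qed.

Let LD p q : L (p + q) = L p + L q.
Proof. by have := Llin 1 p q; rewrite scale1r mul1r. Qed.

Let LZ a p : L (a *: p) = a * L p.
Proof. by have := Llin a p 0; rewrite !addr0 L0 addr0. Qed.

Let Lsum n (F : nat -> {poly R}) : L (\sum_(i < n) F i) = \sum_(i < n) L (F i).
Proof. by elim: n => [|n IH]; rewrite ?big_ord0// !big_ord_recr/= LD IH. Qed.

(** The parities of k and N - k decide whether a factor X or M - X is left beside a square. When
    both are left, M X (M - X) = X (M - X)^2 + (M - X) X^2 reduces to the two hypotheses with one
    factor. *)
Lemma functional_bern_ge0 N k : 0 <= L (bern M N k).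
Proof.
rewrite /bern; set j := (N - k)%N; set Y := M%:P - 'X.
rewrite -(odd_double_half k) -(odd_double_half j).
set a := k./2; set b := j./2.
rewrite !exprD -!muln2 !exprM.
have e (b1 b2 : bool) : 'X^b1 * ('X^a) ^+ 2 * (Y ^+ b2 * (Y ^+ b) ^+ 2) =
  'X^b1 * Y ^+ b2 * ('X^a * Y ^+ b) ^+ 2 by rewrite [in RHS]exprMn; ring.
rewrite ![(_ ^+ _ ^+ 2)%R]exprAC in e *; rewrite e.
case: (odd k); case: (odd j); rewrite ?expr1 ?expr0 ?mulr1 ?mul1r//.
set q := 'X^_ * _.
suff : 0 <= M * L ('X * Y * q ^+ 2) by rewrite pmulr_rge0.
rewrite -LZ.
have -> : M *: ('X * Y * q ^+ 2) = 'X * (Y * q) ^+ 2 + Y * ('X * q) ^+ 2.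
  by rewrite -mul_polyC /Y; ring.
by rewrite LD addr_ge0.
Qed.

(** The degree N Bernstein coefficients of [p] are within [bern_err] M p / N of its nonnegative
    samples at k M / N. Since the basis polynomials weighted by 'C(N, k) sum to M^N, this gives L p
    >= - ([bern_err] M p / N) L 1, and N is taken large enough to contradict L p < 0. *)
Lemma functional_ge0 p : (forall t, 0 <= t <= M -> 0 <= p.[t]) -> 0 <= L p.
Proof.
move=> p0; rewrite leNgt; apply/negP => Lp0.
have L10 : 0 <= L 1 by have := Lsq 1; rewrite expr1n.
have E0 : 0 <= bern_err M p.
  by apply: sumr_ge0 => i _; rewrite !mulr_ge0// exprn_ge0// ltW.
pose N := maxn (size p) (Num.truncn (bern_err M p * L 1 / - L p)).+1.
have N0 : (0 < N)%N by rewrite leq_max orbT.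
have pN : (size p <= N)%N by rewrite leq_max leqnn.
have N0' : 0 < N%:R :> R by rewrite ltr0n.
have key : - (bern_err M p / N%:R) * L 1 <= L p.
  have MN : 0 < M ^+ N by rewrite exprn_gt0.
  rewrite -(ler_pM2l MN) -[leRHS]LZ (bern_expansion M pN).
  rewrite (Lsum _ (fun k => ('C(N, k)%:R * bern_coef M N p k) *: bern M N k)).
  have -> : M ^+ N * (- (bern_err M p / N%:R) * L 1) =
      \sum_(k < N.+1) 'C(N, k)%:R * - (bern_err M p / N%:R) * L (bern M N k).
    rewrite mulrCA -LZ.
    have := bern_monomial M (leq0n N); rewrite subn0 expr0 => <-.
    rewrite (Lsum _ (fun k => ('C(N, k)%:R * ('C(k, 0)%:R / 'C(N, 0)%:R)) *: bern M N k)).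
    rewrite mulr_sumr; apply: eq_bigr => k _.
    by rewrite LZ !bin0 divr1 mulr1; ring.
  apply: ler_sum => k _; rewrite LZ ler_wpM2r ?functional_bern_ge0// ler_wpM2l//.
  have kN : (k <= N)%N by rewrite -ltnS.
  have := bern_coef_le (ltW M0) N0 pN kN; rewrite ler_norml => /andP[+ _].
  have : 0 <= p.[k%:R / N%:R * M].
    apply: p0; rewrite mulr_ge0 ?divr_ge0 ?(ltW M0)//=.
    by rewrite -[leRHS]mul1r ler_pM2r// ler_pdivrMr// mul1r ler_nat.
  lra.
have : bern_err M p * L 1 / - L p < N%:R.
  apply: (lt_le_trans (truncnS_gt _)); by rewrite ler_nat leq_max leqnn orbT.
rewrite ltr_pdivrMr ?oppr_gt0//.
rewrite mulNr lerNl in key.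
have : - L p * N%:R <= bern_err M p * L 1.
  rewrite -ler_pdivlMr// (le_trans key)//.
  by rewrite le_eqVlt; apply/orP; left; apply/eqP; ring.
by rewrite mulrC; lra.
Qed.

End positive_functional.

(** Only M = 0 is new. There L is nonnegative on both X q^2 and - X q^2, so it vanishes on them,
    hence by polarization on all multiples of X, and L p = p(0) L 1. The case is needed because an
    operator may have norm bound 0. *)
Lemma functional_ge0_itv M L : 0 <= M ->
  (forall a p q, L (a *: p + q) = a * L p + L q) ->
  (forall q, 0 <= L (q ^+ 2)) -> (forall q, 0 <= L ('X * q ^+ 2)) ->
  (forall q, 0 <= L ((M%:P - 'X) * q ^+ 2)) ->
  forall p, (forall t, 0 <= t <= M -> 0 <= p.[t]) -> 0 <= L p.
Proof.
rewrite le_eqVlt => /orP[/eqP <-|M0]; last exact: functional_ge0.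
move=> Llin Lsq LXsq LNXsq p p0.
have LNX q : L ('X * q ^+ 2) <= 0.
  have := Llin (-1) ('X * q ^+ 2) ('X * q ^+ 2).
  have := Llin 1 0 0; rewrite scale1r addr0 scaleN1r addNr => h.
  have := LNXsq q; rewrite sub0r mulNr => h1 h2.
  have := Llin (-1) ('X * q ^+ 2) 0; rewrite addr0 scaleN1r => h3; lra.
have LX0 q : L ('X * q ^+ 2) = 0 by apply/eqP; rewrite eq_le LNX LXsq.
have LX r : L (r * 'X) = 0.
  have -> : r * 'X = 4^-1 *: ('X * (r + 1) ^+ 2 + (- 1) *: ('X * (r - 1) ^+ 2)) + 0.
    apply: (@scalerI _ _ (4 : R)); first by rewrite pnatr_eq0.
    rewrite addr0 scalerA divff ?pnatr_eq0// scale1r scaleN1r.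
    by rewrite -[4%R]/(4%:R) scaler_nat -mulr_natl; ring.
  rewrite Llin -[X in L (X + _)]scale1r Llin LX0 -[_ *: _]addr0 Llin LX0.
  by have := Llin 1 0 0; rewrite scale1r addr0; lra.
have /factor_theorem[r] : root (p - p.[0]%:P) 0.
  by rewrite /root !hornerE subrr.
rewrite subr0 => /eqP; rewrite subr_eq addrC => /eqP ->.
have := Llin p.[0] 1 (r * 'X); rewrite LX addr0 -mul_polyC mulr1 => ->.
rewrite mulr_ge0//; first by apply: p0; rewrite lexx.
by have := Lsq 1; rewrite expr1n.
Qed.

Definition bern_approx M N (f : R -> R) : {poly R} :=
  \sum_(k < N.+1) (f (k%:R / N%:R * M) * ('C(N, k)%:R / M ^+ N)) *: bern M N k.

(** Bernstein's probabilistic proof. The [w k] are binomial weights on the points k M / N with mean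
    t, and the quadratic modulus of continuity asked of [f] is exactly what their variance
    controls. *)
Lemma bern_weierstrass M (f : R -> R) : 0 < M ->
  (forall eps : R, 0 < eps -> exists2 C : R, 0 <= C & forall s t : R,
     0 <= s <= M -> 0 <= t <= M -> `|f s - f t| <= eps + C * (s - t) ^+ 2) ->
  forall eps : R, 0 < eps ->
  exists p : {poly R}, forall t, 0 <= t <= M -> `|p.[t] - f t| <= eps.
Proof.
move=> M0 fC eps e0.
have [C C0 fCe] := fC (eps / 2) (divr_gt0 e0 (ltr0Sn _ 1)).
(* Bounds [bern_err] of (X - t)^2 = t^2 - 2 t X + X^2 for 0 <= t <= M: the linear term contributes 2
   t M and the quadratic one 4 M^2. *)
pose E := 6 * M ^+ 2.
have E0 : 0 <= E by rewrite mulr_ge0// exprn_ge0// ltW.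
(* 3 is the size of (X - t)^2, and the other term makes C E / N at most eps / 2. *)
pose N := maxn 3 (Num.truncn (C * E / (eps / 2))).+1.
have N0 : (0 < N)%N by rewrite leq_max.
have N0' : 0 < N%:R :> R by rewrite ltr0n.
exists (bern_approx M N f) => t tM; have /andP[t0 t1] := tM.
pose w (k : nat) := 'C(N, k)%:R / M ^+ N * (bern M N k).[t].
have MN : 0 < M ^+ N by rewrite exprn_gt0.
have w0 k : 0 <= w k.
  rewrite mulr_ge0 ?divr_ge0 ?(ltW MN)// /bern hornerM horner_exp hornerX.
  rewrite horner_exp !hornerE mulr_ge0// exprn_ge0//; lra.
have wp p : (size p <= N)%N -> p.[t] = \sum_(k < N.+1) w k * bern_coef M N p k.
  move=> pN; have /(congr1 (fun q => q.[t])) := bern_expansion M pN.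
  rewrite hornerZ horner_sum => e.
  apply: (mulfI (lt0r_neq0 MN)); rewrite e mulr_sumr.
  by apply: eq_bigr => k _; rewrite hornerZ /w; field; rewrite gt_eqF.
have w1 : \sum_(k < N.+1) w k = 1.
  have := wp 1; rewrite size_poly1 => /(_ N0); rewrite hornerC => ->.
  apply: eq_bigr => k _; rewrite /bern_coef size_poly1 big_ord1.
  by rewrite !bin0 coef1 expr0 divr1 !mulr1.
have -> : (bern_approx M N f).[t] = \sum_(k < N.+1) w k * f (k%:R / N%:R * M).
  rewrite horner_sum; apply: eq_bigr => k _; rewrite hornerZ /w; ring.
have -> : f t = \sum_(k < N.+1) w k * f t by rewrite -mulr_suml w1 mul1r.
rewrite -sumrB; apply: (le_trans (ler_norm_sum _ _ _)).
have kM (k : 'I_N.+1) : 0 <= k%:R / N%:R * M <= M.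
  rewrite mulr_ge0 ?divr_ge0 ?(ltW M0)//=.
  by rewrite -[leRHS]mul1r ler_pM2r// ler_pdivrMr// mul1r ler_nat -ltnS.
apply: (@le_trans _ _ (\sum_(k < N.+1)
    (w k * (eps / 2) + C * (w k * (k%:R / N%:R * M - t) ^+ 2)))).
  apply: ler_sum => k _; rewrite -mulrBr normrM ger0_norm//.
  have -> : w k * (eps / 2) + C * (w k * (k%:R / N%:R * M - t) ^+ 2) =
    w k * (eps / 2 + C * (k%:R / N%:R * M - t) ^+ 2) by ring.
  by rewrite ler_wpM2l// fCe.
rewrite big_split/= -mulr_suml w1 mul1r -mulr_sumr.
suff : C * \sum_(k < N.+1) w k * (k%:R / N%:R * M - t) ^+ 2 <= eps / 2 by lra.
pose p := ('X - t%:P) ^+ 2.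
have sp : size p = 3%N by rewrite /p size_exp_XsubC.
have pN : (size p <= N)%N by rewrite sp leq_max.
have hp s : p.[s] = (s - t) ^+ 2 by rewrite /p horner_exp !hornerE.
have var : \sum_(k < N.+1) w k * (k%:R / N%:R * M - t) ^+ 2 <= E / N%:R.
  have errE : bern_err M p <= E.
    rewrite /bern_err sp !big_ord_recr big_ord0/= /p !exprS !expr0 !mulr1.
    rewrite !(coefMr, big_ord_recr, big_ord0, coefB, coefX, coefC)/=.
    rewrite ?(mulr0,mul0r,add0r,addr0,subr0,mulr1,mul1r,sub0r,expr1).
    rewrite oppr0 mul0r mulr0 add0r addr0 normr1 mul1r -opprD normrN.
    rewrite (_ : (2 ^ 2)%N = 4%N)// ger0_norm; last lra.
    by rewrite /E expr2; nra.
  apply: (@le_trans _ _ (bern_err M p / N%:R)); last first.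
    by rewrite ler_pM2r// invr_gt0.
  (* The exact expansion of (X - t)^2 has value 0 at t, so the variance is the weighted sum of the
     differences between samples and Bernstein coefficients. *)
  have : 0 = \sum_(k < N.+1) w k * bern_coef M N p k.
    by rewrite -wp// hp subrr expr0n.
  move=> e; rewrite -[leLHS]subr0 [X in _ - X]e -sumrB.
  have -> : bern_err M p / N%:R = \sum_(k < N.+1) w k * (bern_err M p / N%:R).
    by rewrite -mulr_suml w1 mul1r.
  apply: ler_sum => k _; rewrite -mulrBr ler_wpM2l//.
  have kN : (k <= N)%N by rewrite -ltnS.
  have := bern_coef_le (ltW M0) N0 pN kN.
  rewrite hp distrC => h.
  exact: (le_trans (ler_norm _) h).
apply: (le_trans (ler_wpM2l C0 var)).
rewrite mulrA ler_pdivrMr// [leRHS]mulrC -ler_pdivrMr ?divr_gt0//.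
by rewrite (le_trans (ltW (truncnS_gt _)))// ler_nat leq_max leqnn orbT.
Qed.

End bernstein.

(** * Complex numbers and Hilbert spaces *)

Lemma cvg0_le (R : realType) T (F : set_system T) (FF : Filter F) (u v : T -> R) :
  (forall x, 0 <= u x <= v x) ->
  v x @[x --> F] --> (0 : R) -> u x @[x --> F] --> (0 : R).
Proof.
move=> uv /cvgrPdist_le v0; apply/cvgrPdist_le => e /v0; apply: filterS => x.
have /andP[u0 uvx] := uv x.
by rewrite !sub0r !normrN !ger0_norm//; [exact: le_trans|exact: le_trans uvx].
Qed.

Section complex_lemmas.
Variable R : realType.
Implicit Types z w : R[i].

Lemma cReD z w : complex.Re (z + w) = complex.Re z + complex.Re w.
Proof. by case: z => a b; case: w. Qed.

Lemma cImD z w : complex.Im (z + w) = complex.Im z + complex.Im w.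
Proof. by case: z => a b; case: w. Qed.

Lemma cReN z : complex.Re (- z) = - complex.Re z.
Proof. by case: z. Qed.

Lemma cImN z : complex.Im (- z) = - complex.Im z.
Proof. by case: z. Qed.

Lemma cReM z w :
  complex.Re (z * w) = complex.Re z * complex.Re w - complex.Im z * complex.Im w.
Proof. by case: z => a b; case: w. Qed.

Lemma cImM z w :
  complex.Im (z * w) = complex.Re z * complex.Im w + complex.Im z * complex.Re w.
Proof. by case: z => a b; case: w. Qed.

Lemma cReJ z : complex.Re (z^*)%R = complex.Re z.
Proof. by case: z. Qed.

Lemma cImJ z : complex.Im (z^*)%R = - complex.Im z.
Proof. by case: z. Qed.

Lemma complex_eqP z w :
  complex.Re z = complex.Re w -> complex.Im z = complex.Im w -> z = w.
Proof. by case: z => a b; case: w => c d /= -> ->. Qed.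

Lemma Re_sum I (r : seq I) (P : pred I) (F : I -> R[i]) :
  complex.Re (\sum_(i <- r | P i) F i) = \sum_(i <- r | P i) complex.Re (F i).
Proof. exact: (big_morph _ cReD (erefl _)). Qed.

Lemma normsq_ge0 z : 0 <= normsq z.
Proof. by rewrite /normsq addr_ge0// sqr_ge0. Qed.

Lemma mulcJ z : z * (z^*)%R = (normsq z)%:C.
Proof. by apply: complex_eqP; rewrite ?cReM ?cImM cReJ cImJ /normsq /=; ring. Qed.

Lemma normsqM z w : normsq (z * w) = normsq z * normsq w.
Proof. by rewrite /normsq cReM cImM; ring. Qed.

Lemma normsqJ z : normsq (z^*)%R = normsq z.
Proof. by rewrite /normsq cReJ cImJ sqrrN. Qed.

Lemma normsq_real (x : R) : normsq x%:C = x ^+ 2.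
Proof. by rewrite /normsq /= expr0n addr0. Qed.

Lemma normsq0 : normsq (0 : R[i]) = 0.
Proof. by rewrite (normsq_real 0) expr0n. Qed.

Lemma normsq_eq0 z : normsq z = 0 -> z = 0.
Proof.
move/eqP; rewrite paddr_eq0 ?sqr_ge0// !sqrf_eq0 => /andP[/eqP a /eqP b].
exact: complex_eqP.
Qed.

Lemma normc_normsq z : Normc.normc z = Num.sqrt (normsq z).
Proof. by case: z. Qed.

Lemma sqr_normc_normsq z : Normc.normc z ^+ 2 = normsq z.
Proof. by rewrite normc_normsq sqr_sqrtr// normsq_ge0. Qed.

Lemma normc_ge0 z : 0 <= Normc.normc z.
Proof. by rewrite normc_normsq sqrtr_ge0. Qed.

Lemma ler_normc_Re z : `|complex.Re z| <= Normc.normc z.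
Proof.
by rewrite normc_normsq -sqrtr_sqr ler_wsqrtr// /normsq lerDl sqr_ge0.
Qed.

Lemma ler_normc_Im z : `|complex.Im z| <= Normc.normc z.
Proof.
by rewrite normc_normsq -sqrtr_sqr ler_wsqrtr// /normsq lerDr sqr_ge0.
Qed.

Lemma ler_normc_ReIm z : Normc.normc z <= `|complex.Re z| + `|complex.Im z|.
Proof.
rewrite normc_normsq -(ler_pXn2r (ltn0Sn 1)) ?nnegrE ?sqrtr_ge0 ?addr_ge0//.
rewrite sqr_sqrtr ?normsq_ge0// /normsq sqrrD !real_normK ?num_real//.
have : 0 <= `|complex.Re z| * `|complex.Im z| by rewrite mulr_ge0.
lra.
Qed.

Lemma normc_real (x : R) : Normc.normc x%:C = `|x|.
Proof. by rewrite normc_normsq normsq_real sqrtr_sqr. Qed.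

Lemma conjcR (x : R) : ((x%:C)^*)%R = x%:C :> R[i].
Proof. by apply: complex_eqP => //=; rewrite oppr0. Qed.

Lemma cvg_complex T (F : set_system T) (FF : Filter F) (f : T -> R[i]) z :
  Normc.normc (f x - z) @[x --> F] --> (0 : R) ->
  (f x : R[i]^o) @[x --> F] --> (z : R[i]^o).
Proof.
move=> fz; apply/cvgrPdist_lt => e e0.
(* A positive element of [R[i]] is real, so the neighbourhoods of [R[i]^o] are governed by real
   radii. *)
have e0' : 0 < complex.Re e by move: e0; rewrite ltcE => /andP[].
have ee : e = (complex.Re e)%:C.
  move: e0; rewrite ltcE => /andP[/eqP ie _].
  by apply: complex_eqP => //=; rewrite ie.
move/cvgrPdist_lt : fz => /(_ _ e0'); apply: filterS => x.
rewrite sub0r normrN ger0_norm ?normc_ge0// distrC ee => h.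
by rewrite [`| _ |]/(Num.norm _) /= ltcR.
Qed.

End complex_lemmas.

Section hilbert_space.
Context {R : realType} {V : lmodType R[i]}.
Variables (ip : V -> V -> R[i]) (H : set V).

(** The axioms are relative to [H], because [inner] is an integral that is meaningful only for
    square integrable functions. Definiteness is not among them: null functions have norm 0, so
    limits are unique up to norm 0. *)
Record hilbert := Hilbert {
  hilbert0 : H 0;
  hilbertP : forall a f g, H f -> H g -> H (a *: f + g);
  ip_linear : forall a f g h, H f -> H g -> H h ->
    ip (a *: f + g) h = a * ip f h + ip g h;
  ip_conj : forall f g, H f -> H g -> ip g f = ((ip f g)^*)%R;
  ip_ge0 : forall f, H f -> 0 <= complex.Re (ip f f);
  hilbert_complete : forall u : nat -> V, (forall k, H (u k)) ->
    (forall eps : R, 0 < eps -> exists N : nat, forall j k : nat,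
      (N <= j)%N -> (N <= k)%N -> ip_norm ip (u j - u k) <= eps) ->
    exists2 f, H f & ip_norm ip (u k - f) @[k --> \oo] --> 0 }.

Hypothesis hH : hilbert.
Implicit Types (f g h : V) (a : R[i]) (e : nat -> V).
Local Notation N := (ip_norm ip).
Let nsq f : R := complex.Re (ip f f).

Lemma hD f g : H f -> H g -> H (f + g).
Proof. by move=> Hf Hg; rewrite -[f]scale1r; apply: hilbertP. Qed.

Lemma hZ a f : H f -> H (a *: f).
Proof.
by move=> Hf; rewrite -[_ *: _]addr0; apply: hilbertP => //; exact: hilbert0.
Qed.

Lemma hN f : H f -> H (- f).
Proof. by move=> Hf; rewrite -scaleN1r; exact: hZ. Qed.

Lemma hB f g : H f -> H g -> H (f - g).
Proof. by move=> Hf Hg; apply: hD => //; exact: hN. Qed.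

Lemma h_sum n (F : nat -> V) : (forall i, (i < n)%N -> H (F i)) ->
  H (\sum_(i < n) F i).
Proof.
elim: n => [|n IH] HF; first by rewrite big_ord0; exact: hilbert0.
by rewrite big_ord_recr/=; apply: hD; [apply: IH => i /ltnW/HF|exact: HF].
Qed.

Lemma ip0l f : H f -> ip 0 f = 0.
Proof.
move=> Hf; have H0 := hilbert0 hH.
have := ip_linear hH 1 H0 H0 Hf; rewrite scale1r addr0 mul1r => h.
by apply: (@addrI _ (ip 0 f)); rewrite -h addr0.
Qed.

Lemma ipDl f g h : H f -> H g -> H h -> ip (f + g) h = ip f h + ip g h.
Proof.
by move=> Hf Hg Hh; have := ip_linear hH 1 Hf Hg Hh; rewrite scale1r mul1r.
Qed.

Lemma ipZl a f h : H f -> H h -> ip (a *: f) h = a * ip f h.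
Proof.
move=> Hf Hh; have := ip_linear hH a Hf (hilbert0 hH) Hh.
by rewrite addr0 ip0l// addr0.
Qed.

Lemma ipNl f h : H f -> H h -> ip (- f) h = - ip f h.
Proof. by move=> Hf Hh; rewrite -scaleN1r ipZl// mulN1r. Qed.

Lemma ipBl f g h : H f -> H g -> H h -> ip (f - g) h = ip f h - ip g h.
Proof. by move=> Hf Hg Hh; rewrite ipDl ?ipNl//; exact: hN. Qed.

Lemma ip0r f : H f -> ip f 0 = 0.
Proof.
move=> Hf; have H0 := hilbert0 hH.
by rewrite (ip_conj hH H0 Hf) ip0l// conjC0.
Qed.

Lemma ipDr f g h : H f -> H g -> H h -> ip h (f + g) = ip h f + ip h g.
Proof.
move=> Hf Hg Hh; rewrite (ip_conj hH (hD Hf Hg) Hh) ipDl// rmorphD/=.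
by rewrite -(ip_conj hH Hf Hh) -(ip_conj hH Hg Hh).
Qed.

Lemma ipZr a f h : H f -> H h -> ip h (a *: f) = (a^*)%R * ip h f.
Proof.
by move=> Hf Hh; rewrite (ip_conj hH (hZ a Hf) Hh) ipZl// rmorphM/= -(ip_conj hH Hf Hh).
Qed.

Lemma ipNr f h : H f -> H h -> ip h (- f) = - ip h f.
Proof. by move=> Hf Hh; rewrite -scaleN1r ipZr// rmorphN rmorph1 mulN1r. Qed.

Lemma ipBr f g h : H f -> H g -> H h -> ip h (f - g) = ip h f - ip h g.
Proof. by move=> Hf Hg Hh; rewrite ipDr ?ipNr//; exact: hN. Qed.

Lemma ip_suml n (F : nat -> V) h : (forall i, (i < n)%N -> H (F i)) -> H h ->
  ip (\sum_(i < n) F i) h = \sum_(i < n) ip (F i) h.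
Proof.
move=> HF Hh; elim: n HF => [|n IH] HF; first by rewrite !big_ord0 ip0l.
have HF' i : (i < n)%N -> H (F i) by move/ltnW/HF.
by rewrite !big_ord_recr/= ipDl// ?IH//; [exact: h_sum|exact: HF].
Qed.

Lemma ip_sumr n (F : nat -> V) h : (forall i, (i < n)%N -> H (F i)) -> H h ->
  ip h (\sum_(i < n) F i) = \sum_(i < n) ip h (F i).
Proof.
move=> HF Hh; elim: n HF => [|n IH] HF; first by rewrite !big_ord0 ip0r.
have HF' i : (i < n)%N -> H (F i) by move/ltnW/HF.
by rewrite !big_ord_recr/= ipDr// ?IH//; [exact: h_sum|exact: HF].
Qed.

Lemma ip_self f : H f -> ip f f = (nsq f)%:C.
Proof.
move=> Hf; apply: complex_eqP => //=.
have /(congr1 (@complex.Im _)) := ip_conj hH Hf Hf; rewrite cImJ; lra.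
Qed.

Lemma sqr_ip_norm f : H f -> N f ^+ 2 = nsq f.
Proof. by move=> Hf; rewrite /ip_norm sqr_sqrtr// (ip_ge0 hH). Qed.

Lemma ip_norm_ge0 f : 0 <= N f.
Proof. exact: sqrtr_ge0. Qed.

Lemma nsqZ a f : H f -> nsq (a *: f) = normsq a * nsq f.
Proof.
move=> Hf; have Haf := hZ a Hf.
by rewrite /nsq ipZl// ipZr// mulrA mulcJ ip_self// cReM/= mul0r subr0.
Qed.

Lemma ip_normZ a f : H f -> N (a *: f) = Normc.normc a * N f.
Proof.
move=> Hf; have Haf := hZ a Hf.
apply: (@pexpIrn _ 2) => //.
- by rewrite nnegrE ip_norm_ge0.
- by rewrite nnegrE mulr_ge0 ?normc_ge0 ?ip_norm_ge0.
by rewrite exprMn !sqr_ip_norm// nsqZ// sqr_normc_normsq.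
Qed.

Lemma ip_normN f : H f -> N (- f) = N f.
Proof. by move=> Hf; rewrite /ip_norm ipNl ?ipNr ?opprK//; exact: hN. Qed.

Lemma ip_norm_distC f g : H f -> H g -> N (f - g) = N (g - f).
Proof. by move=> Hf Hg; rewrite -opprB ip_normN//; exact: hB. Qed.

Lemma nsqD f g : H f -> H g ->
  nsq (f + g) = nsq f + 2 * complex.Re (ip f g) + nsq g.
Proof.
move=> Hf Hg; have Hfg := hD Hf Hg.
rewrite /nsq ipDl// !ipDr// !cReD (ip_conj hH Hf Hg) cReJ; ring.
Qed.

Lemma nsqB f g : H f -> H g ->
  nsq (f - g) = nsq f - 2 * complex.Re (ip f g) + nsq g.
Proof.
move=> Hf Hg; have HNg := hN Hg.
by rewrite nsqD// ipNr// cReN /nsq ipNl// ipNr// opprK; ring.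
Qed.

(** Positivity of |f - t <f, g> g|^2 for real t, at t = |g|^-2. If |g| = 0, which does not force g =
    0, the expression is affine in t and a large t would make it negative unless <f, g> = 0. *)
Lemma cauchy_schwarz_sq f g : H f -> H g -> normsq (ip f g) <= nsq f * nsq g.
Proof.
move=> Hf Hg; set w := ip f g; set W := normsq w.
have W0 : 0 <= W := normsq_ge0 w.
have key (t : R) : 0 <= nsq f - 2 * t * W + t ^+ 2 * W * nsq g.
  have Hz := hZ (t%:C * w) Hg.
  have e1 : ((t%:C * w)^*)%R * w = (t * W)%:C.
    by apply: complex_eqP; rewrite !(cReM, cImM, cReJ, cImJ) /W /normsq /=; ring.
  have := ip_ge0 hH (hB Hf Hz); rewrite -/(nsq _) nsqB// ipZr// -/w e1.
  rewrite nsqZ// normsqM normsq_real -/W => h; apply: (le_trans h).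
  by rewrite le_eqVlt; apply/orP; left; apply/eqP => /=; ring.
have f0 : 0 <= nsq f := ip_ge0 hH Hf.
have : 0 <= nsq g := ip_ge0 hH Hg.
rewrite le_eqVlt => /orP[/eqP g0|g0].
  rewrite -g0 mulr0 leNgt; apply/negP => Wp.
  have := key ((nsq f + 1) / (2 * W)); rewrite -g0 mulr0 addr0.
  have -> : 2 * ((nsq f + 1) / (2 * W)) * W = nsq f + 1.
    by field; rewrite gt_eqF.
  lra.
have := key (nsq g)^-1.
have -> : nsq f - 2 * (nsq g)^-1 * W + (nsq g)^-1 ^+ 2 * W * nsq g =
   nsq f - W / nsq g by field; rewrite gt_eqF.
by rewrite subr_ge0 ler_pdivrMr.
Qed.

Lemma cauchy_schwarz f g : H f -> H g -> Normc.normc (ip f g) <= N f * N g.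
Proof.
move=> Hf Hg; rewrite normc_normsq /ip_norm -sqrtrM ?(ip_ge0 hH)//.
by rewrite ler_wsqrtr// cauchy_schwarz_sq.
Qed.

Lemma ip_norm0_ip f g : H f -> H g -> N f = 0 -> ip f g = 0.
Proof.
move=> Hf Hg f0; apply: normsq_eq0; rewrite -sqr_normc_normsq.
have := cauchy_schwarz Hf Hg; rewrite f0 mul0r => h.
have -> : Normc.normc (ip f g) = 0.
  by apply/eqP; rewrite eq_le h normc_ge0.
by rewrite expr0n.
Qed.

Lemma ip_normD f g : H f -> H g -> N (f + g) <= N f + N g.
Proof.
move=> Hf Hg; have Hfg := hD Hf Hg.
rewrite -(ler_pXn2r (ltn0Sn 1)) ?nnegrE ?addr_ge0 ?ip_norm_ge0//.
rewrite sqrrD !sqr_ip_norm// nsqD//.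
have := le_trans (ler_norm _) (le_trans (ler_normc_Re _) (cauchy_schwarz Hf Hg)).
lra.
Qed.

Lemma ip_normB_trans f g h : H f -> H g -> H h -> N (f - h) <= N (f - g) + N (g - h).
Proof.
move=> Hf Hg Hh; rewrite -[f](subrK g) -addrA.
by rewrite (addrK g); apply: ip_normD; exact: hB.
Qed.

Lemma ip_cvg u f g : (forall k, H (u k)) -> H f -> H g ->
  N (u k - f) @[k --> \oo] --> (0 : R) ->
  Normc.normc (ip (u k) g - ip f g) @[k --> \oo] --> (0 : R).
Proof.
move=> Hu Hf Hg uf; apply: (@cvg0_le _ _ _ _ _ (fun k => N (u k - f) * N g)).
  move=> k; rewrite normc_ge0/= -ipBl//; apply: cauchy_schwarz => //.
  exact: hB.
by rewrite -[X in _ --> X](mul0r (N g)); apply: cvgM => //; exact: cvg_cst.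
Qed.

End hilbert_space.

(** * Orthonormal bases *)

Lemma nondecreasing_bounded_cauchy (R : realType) (u : nat -> R) (B : R) :
  (forall k, u k <= u k.+1) -> (forall k, u k <= B) ->
  forall eps : R, 0 < eps -> exists M : nat, forall j k : nat,
    (M <= j)%N -> (j <= k)%N -> u k - u j <= eps.
Proof.
move=> unD uB eps e0.
have nd : nondecreasing_seq u by apply/nondecreasing_seqP.
have ubu : has_ubound (range u) by exists B => _ [k _ <-].
have /cvgrPdist_le /(_ _ e0) [M _ uM] := nondecreasing_cvgn nd ubu.
exists M => j k Mj jk.
have := uM j Mj; rewrite ger0_norm; last first.
  by rewrite subr_ge0; apply: sup_upper_bound; [split => //; exists (u 0%N), 0%N|exists j].
have : u k <= sup (range u).
  by apply: sup_upper_bound; [split => //; exists (u 0%N), 0%N|exists k].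
lra.
Qed.

Lemma le_cvg0 (R : realType) (x : R) (u : nat -> R) :
  (forall n, x <= u n) -> u n @[n --> \oo] --> (0 : R) -> x <= 0.
Proof.
move=> xu /cvgrPdist_le u0; apply/ler_addgt0Pr => e /u0[M _ HM]; rewrite add0r.
apply: (le_trans (xu M)); apply: le_trans (HM M (leqnn M)).
by rewrite sub0r normrN ler_norm.
Qed.

Section orthonormal_systems.
Context {R : realType} {V : lmodType R[i]}.
Variables (ip : V -> V -> R[i]) (H : set V).
Hypothesis hH : hilbert ip H.
Implicit Types (f g h : V) (a : R[i]) (e : nat -> V) (c d : nat -> R[i]) (n : nat).
Local Notation N := (ip_norm ip).
Local Notation nsq f := (complex.Re (ip f f)).

Definition orthonormal e := (forall j, H (e j)) /\
  forall j k, ip (e j) (e k) = (j == k)%:R.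

Definition onproj e n f : V := \sum_(j < n) ip f (e j) *: e j.

Section comb.
Variables (e : nat -> V) (eo : orthonormal e).
Let He j : H (e j). Proof. by case: eo. Qed.
Let eE j k : ip (e j) (e k) = (j == k)%:R. Proof. by case: eo => _ ->. Qed.

Definition oncomb (c : nat -> R[i]) n : V := \sum_(j < n) c j *: e j.

Lemma h_oncomb c n : H (oncomb c n).
Proof. by apply: (h_sum hH (F := fun j => c j *: e j)) => j _; exact: (hZ hH). Qed.

Lemma ip_oncomb c n f : H f -> ip (oncomb c n) f = \sum_(j < n) c j * ip (e j) f.
Proof.
move=> Hf; rewrite (ip_suml hH (F := fun j => c j *: e j))//; last first.
  by move=> j _; exact: (hZ hH).
by apply: eq_bigr => j _; rewrite (ipZl hH).
Qed.

Lemma ip_oncombr c n f : H f -> ip f (oncomb c n) = \sum_(j < n) ((c j)^*)%R * ip f (e j).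
Proof.
move=> Hf; rewrite (ip_sumr hH (F := fun j => c j *: e j))//; last first.
  by move=> j _; exact: (hZ hH).
by apply: eq_bigr => j _; rewrite (ipZr hH).
Qed.

Lemma ip_oncomb_basis c n k : (k < n)%N -> ip (oncomb c n) (e k) = c k.
Proof.
move=> kn; rewrite ip_oncomb// (bigD1 (Ordinal kn))//= eE eqxx mulr1 big1 ?addr0//.
by move=> j; rewrite -val_eqE/= eE => /negPf ->; rewrite mulr0.
Qed.

Lemma nsq_oncomb c n : nsq (oncomb c n) = \sum_(j < n) normsq (c j).
Proof.
rewrite ip_oncombr ?Re_sum; last exact: h_oncomb.
apply: eq_bigr => j _; rewrite ip_oncomb_basis//.
by rewrite mulrC mulcJ.
Qed.

Lemma oncombB c m n : (m <= n)%N ->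
  oncomb c n - oncomb c m = oncomb (fun j => if (j < m)%N then 0 else c j) n.
Proof.
move=> mn; apply/eqP; rewrite subr_eq; apply/eqP.
rewrite /oncomb -(subnKC mn); elim: (n - m)%N => [|k IH].
  rewrite addn0 [X in X + _]big1 ?add0r// => j _.
  by rewrite ltn_ord scale0r.
rewrite addnS !big_ord_recr/= IH ltnNge leq_addr/=.
by rewrite addrAC.
Qed.

Lemma nsq_oncombB c m n : (m <= n)%N ->
  nsq (oncomb c n - oncomb c m) =
  \sum_(j < n) normsq (c j) - \sum_(j < m) normsq (c j).
Proof.
move=> mn; rewrite oncombB// nsq_oncomb.
rewrite -(subnKC mn); elim: (n - m)%N => [|k IH].
  rewrite addn0 subrr big1// => j _; by rewrite ltn_ord normsq0.
rewrite addnS !big_ord_recr/= IH ltnNge leq_addr/=.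
by rewrite addrAC.
Qed.

(** Riesz-Fischer. Squared distances between partial sums are differences of the bounded monotone
    sums of |c j|^2, so the partial sums are Cauchy; their k-th coefficient is c k as soon as they
    have more than k terms. *)
Lemma oncomb_cvg c (B : R) : (forall n, \sum_(j < n) normsq (c j) <= B) ->
  exists h, [/\ H h, N (oncomb c n - h) @[n --> \oo] --> (0 : R) &
    forall k, ip h (e k) = c k].
Proof.
move=> cB.
have nd n : \sum_(j < n) normsq (c j) <= \sum_(j < n.+1) normsq (c j).
  by rewrite big_ord_recr/= lerDl normsq_ge0.
have [] := hilbert_complete hH (u := oncomb c).
- by move=> n; exact: h_oncomb.
- move=> eps e0.
  have [M HM] := nondecreasing_bounded_cauchy nd cB (exprn_gt0 2 e0).
  exists M => j k Mj Mk; wlog jk : j k Mj Mk / (k <= j)%N.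
    move=> hw; have [jk|/ltnW kj] := leqP k j; first exact: hw.
    by rewrite (ip_norm_distC hH); [exact: hw|exact: h_oncomb|exact: h_oncomb].
  rewrite -(ler_pXn2r (ltn0Sn 1)) ?nnegrE ?ip_norm_ge0 ?(ltW e0)//.
  rewrite (sqr_ip_norm hH); last by apply: (hB hH) => //; exact: h_oncomb.
  by rewrite nsq_oncombB//; exact: HM.
move=> h Hh hh; exists h; split => // k.
have := ip_cvg hH (h_oncomb c) Hh (He k) hh.
move=> /cvgrPdist_le hk; apply/eqP; rewrite -subr_eq0.
apply/eqP; apply: normsq_eq0; rewrite -sqr_normc_normsq; apply/eqP.
rewrite sqrf_eq0 eq_le normc_ge0 andbT; apply/ler_addgt0Pr => eps /hk.
move=> [M _ HM]; have := HM (maxn M k.+1); rewrite /= leq_maxl => /(_ isT).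
rewrite ip_oncomb_basis ?leq_maxr// sub0r normrN ger0_norm ?normc_ge0// add0r.
by rewrite -normcN opprB.
Qed.

Let projE n f : onproj e n f = oncomb (fun j => ip f (e j)) n.
Proof. by []. Qed.

Lemma h_onproj n f : H (onproj e n f).
Proof. by rewrite projE; exact: h_oncomb. Qed.

Lemma ip_onproj n f g : H g ->
  ip (onproj e n f) g = \sum_(j < n) ip f (e j) * ip (e j) g.
Proof. by move=> Hg; rewrite projE ip_oncomb. Qed.

Lemma nsq_onproj n f : nsq (onproj e n f) = \sum_(j < n) normsq (ip f (e j)).
Proof. by rewrite projE nsq_oncomb. Qed.

Lemma nsq_onprojB n f : H f ->
  nsq (f - onproj e n f) = nsq f - \sum_(j < n) normsq (ip f (e j)).
Proof.
move=> Hf; rewrite (nsqB hH)//; last exact: h_onproj.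
rewrite nsq_onproj projE ip_oncombr// Re_sum.
under eq_bigr => j _ do rewrite mulrC mulcJ/=.
ring.
Qed.

Lemma bessel n f : H f -> \sum_(j < n) normsq (ip f (e j)) <= nsq f.
Proof.
move=> Hf; rewrite -subr_ge0 -nsq_onprojB//; apply: (ip_ge0 hH).
by apply: (hB hH) => //; exact: h_onproj.
Qed.

Lemma onproj_norm_le n f : H f -> N (onproj e n f) <= N f.
Proof.
by move=> Hf; rewrite /ip_norm ler_wsqrtr// nsq_onproj; exact: bessel.
Qed.

Lemma parseval_partial_le n f g : H f -> H g ->
  Normc.normc (\sum_(j < n) ip f (e j) * ip (e j) g) <= N f * N g.
Proof.
move=> Hf Hg; rewrite -ip_onproj//.
apply: (le_trans (cauchy_schwarz hH (h_onproj n f) Hg)).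
by rewrite ler_wpM2r ?ip_norm_ge0// onproj_norm_le.
Qed.

Hypothesis ecvg : forall f, H f ->
  N (f - onproj e n f) @[n --> \oo] --> (0 : R).

Lemma onproj_cvg f : H f -> N (onproj e n f - f) @[n --> \oo] --> (0 : R).
Proof.
move=> Hf; under eq_cvg => n do rewrite (ip_norm_distC hH (h_onproj n f) Hf).
exact: ecvg.
Qed.

Lemma parseval f g : H f -> H g ->
  Normc.normc (\sum_(j < n) ip f (e j) * ip (e j) g - ip f g) @[n --> \oo] --> (0 : R).
Proof.
move=> Hf Hg; have := ip_cvg hH (fun n => h_onproj n f) Hf Hg (onproj_cvg Hf).
by under eq_cvg => n do rewrite ip_onproj//.
Qed.

(* The coefficients of the representing vector are the values of the functional
   on the basis; they are square summable because the functional is bounded on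
   its own partial sums. *)
Lemma riesz (l : V -> R[i]) (C : R) : 0 <= C ->
  (forall a f g, H f -> H g -> l (a *: f + g) = (a^*)%R * l f + l g) ->
  (forall f, H f -> Normc.normc (l f) <= C * N f) ->
  exists2 h, H h & forall g, H g -> ip h g = l g.
Proof.
move=> C0 llin lC; pose c j := l (e j).
have H0 := hilbert0 hH.
have l0 : l 0 = 0.
  have := llin 1 _ _ H0 H0; rewrite scale1r addr0 rmorph1 mul1r => h.
  by apply: (@addrI _ (l 0)); rewrite -h addr0.
have lcomb d n : l (oncomb d n) = \sum_(j < n) ((d j)^*)%R * c j.
  elim: n => [|n IH]; first by rewrite /oncomb !big_ord0.
  rewrite /oncomb !big_ord_recr/= addrC llin//; last exact: h_oncomb.
  by rewrite -/(oncomb d n) IH addrC.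
have cB n : \sum_(j < n) normsq (c j) <= C ^+ 2.
  set S := \sum_(j < n) _.
  have S0 : 0 <= S by apply: sumr_ge0 => j _; exact: normsq_ge0.
  have := lC _ (h_oncomb c n).
  have -> : l (oncomb c n) = S%:C.
    rewrite lcomb /S rmorph_sum/=; apply: eq_bigr => j _.
    by rewrite mulrC mulcJ.
  rewrite normc_real ger0_norm// /ip_norm nsq_oncomb -/S => h.
  have [->|Sn0] := eqVneq S 0; first exact: sqr_ge0.
  have Sp : 0 < Num.sqrt S by rewrite sqrtr_gt0 lt_neqAle eq_sym Sn0.
  have h2 : Num.sqrt S <= C.
    by rewrite -(ler_pM2r Sp) -expr2 sqr_sqrtr.
  by rewrite -[leLHS]sqr_sqrtr// ler_pXn2r ?nnegrE ?sqrtr_ge0.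
have [h [Hh hh hc]] := oncomb_cvg cB; exists h => // g Hg.
apply/eqP; rewrite -subr_eq0; apply/eqP; apply: normsq_eq0.
rewrite -sqr_normc_normsq; apply/eqP; rewrite sqrf_eq0 eq_le normc_ge0 andbT.
have Hgn n : H (g - onproj e n g) by apply: (hB hH) => //; exact: h_onproj.
have key n : Normc.normc (ip h g - l g) <= (N h + C) * N (g - onproj e n g).
  have -> : ip h g - l g = ip h (g - onproj e n g) - l (g - onproj e n g).
    have eh : ip h (onproj e n g) = l (onproj e n g).
      rewrite projE lcomb ip_oncombr//; apply: eq_bigr => j _; by rewrite hc.
    have -> : l (g - onproj e n g) = l g - l (onproj e n g).
      rewrite addrC -scaleN1r llin//; last exact: h_onproj.
      by rewrite rmorphN rmorph1 mulN1r addrC.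
    rewrite (ipBr hH)//; last exact: h_onproj.
    by rewrite eh; ring.
  apply: (le_trans (le_normcD _ _)); rewrite normcN mulrDl lerD ?lC//.
  exact: (cauchy_schwarz hH).
apply: le_cvg0 key _; rewrite -[X in _ --> X](mulr0 (N h + C)).
by apply: cvgM; [exact: cvg_cst|exact: ecvg].
Qed.

End comb.

(** Finite version, for use while Gram-Schmidt is under way and only the first n vectors are known
    to be orthonormal. *)
Definition orthonormal_upto n e := (forall j, (j < n)%N -> H (e j)) /\
  forall j k, (j < n)%N -> (k < n)%N -> ip (e j) (e k) = (j == k)%:R.

Lemma h_onproj_upto n e f : orthonormal_upto n e -> H (onproj e n f).
Proof.
move=> [He _]; apply: (h_sum hH (F := fun j => ip f (e j) *: e j)) => j jn.
by apply: (hZ hH); exact: He.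
Qed.

Lemma ip_residual n e f k : orthonormal_upto n e -> H f -> (k < n)%N ->
  ip (f - onproj e n f) (e k) = 0.
Proof.
move=> eo Hf kn; have [He eE] := eo.
rewrite (ipBl hH)//; [|exact: h_onproj_upto|exact: He].
rewrite (ip_suml hH (F := fun j => ip f (e j) *: e j)); last 2 first.
  by move=> j jn; apply: (hZ hH); exact: He.
  exact: He.
rewrite (bigD1 (Ordinal kn))//= (ipZl hH) ?eE//; [|exact: He|exact: He].
rewrite eqxx mulr1 big1 ?addr0 ?subrr// => j; rewrite -val_eqE/= => /negPf jk.
by rewrite (ipZl hH) ?eE ?jk ?mulr0//; exact: He.
Qed.

Lemma nsq_residual n e f : orthonormal_upto n e -> H f ->
  nsq (f - onproj e n f) = nsq f - \sum_(j < n) normsq (ip f (e j)).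
Proof.
move=> eo Hf; have [He eE] := eo; have Hp := h_onproj_upto f eo.
have Hr : H (f - onproj e n f) := hB hH Hf Hp.
rewrite (ipBr hH Hf Hp Hr).
rewrite [X in _ - X](_ : _ = 0); last first.
  rewrite (ip_sumr hH (F := fun j => ip f (e j) *: e j))//; last first.
    by move=> j jn; apply: (hZ hH); exact: He.
  rewrite big1// => j _; rewrite (ipZr hH)//; last exact: He.
  by rewrite ip_residual// mulr0.
rewrite subr0 (ipBl hH)// cReD cReN; congr (_ - _).
rewrite (ip_suml hH (F := fun j => ip f (e j) *: e j))//; last first.
  by move=> j jn; apply: (hZ hH); exact: He.
rewrite Re_sum; apply: eq_bigr => j _; have Hj := He _ (ltn_ord j).
by rewrite (ipZl hH)// (ip_conj hH Hf Hj) mulcJ.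
Qed.

(** * Gram-Schmidt orthonormalization *)

Section gram_schmidt.
Variable d : nat -> V.
Hypothesis Hd : forall i, H (d i).
Hypothesis d_total :
  forall f, H f -> (forall i, ip f (d i) = 0) -> nsq f = 0.
Variable u : nat -> nat.
Hypothesis du_orth : forall i j, i != j -> ip (d (u i)) (d (u j)) = 0.
Hypothesis du_gt0 : forall i, 0 < nsq (d (u i)).

(** The orthogonal vectors d (u i) make the space infinite-dimensional. If the first n vectors e j
    spanned every d i, the squared coefficients of n + 1 of these vectors, once normalized, would
    sum to n + 1, while Bessel's inequality for each e j bounds the same sum by n. *)
Lemma gs_fresh n e : orthonormal_upto n e ->
  exists i, 0 < nsq (d i - onproj e n (d i)).
Proof.
move=> eo; have [He eE] := eo; apply: contrapT => /forallNP nex.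
have res0 i : \sum_(j < n) normsq (ip (d i) (e j)) = nsq (d i).
  have := nsq_residual eo (Hd i).
  have : 0 <= nsq (d i - onproj e n (d i)).
    by apply: (ip_ge0 hH); apply: (hB hH) => //; exact: h_onproj_upto.
  have : nsq (d i - onproj e n (d i)) <= 0 by rewrite leNgt; apply/negP/nex.
  lra.
pose v i := ((N (d (u i)))^-1)%:C *: d (u i).
have Nd i : 0 < N (d (u i)) by rewrite sqrtr_gt0.
have vo : orthonormal v.
  split=> [j|j k]; first exact: (hZ hH).
  rewrite (ipZl hH) ?(ipZr hH)//; last exact: (hZ hH).
  have [<-|jk] := eqVneq j k; last by rewrite du_orth// !mulr0.
  rewrite (ip_self hH)// -(sqr_ip_norm hH)// conjcR -!rmorphM/=.
  rewrite (_ : _ * _ = 1 :> R)//; by field; rewrite gt_eqF.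
have : \sum_(i < n.+1) \sum_(j < n) normsq (ip (v i) (e j)) = n.+1%:R.
  transitivity (\sum_(i < n.+1) (1 : R)); last by rewrite sumr_const card_ord.
  apply: eq_bigr => i _.
  transitivity (\sum_(j < n) (N (d (u i)) ^- 2 * normsq (ip (d (u i)) (e j)))).
    apply: eq_bigr => j _; rewrite (ipZl hH)//; last exact: He.
    by rewrite normsqM normsq_real exprVn.
  by rewrite -mulr_sumr res0 (sqr_ip_norm hH)// mulVf// gt_eqF.
have : \sum_(i < n.+1) \sum_(j < n) normsq (ip (v i) (e j)) <= n%:R.
  rewrite exchange_big/= -[leRHS]mulr_natl -[n in n%:R]card_ord -sumr_const mulr_suml.
  apply: ler_sum => j _; rewrite mul1r.
  have Hj := He _ (ltn_ord j).
  have := bessel vo n.+1 Hj; rewrite eE// eqxx/=.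
  under eq_bigr => i _ do rewrite (ip_conj hH (vo.1 i) Hj) normsqJ.
  done.
by move=> h1 h2; move: h1; rewrite h2 ler_nat ltnn.
Qed.

(** The vectors found so far are carried in a list, so that plain iteration defines the whole
    sequence although each vector depends on all previous ones. *)
Definition gs_res (s : seq V) f : V := f - \sum_(v <- s) ip f v *: v.

(** Vectors that depend on the earlier ones are skipped, hence the least index with a nonzero
    residual; [gs_fresh] shows that such an index exists. *)
Definition gs_idx s : nat := xget 0%N [set i | 0 < nsq (gs_res s (d i)) /\
  forall j, (j < i)%N -> ~ 0 < nsq (gs_res s (d j))].

Definition gs_next s : V :=
  ((N (gs_res s (d (gs_idx s))))^-1)%:C *: gs_res s (d (gs_idx s)).

Definition gs_seq n : seq V := iter n (fun s => rcons s (gs_next s)) [::].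

Definition gs_basis n : V := gs_next (gs_seq n).

Local Notation e := gs_basis.

Lemma gs_resE n f : gs_res (gs_seq n) f = f - onproj e n f.
Proof.
rewrite /gs_res /onproj; congr (_ - _); elim: n => [|n IH].
  by rewrite big_nil big_ord0.
by rewrite big_rcons/= big_ord_recr/= IH addrC.
Qed.

Lemma gs_idxP n : orthonormal_upto n e ->
  let i := gs_idx (gs_seq n) in 0 < nsq (d i - onproj e n (d i)) /\
  forall j, (j < i)%N -> nsq (d j - onproj e n (d j)) = 0.
Proof.
move=> eo; have [i Hi] := gs_fresh eo.
pose P i := `[< 0 < nsq (gs_res (gs_seq n) (d i)) >].
have exP : exists i, P i by exists i; apply/asboolP; rewrite gs_resE.
have [k /asboolP Pk kmin] := ex_minnP exP.
rewrite /gs_idx; case: xgetP => [j -> [jP jmin]|/(_ k)]; last first.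
  case; split => // j jk; apply/negP; apply/negP => /asboolP/kmin.
  by rewrite leqNgt jk.
rewrite gs_resE in jP; split => // m /jmin; rewrite gs_resE => /negP.
rewrite -leNgt => h; apply/eqP; rewrite eq_le h/=; apply: (ip_ge0 hH).
by apply: (hB hH) => //; exact: h_onproj_upto.
Qed.

Lemma gs_orthonormal_upto n : orthonormal_upto n e.
Proof.
elim: n => [|n IH]; first by split.
have [He eE] := IH; have [ip0 _] := gs_idxP IH.
have := Hd (gs_idx (gs_seq n)); move: ip0.
set di := d _ => r0 Hdi.
pose r := di - onproj e n di.
have Hr : H r by apply: (hB hH) => //; exact: h_onproj_upto.
have en : e n = ((N r)^-1)%:C *: r by rewrite /gs_basis /gs_next gs_resE.
have Hen : H (e n) by rewrite en; exact: (hZ hH).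
have He' j : (j < n.+1)%N -> H (e j).
  by rewrite ltnS leq_eqVlt => /orP[/eqP->//|/He].
have enn : ip (e n) (e n) = 1.
  rewrite en (ipZl hH) ?(ipZr hH)//; last exact: (hZ hH).
  rewrite (ip_self hH)// -(sqr_ip_norm hH)// conjcR -!rmorphM/=.
  have Nr : 0 < N r by rewrite sqrtr_gt0.
  by rewrite (_ : _ * _ = 1 :> R)//; field; rewrite gt_eqF.
have enk k : (k < n)%N -> ip (e n) (e k) = 0.
  move=> kn; rewrite en (ipZl hH) ?ip_residual ?mulr0//; exact: He.
split => // j k; rewrite !ltnS [(j <= n)%N]leq_eqVlt [(k <= n)%N]leq_eqVlt.
move=> /orP[/eqP->|jn] /orP[/eqP->|kn].
- by rewrite eqxx.
- by rewrite enk// gtn_eqF.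
- by rewrite (ip_conj hH Hen (He _ jn)) enk// conjC0 ltn_eqF.
- exact: eE.
Qed.

Lemma gs_orthonormal : orthonormal e.
Proof.
split=> [j|j k]; first by have [He _] := gs_orthonormal_upto j.+1; exact: He.
have [_ eE] := gs_orthonormal_upto (maxn j k).+1.
by apply: eE; rewrite ltnS ?leq_maxl ?leq_maxr.
Qed.

(** By induction the vector added at step m comes from an index at least m. If the index is larger,
    d m was already spanned; if it is m, the new basis vector absorbs the residual of d m. Residuals
    never grow afterwards. *)
Lemma gs_exhausts m i : (i < m)%N -> nsq (d i - onproj e m (d i)) = 0.
Proof.
elim: m i => // m IH i.
have res_ge0 k j : 0 <= nsq (d j - onproj e k (d j)).
  apply: (ip_ge0 hH); apply: (hB hH) => //; apply: h_onproj_upto.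
  exact: gs_orthonormal_upto.
have resS j : nsq (d j - onproj e m.+1 (d j)) =
    nsq (d j - onproj e m (d j)) - normsq (ip (d j) (e m)).
  rewrite !nsq_residual//; [|exact: gs_orthonormal_upto|exact: gs_orthonormal_upto].
  by rewrite big_ord_recr/=; ring.
have stays j : nsq (d j - onproj e m (d j)) = 0 ->
    nsq (d j - onproj e m.+1 (d j)) = 0.
  move=> h; have := res_ge0 m.+1 j; rewrite resS h.
  have := normsq_ge0 (ip (d j) (e m)); lra.
rewrite ltnS leq_eqVlt => /orP[/eqP->|im]; last by apply: stays; exact: IH.
have eo := gs_orthonormal_upto m.
have [pos zero] := gs_idxP eo.
have [mlt|ilt|meq] := ltngtP m (gs_idx (gs_seq m)).
- by apply: stays; exact: zero.
- by move: pos; rewrite IH// ltxx.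
rewrite -meq in pos; rewrite resS.
pose r := d m - onproj e m (d m).
have Hp := h_onproj_upto (d m) eo.
have Hr : H r by exact: (hB hH).
have em : e m = ((N r)^-1)%:C *: r by rewrite /gs_basis /gs_next gs_resE -meq.
have Nr : 0 < N r by rewrite sqrtr_gt0.
have He := gs_orthonormal.1.
have -> : ip (d m) (e m) = (N r)%:C.
  have -> : d m = r + onproj e m (d m) by rewrite subrK.
  rewrite (ipDl hH)// [X in _ + X](_ : _ = 0) ?addr0.
    rewrite em (ipZr hH)// (ip_self hH)// -(sqr_ip_norm hH)// conjcR -rmorphM/=.
    by congr (_%:C); field; rewrite gt_eqF.
  rewrite (ip_conj hH (He m) Hp) em (ipZl hH)//.
  rewrite (ip_sumr hH (F := fun j => ip (d m) (e j) *: e j))//; last first.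
    by move=> j jn; exact: (hZ hH).
  rewrite big1 ?mulr0 ?conjC0// => j _; rewrite (ipZr hH)// /r.
  by rewrite ip_residual// mulr0.
by rewrite normsq_real (sqr_ip_norm hH)// subrr.
Qed.

(** The projections of f converge to some h by [oncomb_cvg]. Then f - h is orthogonal to every e k,
    hence to every d i, which lies in their span up to norm 0, and totality gives |f - h| = 0. *)
Theorem gram_schmidt_basis : orthonormal_basis ip H e.
Proof.
have eo := gs_orthonormal; have [He eE] := eo.
split => // f Hf.
have [h [Hh fh hc]] := oncomb_cvg eo (c := fun j => ip f (e j)) (fun n => bessel eo n Hf).
suff fh0 : N (f - h) = 0.
  apply: (@cvg0_le _ _ _ _ _ (fun n => N (onproj e n f - h))) => // n.
  rewrite ip_norm_ge0/=.
  apply: (le_trans (ip_normB_trans hH Hf Hh (h_onproj eo n f))).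
  by rewrite fh0 add0r (ip_norm_distC hH)//; exact: h_onproj.
rewrite /ip_norm d_total ?sqrtr0//; first exact: (hB hH).
move=> i; have Hfh : H (f - h) by exact: (hB hH).
have Hp := h_onproj eo i.+1 (d i).
have -> : d i = onproj e i.+1 (d i) + (d i - onproj e i.+1 (d i)).
  by rewrite addrCA subrr addr0.
have Hr : H (d i - onproj e i.+1 (d i)) by exact: (hB hH).
rewrite (ipDr hH)// (ip_conj hH Hr Hfh) (ip_norm0_ip hH Hr Hfh); last first.
  by rewrite /ip_norm gs_exhausts// sqrtr0.
rewrite conjC0 addr0 (ip_sumr hH (F := fun j => ip (d i) (e j) *: e j))//.
  rewrite big1// => j _; rewrite (ipZr hH)// (ipBl hH)// hc subrr mulr0//.
by move=> j _; exact: (hZ hH).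
Qed.

(** Carries a linear property of the d i over to the basis; it is applied to continuity of
    translations, known first for indicator functions of boxes. *)
Lemma gs_span (K : set V) : K 0 ->
  (forall a f g, K f -> K g -> K (a *: f + g)) -> (forall i, K (d i)) ->
  forall j, K (e j).
Proof.
move=> K0 Klin Kd j; have Kz a f : K f -> K (a *: f).
  by move=> Kf; rewrite -[_ *: _]addr0; exact: Klin.
elim/ltn_ind: j => j IH.
rewrite /gs_basis /gs_next; apply: Kz; rewrite gs_resE.
rewrite addrC -scaleN1r; apply: (Klin) => //.
rewrite /onproj; move: (d _) => x; elim: j IH => [|j IHj] IH; first by rewrite big_ord0.
rewrite big_ord_recr/= addrC; apply: (Klin); first exact: IH.
by apply: IHj => k kj; apply: IH; rewrite ltnW.
Qed.

End gram_schmidt.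
End orthonormal_systems.

(** * Functional calculus of positive operators *)

Section functional_calculus.
Context {R : realType} {V : lmodType R[i]}.
Variables (ip : V -> V -> R[i]) (H : set V).
Hypothesis hH : hilbert ip H.
Variable T : V -> V.
Hypothesis TH : forall f, H f -> H (T f).
Hypothesis Tsym : forall f g, H f -> H g -> ip (T f) g = ip f (T g).
Hypothesis Tpos : forall f, H f -> 0 <= complex.Re (ip (T f) f).
Implicit Types (f g h : V) (p q : {poly R}) (Q S : V -> V) (t s : R).
Local Notation N := (ip_norm ip).
Local Notation nsq f := (complex.Re (ip f f)).
Local Notation op p f := (op_horner p T f).

Lemma h_iter k f : H f -> H (iter k T f).
Proof. by move=> Hf; elim: k => //= k; exact: TH. Qed.

Lemma iter_sym k f g : H f -> H g -> ip (iter k T f) g = ip f (iter k T g).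
Proof.
move=> Hf Hg; elim: k f g Hf Hg => // k IH f g Hf Hg.
rewrite iterS Tsym//; last exact: h_iter.
by rewrite IH//; [rewrite -iterSr|exact: TH].
Qed.

Lemma op_hornerE m p f : (size p <= m)%N ->
  op p f = \sum_(k < m) (p`_k)%:C *: iter k T f.
Proof.
move=> pm; rewrite /op_horner -(subnKC pm) big_split_ord/= [X in _ + X]big1 ?addr0//.
by move=> k _; rewrite nth_default ?leq_addr// scale0r.
Qed.

Lemma op_horner_linear (a : R) p q f : op (a *: p + q) f = a%:C *: op p f + op q f.
Proof.
pose m := maxn (size (a *: p + q)) (maxn (size p) (size q)).
rewrite !(@op_hornerE m) ?leq_max ?leqnn ?orbT//.
rewrite scaler_sumr -big_split/=; apply: eq_bigr => k _.
by rewrite coefD coefZ scalerA -scalerDl -rmorphM -rmorphD.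
Qed.

Lemma op_hornerD p q f : op (p + q) f = op p f + op q f.
Proof. by have := op_horner_linear 1 p q f; rewrite !scale1r. Qed.

Lemma op_hornerB p q f : op (p - q) f = op p f - op q f.
Proof.
have := op_horner_linear (-1) q p f; rewrite rmorphN !scaleN1r addrC => ->.
by rewrite addrC.
Qed.

Lemma op_horner0 f : op 0 f = 0.
Proof. by rewrite /op_horner size_poly0 big_ord0. Qed.

Lemma op_hornerC (c : R) f : op c%:P f = c%:C *: f.
Proof.
by rewrite (@op_hornerE 1%N) ?size_polyC ?leq_b1// big_ord1 coefC.
Qed.

Lemma op_hornerX f : op 'X f = T f.
Proof.
rewrite (@op_hornerE 2%N) ?size_polyX// !big_ord_recr big_ord0/= !coefX.
by rewrite scale0r !add0r scale1r.
Qed.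

Lemma h_op_horner p f : H f -> H (op p f).
Proof.
move=> Hf; apply: (h_sum hH (F := fun k => (p`_k)%:C *: iter k T f)) => k _.
by apply: (hZ hH); exact: h_iter.
Qed.

Lemma ip_op_horner p f g m : (size p <= m)%N -> H f -> H g ->
  ip (op p f) g = \sum_(k < m) (p`_k)%:C * ip (iter k T f) g.
Proof.
move=> pm Hf Hg; rewrite (op_hornerE _ pm).
rewrite (ip_suml hH (F := fun k => (p`_k)%:C *: iter k T f))//; last first.
  by move=> k _; apply: (hZ hH); exact: h_iter.
by apply: eq_bigr => k _; rewrite (ipZl hH)//; exact: h_iter.
Qed.

Lemma op_horner_sym p f g : H f -> H g -> ip (op p f) g = ip f (op p g).
Proof.
move=> Hf Hg; rewrite (ip_conj hH (h_op_horner p Hg) Hf).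
rewrite !(ip_op_horner (leqnn _))// rmorph_sum; apply: eq_bigr => k _ /=.
by rewrite rmorphM/= conjcR iter_sym// (ip_conj hH (h_iter k Hg) Hf).
Qed.

(** [T] is not assumed linear, so [T (op p f)] cannot be expanded: symmetry moves [T] to the other
    argument, and the identity is obtained only in this weak form. The same holds of
    [op_hornerM]. *)
Lemma ip_op_hornerMX p f g : H f -> H g ->
  ip (op (p * 'X) f) g = ip (T (op p f)) g.
Proof.
move=> Hf Hg; rewrite Tsym//; last exact: h_op_horner.
rewrite (@ip_op_horner _ _ _ (size p).+1)//; last first.
  by rewrite (leq_trans (size_polyMleq _ _))// size_polyX addn2.
rewrite (ip_op_horner (leqnn _))//; last exact: TH.
rewrite big_ord_recl coefMX/= mul0r add0r; apply: eq_bigr => k _.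
by rewrite coefMX/= Tsym//; exact: h_iter.
Qed.

Lemma op_hornerM p q f g : H f -> H g ->
  ip (op p f) (op q g) = ip (op (p * q) f) g.
Proof.
move=> Hf Hg; elim/poly_ind: q p => [|q c IH] p.
  by rewrite mulr0 !op_horner0 (ip0r hH) ?(ip0l hH)//; exact: h_op_horner.
have Hp := h_op_horner p Hf.
rewrite op_hornerD op_hornerC (ipDr hH)//; [|exact: h_op_horner|exact: (hZ hH)].
rewrite (ipZr hH)// conjcR.
have -> : ip (op p f) (op (q * 'X) g) = ip (op (p * 'X) f) (op q g).
  rewrite (ip_conj hH (h_op_horner _ Hg) Hp) ip_op_hornerMX// Tsym//; last first.
    exact: h_op_horner.
  rewrite -(ip_conj hH (h_op_horner _ Hg) (TH Hp)) ip_op_hornerMX//.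
  exact: h_op_horner.
rewrite IH mulrDr mulrA [p * q * 'X]mulrAC op_hornerD (ipDl hH)//; [|exact: h_op_horner|exact: h_op_horner].
congr (_ + _); rewrite [p * _]mulrC mul_polyC -[_ *: p]addr0 op_horner_linear op_horner0 addr0.
by rewrite (ipZl hH).
Qed.

Lemma nsq_op_horner q f : H f ->
  nsq (op q f) = complex.Re (ip (op (q ^+ 2) f) f).
Proof.
move=> Hf; rewrite expr2 -(op_hornerM q q Hf Hf).
by [].
Qed.

Section bounded.
Variable M : R.
Hypothesis M0 : 0 <= M.
Hypothesis TM : op_bound ip H T M.

(** The functional q |-> Re <q(T) f, f> meets the hypotheses of [functional_ge0_itv]: with h = q(T)
    f, its values at q^2, X q^2 and (M - X) q^2 are |h|^2, <T h, h> and M |h|^2 - <T h, h>, the last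
    one nonnegative by Cauchy-Schwarz and |T h| <= M |h|. *)
Lemma op_horner_ge0 p f : H f -> (forall t, 0 <= t <= M -> 0 <= p.[t]) ->
  0 <= complex.Re (ip (op p f) f).
Proof.
move=> Hf p0; pose L q := complex.Re (ip (op q f) f).
have Llin a q r : L (a *: q + r) = a * L q + L r.
  rewrite /L op_horner_linear (ip_linear hH)//; [|exact: h_op_horner|exact: h_op_horner].
  by rewrite cReD cReM/= mul0r subr0.
have LX q : L ('X * q ^+ 2) = complex.Re (ip (T (op q f)) (op q f)).
  rewrite -ip_op_hornerMX//; last exact: h_op_horner.
  by rewrite op_hornerM// /L; congr (complex.Re (ip (op _ _) _)); ring.
apply: (@functional_ge0_itv _ M L) => // q.
- by rewrite /L -nsq_op_horner//; apply: (ip_ge0 hH); exact: h_op_horner.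
- by rewrite LX; apply: Tpos; exact: h_op_horner.
- have Hq := h_op_horner q Hf.
  have -> : (M%:P - 'X) * q ^+ 2 = M *: q ^+ 2 + (-1) *: ('X * q ^+ 2).
    by rewrite mulrBl mul_polyC scaleN1r.
  rewrite Llin -[_ *: ('X * _)]addr0 Llin LX.
  have -> : L 0 = 0 by rewrite /L op_horner0 (ip0l hH).
  rewrite addr0 mulN1r subr_ge0 /L -nsq_op_horner// -(sqr_ip_norm hH)//.
  apply: (le_trans (ler_norm _)); apply: (le_trans (ler_normc_Re _)).
  apply: (le_trans (cauchy_schwarz hH (TH Hq) Hq)).
  by rewrite expr2 mulrA ler_wpM2r ?ip_norm_ge0//; have [_] := TM Hq.
Qed.

Lemma op_horner_le p q f : H f -> (forall t, 0 <= t <= M -> p.[t] <= q.[t]) ->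
  complex.Re (ip (op p f) f) <= complex.Re (ip (op q f) f).
Proof.
move=> Hf pq; rewrite -subr_ge0 -cReN -cReD -(ipBl hH)//; last first.
- exact: h_op_horner.
- exact: h_op_horner.
rewrite -op_hornerB; apply: op_horner_ge0 => // t tM.
by rewrite hornerD hornerN subr_ge0 pq.
Qed.

Lemma op_horner_norm_le p (B : R) f : 0 <= B -> H f ->
  (forall t, 0 <= t <= M -> `|p.[t]| <= B) -> N (op p f) <= B * N f.
Proof.
move=> B0 Hf pB.
rewrite -(ler_pXn2r (ltn0Sn 1)) ?nnegrE ?mulr_ge0 ?ip_norm_ge0//.
rewrite exprMn !(sqr_ip_norm hH)//; last exact: h_op_horner.
rewrite nsq_op_horner//.
have -> : B ^+ 2 * nsq f = complex.Re (ip (op (B ^+ 2)%:P f) f).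
  by rewrite op_hornerC (ipZl hH)// cReM/= mul0r subr0.
apply: op_horner_le => // t tM; rewrite horner_exp hornerC.
by rewrite -[leLHS]real_normK ?num_real// ler_pXn2r ?nnegrE// pB.
Qed.

Variable phi : R -> R.
Hypothesis phi_approx : forall eps : R, 0 < eps ->
  exists p : {poly R}, forall t, 0 <= t <= M -> `|p.[t] - phi t| <= eps.

(** [Q] is phi(T). Testing it against every polynomial close to phi, and not against one fixed
    sequence, leaves later estimates free to pick their own approximation. *)
Definition op_limit Q := forall f, H f -> H (Q f) /\
  forall (eps : R) p, 0 < eps ->
    (forall t, 0 <= t <= M -> `|p.[t] - phi t| <= eps) ->
    N (Q f - op p f) <= eps * N f.

Lemma op_limit_exists : exists Q, op_limit Q.
Proof.
have /choice[P HP] : forall k : nat, exists p : {poly R},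
    forall t, 0 <= t <= M -> `|p.[t] - phi t| <= k.+1%:R^-1.
  by move=> k; apply: phi_approx; rewrite invr_gt0.
have dist (p q : {poly R}) (a b : R) f : H f -> 0 < a -> 0 < b ->
    (forall t, 0 <= t <= M -> `|p.[t] - phi t| <= a) ->
    (forall t, 0 <= t <= M -> `|q.[t] - phi t| <= b) ->
    N (op p f - op q f) <= (a + b) * N f.
  move=> Hf a0 b0 pa qb; rewrite -op_hornerB; apply: op_horner_norm_le => //.
    by rewrite addr_ge0 ?ltW.
  move=> t tM; rewrite hornerD hornerN.
  have -> : p.[t] - q.[t] = (p.[t] - phi t) - (q.[t] - phi t) by ring.
  by apply: (le_trans (ler_normB _ _)); rewrite lerD ?pa ?qb.
have lim f : exists h, H f -> H h /\
    N (op (P k) f - h) @[k --> \oo] --> (0 : R).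
  have [Hf|nHf] := pselect (H f); last by exists 0.
  have [|eps e0|h Hh hh] := hilbert_complete hH (u := fun k => op (P k) f).
  - by move=> k; exact: h_op_horner.
  (* Two polynomials within 1/(K + 1) of phi give values at f within 2 |f| / (K + 1) of each
     other. *)
  - pose K := Num.truncn (2 * N f / eps); exists K => j k Kj Kk.
    apply: (le_trans (dist _ _ _ _ _ Hf _ _ (HP j) (HP k))); rewrite ?invr_gt0//.
    have : K.+1%:R^-1 * (2 * N f) <= eps.
      rewrite mulrC ler_pdivrMr// [leRHS]mulrC -ler_pdivrMr//.
      exact: (ltW (truncnS_gt _)).
    have inv i : (K <= i)%N -> i.+1%:R^-1 <= K.+1%:R^-1 :> R.
      by move=> Ki; rewrite lef_pV2 ?posrE// ler_nat.
    apply: le_trans.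
    have -> : K.+1%:R^-1 * (2 * N f) = (K.+1%:R^-1 + K.+1%:R^-1) * N f by ring.
    by rewrite ler_wpM2r ?ip_norm_ge0// lerD ?inv.
  - by exists h.
have [Q HQ] := choice lim.
exists Q => f Hf; have [HQf Qcvg] := HQ f Hf; split => // eps p e0 pe.
pose u k : R := N (op (P k) f - Q f) + k.+1%:R^-1 * N f.
rewrite -subr_le0; apply: (@le_cvg0 _ _ u).
  move=> k; rewrite /u lerBlDr.
  have Hk := h_op_horner (P k) Hf; have Hp := h_op_horner p Hf.
  apply: (le_trans (ip_normB_trans hH HQf Hk Hp)).
  rewrite (ip_norm_distC hH HQf Hk) -addrA lerD2l -mulrDl.
  by apply: (dist _ _ _ _ _ Hf _ e0 (HP k) pe); rewrite invr_gt0 ltr0n.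
rewrite /u -[X in _ --> X](addr0 (0 : R)); apply: cvgD => //.
rewrite -[X in _ --> X](mul0r (N f)); apply: cvgM; last exact: cvg_cst.
exact: cvg_harmonic.
Qed.

Variable Q : V -> V.
Hypothesis QP : op_limit Q.

Let HQ f : H f -> H (Q f).
Proof. by move=> /QP[]. Qed.

Let Qapprox (eps : R) f : 0 < eps -> exists p : {poly R},
  [/\ forall t, 0 <= t <= M -> `|p.[t] - phi t| <= eps &
      forall f, H f -> N (Q f - op p f) <= eps * N f].
Proof.
move=> e0; have [p pe] := phi_approx e0; exists p; split => // g Hg.
by have [_] := QP Hg; apply.
Qed.

Lemma op_limit_sym f g : H f -> H g -> ip (Q f) g = ip f (Q g).
Proof.
move=> Hf Hg; apply/eqP; rewrite -subr_eq0; apply/eqP; apply: normsq_eq0.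
rewrite -sqr_normc_normsq; apply/eqP; rewrite sqrf_eq0 eq_le normc_ge0 andbT.
apply/ler_addgt0Pr => eps e0; rewrite add0r.
(* The two errors add up to 2 eta |f| |g|; the 1 in the denominator allows for vanishing norms. *)
pose eta := eps / (2 * N f * N g + 1).
have D0 : 0 < 2 * N f * N g + 1.
  by rewrite ltr_wpDl// !mulr_ge0// ip_norm_ge0.
have eta0 : 0 < eta by rewrite divr_gt0.
have [p [_ Qp]] := Qapprox f eta0.
have Hpf := h_op_horner p Hf; have Hpg := h_op_horner p Hg.
have -> : ip (Q f) g - ip f (Q g) =
    ip (Q f - op p f) g - ip f (Q g - op p g).
  rewrite (ipBl hH)//; last exact: HQ.
  by rewrite (ipBr hH)//; [rewrite op_horner_sym//; ring|exact: HQ].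
apply: (le_trans (le_normcD _ _)); rewrite normcN.
have h1 : Normc.normc (ip (Q f - op p f) g) <= eta * N f * N g.
  apply: (le_trans (cauchy_schwarz hH _ Hg)); first by apply: (hB hH) => //; exact: HQ.
  by rewrite ler_wpM2r ?ip_norm_ge0// Qp.
have h2 : Normc.normc (ip f (Q g - op p g)) <= eta * N f * N g.
  apply: (le_trans (cauchy_schwarz hH Hf _)); first by apply: (hB hH) => //; exact: HQ.
  by rewrite mulrAC mulrC ler_wpM2r ?ip_norm_ge0// Qp.
apply: (le_trans (lerD h1 h2)).
have -> : eta * N f * N g + eta * N f * N g = eta * (2 * N f * N g) by ring.
by rewrite /eta mulrAC ler_pdivrMr// ler_wpM2l ?(ltW e0)// lerDl.
Qed.

Lemma op_limit_norm_le (B : R) f : H f ->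
  (forall t, 0 <= t <= M -> `|phi t| <= B) -> N (Q f) <= B * N f.
Proof.
move=> Hf phiB.
have B0 : 0 <= B by apply: le_trans (phiB 0 _); rewrite ?lexx.
apply/ler_addgt0Pr => eps e0.
pose eta := eps / (2 * N f + 1).
have D0 : 0 < 2 * N f + 1 by rewrite ltr_wpDl// mulr_ge0// ip_norm_ge0.
have eta0 : 0 < eta by rewrite divr_gt0.
have [p [pphi Qp]] := Qapprox f eta0.
have Hpf := h_op_horner p Hf.
have h1 : N (op p f) <= (eta + B) * N f.
  apply: op_horner_norm_le => //; first by rewrite addr_ge0// ltW.
  move=> t tM; rewrite -[p.[t]](subrK (phi t)).
  by apply: (le_trans (ler_normD _ _)); rewrite lerD ?pphi ?phiB.
rewrite -[Q f](subrK (op p f)).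
apply: (le_trans (ip_normD hH _ Hpf)); first by apply: (hB hH) => //; exact: HQ.
apply: (le_trans (lerD (Qp f Hf) h1)).
have -> : eta * N f + (eta + B) * N f = B * N f + eta * (2 * N f) by ring.
rewrite lerD2l /eta mulrAC ler_pdivrMr// ler_wpM2l ?(ltW e0)// lerDl//.
Qed.

(** An operator inequality read off from a scalar one: both p - b and b - p are dominated on [0, M]
    by the polynomial A + eta + C (X - s)^2, whose value at T paired with f is the right-hand side
    up to eta. Positivity takes the place of the spectral measure of f. *)
Lemma op_limit_dist (A C b s : R) f : H f -> 0 <= C ->
  (forall t, 0 <= t <= M -> `|phi t - b| <= A + C * (t - s) ^+ 2) ->
  `|complex.Re (ip (Q f) f) - b * nsq f| <=
    A * nsq f + C * nsq (T f - s%:C *: f).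
Proof.
move=> Hf C0 phib; apply/ler_addgt0Pr => eps e0.
have n0 : 0 <= nsq f := ip_ge0 hH Hf.
pose eta := eps / (2 * nsq f + 1).
have D0 : 0 < 2 * nsq f + 1 by rewrite ltr_wpDl// mulr_ge0.
have eta0 : 0 < eta by rewrite divr_gt0.
have [p [pphi Qp]] := Qapprox f eta0.
have Hpf := h_op_horner p Hf.
have h1 : `|complex.Re (ip (Q f) f) - complex.Re (ip (op p f) f)| <= eta * nsq f.
  rewrite -cReN -cReD -(ipBl hH)//; last exact: HQ.
  apply: (le_trans (ler_normc_Re _)); apply: (le_trans (cauchy_schwarz hH _ Hf)).
    by apply: (hB hH) => //; exact: HQ.
  by rewrite -(sqr_ip_norm hH)// expr2 mulrA ler_wpM2r ?ip_norm_ge0// Qp.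
pose q := (A + eta)%:P + C *: ('X - s%:P) ^+ 2.
have qE : complex.Re (ip (op q f) f) =
    (A + eta) * nsq f + C * nsq (T f - s%:C *: f).
  have -> : T f - s%:C *: f = op ('X - s%:P) f.
    by rewrite op_hornerB op_hornerX op_hornerC.
  rewrite nsq_op_horner// /q addrC op_horner_linear op_hornerC.
  rewrite (ipDl hH)//; [|by apply: (hZ hH); exact: h_op_horner|exact: (hZ hH)].
  rewrite !(ipZl hH)//; last exact: h_op_horner.
  by rewrite cReD !cReM/= !mul0r !subr0 addrC.
have qv t : q.[t] = A + eta + C * (t - s) ^+ 2.
  by rewrite /q !hornerE.
have bE : complex.Re (ip (op b%:P f) f) = b * nsq f.
  by rewrite op_hornerC (ipZl hH)// cReM/= mul0r subr0.
have h2 : complex.Re (ip (op p f) f) - b * nsq f <=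
    (A + eta) * nsq f + C * nsq (T f - s%:C *: f).
  rewrite -qE -bE lerBlDr -cReD -(ipDl hH)//; [|exact: h_op_horner|exact: h_op_horner].
  rewrite -op_hornerD; apply: op_horner_le => // t tM.
  rewrite hornerD qv hornerC.
  have := pphi t tM; have := phib t tM; rewrite !ler_norml; lra.
have h3 : b * nsq f - complex.Re (ip (op p f) f) <=
    (A + eta) * nsq f + C * nsq (T f - s%:C *: f).
  rewrite -qE -bE lerBlDr -cReD -(ipDl hH)//; last exact: h_op_horner.
  rewrite -op_hornerD; apply: op_horner_le => // t tM.
  rewrite hornerD qv hornerC.
  have := pphi t tM; have := phib t tM; rewrite !ler_norml; lra.
have h4 : eta * (2 * nsq f) <= eps.
  by rewrite /eta mulrAC ler_pdivrMr// ler_wpM2l ?(ltW e0)// lerDl.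
move: h1; rewrite !ler_norml; lra.
Qed.

Variable psi : R -> R.
Hypothesis psiE : forall t, 0 <= t <= M -> psi t = t * phi t.

Lemma op_limit_mulX (eps : R) p f : 0 < eps -> H f ->
  (forall t, 0 <= t <= M -> `|p.[t] - phi t| <= eps) ->
  N (T (Q f) - op (p * 'X) f) <= M * eps * N f.
Proof.
move=> e0 Hf pphi; have Hp := h_op_horner p Hf.
have HX := h_op_horner (p * 'X) Hf.
set w := _ - _; have Hw : H w by apply: (hB hH) => //; apply: TH; exact: HQ.
have [w0|wn0] := eqVneq (N w) 0.
  by rewrite w0 !mulr_ge0// ?ip_norm_ge0// ltW.
have wp : 0 < N w by rewrite lt_neqAle eq_sym wn0 ip_norm_ge0.
rewrite -(ler_pM2r wp) -expr2 (sqr_ip_norm hH)//.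
(* As [T] is not assumed linear, w is paired with itself and [T] moved onto w; the bound |T w| <= M
   |w| then leaves one factor |w| to divide out. *)
have -> : ip w w = ip (Q f - op p f) (T w).
  have HQf := HQ Hf; have HTQ := TH HQf; have HTw := TH Hw.
  have -> : ip w w = ip (T (Q f)) w - ip (op (p * 'X) f) w by rewrite -(ipBl hH).
  by rewrite ip_op_hornerMX// !Tsym// (ipBl hH).
have HQp : H (Q f - op p f) by apply: (hB hH) => //; exact: HQ.
apply: (le_trans (ler_norm _)); apply: (le_trans (ler_normc_Re _)).
apply: (le_trans (cauchy_schwarz hH HQp (TH Hw))).
have -> : M * eps * N f * N w = (eps * N f) * (M * N w) by ring.
apply: ler_pM; rewrite ?ip_norm_ge0//; last by have [] := TM Hw.
by have [_] := QP Hf; apply.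
Qed.

Lemma op_limit_fcalc : is_fcalc ip H psi T (T \o Q).
Proof.
exists M; split => // eps e0.
have M1 : 0 < M + 1 by rewrite ltr_wpDl.
have eta0 : 0 < eps / (M + 1) by rewrite divr_gt0.
have [p pphi] := phi_approx eta0; exists (p * 'X).
have Me : M * (eps / (M + 1)) <= eps.
  by rewrite mulrA ler_pdivrMr// mulrC ler_wpM2l ?(ltW e0)// lerDl.
split=> [t tM|f Hf].
  rewrite hornerM hornerX psiE// mulrC -mulrBr normrM.
  apply: le_trans Me; have /andP[t0 t1] := tM.
  by apply: ler_pM => //; [rewrite ger0_norm|exact: pphi].
split; first by apply: (hB hH); [apply: TH; exact: HQ|exact: h_op_horner].
apply: (le_trans (op_limit_mulX eta0 Hf pphi)).
by rewrite ler_wpM2r ?ip_norm_ge0.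
Qed.

End bounded.

Section unique.
Variables (M : R) (phi psi : R -> R) (Q : V -> V).
Hypothesis M0 : 0 <= M.
Hypothesis TM : op_bound ip H T M.
Hypothesis phi_approx : forall eps : R, 0 < eps ->
  exists p : {poly R}, forall t, 0 <= t <= M -> `|p.[t] - phi t| <= eps.
Hypothesis QP : op_limit M phi Q.
Hypothesis psiE : forall t, 0 <= t <= M -> psi t = t * phi t.

(** The bounds M and M' on the norm of [T] may differ, but their minimum is again a bound. On the
    interval that it defines, a polynomial p close to psi and a multiple q X close to t phi(t) are
    close to each other, and positivity on that interval compares the operators. *)
Lemma fcalc_unique S f : is_fcalc ip H psi T S -> H f ->
  H (S f) /\ N (S f - T (Q f)) = 0.
Proof.
move=> [M' [M'0 TM' SP]] Hf.
have HSp p eps : op_bound ip H (fun f => S f - op p f) eps -> H (S f).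
  move=> /(_ f Hf)[+ _] => h.
  rewrite -[S f](subrK (op p f)); apply: (hD hH) => //; exact: h_op_horner.
have HS : H (S f).
  by have [p [_ /HSp]] := SP 1 ltr01.
split => //; apply/eqP; rewrite eq_le ip_norm_ge0 andbT.
apply/ler_addgt0Pr => eps e0; rewrite add0r.
pose eta := eps / ((2 + 2 * M) * N f + 1).
have D0 : 0 < (2 + 2 * M) * N f + 1.
  by rewrite ltr_wpDl// mulr_ge0 ?ip_norm_ge0// addr_ge0// mulr_ge0.
have eta0 : 0 < eta by rewrite divr_gt0.
have [p [ppsi Sp]] := SP _ eta0.
have [q qphi] := phi_approx eta0.
pose m := Num.min M M'.
have m0 : 0 <= m by rewrite le_min M0.
have Tm : op_bound ip H T m.
  by rewrite /m; case: (leP M M').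
have Hp := h_op_horner p Hf; have HX := h_op_horner (q * 'X) Hf.
have HTQ : H (T (Q f)) by apply: TH; have [] := QP Hf.
have h1 : N (op p f - op (q * 'X) f) <= (eta + M * eta) * N f.
  rewrite -op_hornerB; apply: (op_horner_norm_le m0 Tm) => //.
    by apply: addr_ge0; [exact: ltW|apply: mulr_ge0 => //; exact: ltW].
  move=> t /andP[t0]; rewrite le_min => /andP[tM tM'].
  have tM0 : 0 <= t <= M by rewrite t0.
  have tM'0 : 0 <= t <= M' by rewrite t0.
  rewrite hornerD hornerN hornerM hornerX.
  have -> : p.[t] - q.[t] * t = (p.[t] - psi t) - t * (q.[t] - phi t).
    by rewrite psiE//; ring.
  apply: (le_trans (ler_normB _ _)); rewrite lerD ?ppsi// normrM ger0_norm//.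
  by apply: ler_pM => //; exact: qphi.
have h2 : N (S f - op p f) <= eta * N f by have [] := Sp f Hf.
have h3 := op_limit_mulX M0 TM QP eta0 Hf qphi.
apply: (le_trans (ip_normB_trans hH HS Hp HTQ)).
have h4 := ip_normB_trans hH Hp HX HTQ.
rewrite [X in _ <= _ + X](ip_norm_distC hH) // in h4.
have h5 : eta * ((2 + 2 * M) * N f) <= eps.
  by rewrite /eta mulrAC ler_pdivrMr// ler_wpM2l ?(ltW e0)// lerDl.
apply: (le_trans (lerD h2 h4)); apply: le_trans h5.
apply: (le_trans (lerD (lexx _) (lerD h1 h3))).
by rewrite le_eqVlt; apply/orP; left; apply/eqP; ring.
Qed.

Lemma fcalcE f : H f ->
  H (fcalc ip H psi T f) /\ N (fcalc ip H psi T f - T (Q f)) = 0.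
Proof.
move=> Hf; have QF := op_limit_fcalc M0 TM phi_approx QP psiE.
rewrite /fcalc; case: xgetP => [S _ SP|/(_ _ QF)]; last by [].
exact: fcalc_unique.
Qed.

End unique.
End functional_calculus.

(** * Integration of real and complex functions *)

Lemma measurable_fun_in d (T : measurableType d) (N : set T) : measurable N ->
  measurable_fun setT (fun x => x \in N).
Proof.
move=> mN; apply: (measurable_fun_bool true); rewrite setTI.
rewrite (_ : _ @^-1` _ = N)//; apply/seteqP; split => x /=; first exact: set_mem.
exact: mem_set.
Qed.

Section real_integral.
Context d (T : measurableType d) (R : realType) (mu : {measure set T -> \bar R}).
Implicit Types (f g : T -> R).
Local Notation rI f := (mu.-integrable setT (EFin \o f)).

Lemma rI_meas f : rI f -> measurable_fun setT f.
Proof. by move=> /measurable_int /measurable_EFinP. Qed.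

Lemma rI_le f g : measurable_fun setT f -> (forall x, `|f x| <= g x) ->
  rI g -> rI f.
Proof.
move=> mf fg; apply: le_integrable => //; first exact/measurable_EFinP.
by move=> x _ /=; rewrite lee_fin (le_trans (fg x))// ler_norm.
Qed.

Lemma rI_norm f : rI f -> rI (fun x => `|f x|).
Proof. exact: integrable_norm. Qed.

Lemma rID f g : rI f -> rI g -> rI (fun x => f x + g x).
Proof. by move=> mf mg; exact: (integrableD measurableT mf mg). Qed.

Lemma rIB f g : rI f -> rI g -> rI (fun x => f x - g x).
Proof. by move=> mf mg; exact: (integrableB measurableT mf mg). Qed.

Lemma rIZ c f : rI f -> rI (fun x => c * f x).
Proof. by move=> mf; exact: (integrableZl measurableT c mf). Qed.

Lemma rIN f : rI f -> rI (fun x => - f x).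
Proof. by move=> mf; exact: (integrableN mf). Qed.

Lemma rI0 : rI (fun=> 0).
Proof. exact: integrable0. Qed.

Lemma rI_sum n (F : nat -> T -> R) : (forall j, (j < n)%N -> rI (F j)) ->
  rI (fun x => \sum_(j < n) F j x).
Proof.
elim: n => [|n IH] hF.
  by under eq_fun => x do rewrite big_ord0; exact: rI0.
under eq_fun => x do rewrite big_ord_recr/=.
by apply: rID; [apply: IH => j /ltnW/hF|exact: hF].
Qed.

Lemma rint_sum n (F : nat -> T -> R) : (forall j, (j < n)%N -> rI (F j)) ->
  \int[mu]_x (\sum_(j < n) F j x) = \sum_(j < n) \int[mu]_x F j x.
Proof.
elim: n => [|n IH] hF.
  by rewrite big_ord0; under eq_fun => x do rewrite big_ord0; rewrite Rintegral_cst// mul0r.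
under eq_fun => x do rewrite big_ord_recr/=.
rewrite big_ord_recr/= RintegralD//; last exact: hF.
  by rewrite IH// => j /ltnW/hF.
by apply: rI_sum => j /ltnW/hF.
Qed.

Lemma rint_EFin f : rI f -> (\int[mu]_x (f x)%:E)%E = (\int[mu]_x f x)%:E.
Proof. by move=> fI; rewrite fineK//; exact: integrable_fin_num. Qed.

Lemma rI_ge0 f : measurable_fun setT f -> (forall x, 0 <= f x) ->
  (\int[mu]_x (f x)%:E < +oo)%E -> rI f.
Proof.
move=> mf f0 foo; apply/integrableP; split; first exact/measurable_EFinP.
by under eq_integral => x _ do rewrite /= ger0_norm//.
Qed.

Lemma rI_ge0_lty f : rI f -> (\int[mu]_x (f x)%:E < +oo)%E.
Proof. by move=> fI; rewrite rint_EFin// ltry. Qed.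

Lemma rI_ae f g : {ae mu, forall x, f x = g x} -> measurable_fun setT g ->
  rI f -> rI g.
Proof.
move=> fg mg fI; have mf := rI_meas fI; move: fI => /integrableP[_ foo].
apply/integrableP; split; first exact/measurable_EFinP.
rewrite (_ : (\int[mu]_x _)%E = (\int[mu]_x `|(EFin \o f) x|)%E)//.
apply: ae_eq_integral => //.
- by apply: measurableT_comp => //; exact/measurable_EFinP.
- by apply: measurableT_comp => //; exact/measurable_EFinP.
- by apply: filterS fg => x /= ->.
Qed.

Lemma rint_ae f g : {ae mu, forall x, f x = g x} -> measurable_fun setT f ->
  measurable_fun setT g -> \int[mu]_x f x = \int[mu]_x g x.
Proof.
move=> fg mf mg; congr fine; apply: ae_eq_integral => //.
- exact/measurable_EFinP.
- exact/measurable_EFinP.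
- by apply: filterS fg => x /= ->.
Qed.

Lemma rint_eq0 f : rI f -> (forall x, 0 <= f x) -> \int[mu]_x f x = 0 ->
  {ae mu, forall x, f x = 0}.
Proof.
move=> fI f0 if0; have mf := rI_meas fI.
have : (\int[mu]_x `|(EFin \o f) x|)%E = 0%E.
  under eq_integral => x _ do rewrite /= ger0_norm//.
  by rewrite rint_EFin// if0.
move/(ae_eq_integral_abs mu measurableT (measurable_int _ fI)).
by apply: filterS => x /(_ I) [].
Qed.

Lemma rdct (f_ : nat -> T -> R) f g :
  (forall k, measurable_fun setT (f_ k)) -> measurable_fun setT f ->
  {ae mu, forall x, f_ k x @[k --> \oo] --> f x} ->
  (forall k x, `|f_ k x| <= g x) -> rI g ->
  rI f /\ \int[mu]_x f_ k x @[k --> \oo] --> \int[mu]_x f x.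
Proof.
move=> mf_ mf ff fg gI.
have [fI _ cv] : [/\ rI f, [sequence \int[mu]_(x in setT)
    (`|(EFin \o f_ n) x - (EFin \o f) x|)]_n @ \oo --> 0 &
  [sequence \int[mu]_(x in setT) ((EFin \o f_ n) x)]_n @ \oo -->
    \int[mu]_(x in setT) ((EFin \o f) x)]%E.
  apply: (@dominated_convergence _ _ _ mu _ _ _ _ (EFin \o g)) => //.
  - by move=> k; exact/measurable_EFinP.
  - exact/measurable_EFinP.
  - by apply: filterS ff => x fx _; apply: cvg_EFin => //; apply: nearW.
  - by apply: aeW => x k _ /=; rewrite lee_fin.
split => //.
have fkI k : rI (f_ k) by apply: rI_le (fg k) gI.
rewrite rint_EFin// in cv.
move: cv => /fine_cvgP[_]; apply: cvg_trans; apply: near_eq_cvg.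
by apply: nearW => k.
Qed.

(* The integrand need not be measurable on the null set [N]. *)
Lemma ge0_integral_null (f g : T -> \bar R) (N : set T) :
  (forall x, (0 <= f x)%E) -> (forall x, (0 <= g x)%E) ->
  measurable_fun setT g -> measurable N -> mu N = 0%E ->
  (forall x, ~ N x -> f x = g x) -> (\int[mu]_x f x = \int[mu]_x g x)%E.
Proof.
move=> f0 g0 mg mN N0 fg.
(* As a supremum over simple functions below the integrand, the integral is monotone without
   measurability; f is then squeezed between g changed to 0 and g changed to +oo on N. *)
have mono (f1 f2 : T -> \bar R) : (forall x, 0 <= f1 x)%E ->
    (forall x, f1 x <= f2 x)%E -> (\int[mu]_x f1 x <= \int[mu]_x f2 x)%E.
  move=> f10 f12; rewrite !ge0_integralTE//; last first.
    by move=> x; exact: le_trans (f12 x).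
  apply: le_ereal_sup => _ [h hf1 <-]; exists h => //= x.
  exact: le_trans (hf1 x) (f12 x).
pose lo x : \bar R := if x \in N then 0%E else g x.
pose hi x : \bar R := if x \in N then +oo%E else g x.
have mlo : measurable_fun setT lo.
  by apply: measurable_fun_ifT => //; exact: measurable_fun_in.
have mhi : measurable_fun setT hi.
  by apply: measurable_fun_ifT => //; exact: measurable_fun_in.
have lo0 x : (0 <= lo x)%E by rewrite /lo; case: ifP.
have hi0 x : (0 <= hi x)%E by rewrite /hi; case: ifP.
have aeN : {ae mu, forall x, ~ N x}.
  by exists N; split => // x /= /contrapT.
have lof x : (lo x <= f x)%E.
  by rewrite /lo; case: ifPn => // /negP xN; rewrite fg// => /mem_set.
have fhi x : (f x <= hi x)%E.
  by rewrite /hi; case: ifPn => [_|/negP xN]; rewrite ?leey// fg// => /mem_set.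
have eqlo : (\int[mu]_x lo x = \int[mu]_x g x)%E.
  apply: ae_eq_integral => //; apply: filterS aeN => x nx _.
  by rewrite /lo memNset.
have eqhi : (\int[mu]_x hi x = \int[mu]_x g x)%E.
  apply: ae_eq_integral => //; apply: filterS aeN => x nx _.
  by rewrite /hi memNset.
apply/eqP; rewrite eq_le -{1}eqhi -eqlo; apply/andP; split; exact: mono.
Qed.

(** Lets an integrand be changed on a null set where nothing is known about it: psi at negative
    values of sigma and, through [cint_null], the indicator of a convex set that may fail to be
    Borel. *)
Lemma rint_null f g (N : set T) : measurable_fun setT g ->
  measurable N -> mu N = 0%E -> (forall x, ~ N x -> f x = g x) ->
  \int[mu]_x f x = \int[mu]_x g x.
Proof.
move=> mg mN N0 fg; rewrite /Rintegral; congr fine.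
have mg' : measurable_fun setT (EFin \o g) by exact/measurable_EFinP.
rewrite integralE [RHS]integralE; congr (_ - _)%E.
- apply: ge0_integral_null N0 _ => //.
  + exact: measurable_funepos.
  + by move=> x nx; rewrite !funeposE /= fg.
- apply: ge0_integral_null N0 _ => //.
  + exact: measurable_funeneg.
  + by move=> x nx; rewrite !funenegE /= fg.
Qed.

End real_integral.

Section real_fubini.
Context d1 d2 (T1 : measurableType d1) (T2 : measurableType d2) (R : realType).
Variable m1 : {sigma_finite_measure set T1 -> \bar R}.
Variable m2 : {sigma_finite_measure set T2 -> \bar R}.
Variable f : T1 * T2 -> R.
Hypothesis fI : (m1 \x m2)%E.-integrable setT (EFin \o f).

Lemma rfubini_meas1 : measurable_fun setT (fun x => \int[m2]_y f (x, y)).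
Proof.
apply: (@measurableT_comp _ _ _ _ _ _ fine) => //.
exact: (measurable_int _ (integrable_fubini_F fI)).
Qed.

Lemma rfubini_meas2 : measurable_fun setT (fun y => \int[m1]_x f (x, y)).
Proof.
apply: (@measurableT_comp _ _ _ _ _ _ fine) => //.
exact: (measurable_fubini_G fI).
Qed.

Let ae1 : {ae m1, forall x, ((\int[m2]_y f (x, y))%:E = \int[m2]_y (f (x, y))%:E)%E}.
Proof.
apply: filterS (ae_integrable1 fI) => x fx.
by rewrite [in RHS]rint_EFin.
Qed.

Let ae2 : {ae m2, forall y, ((\int[m1]_x f (x, y))%:E = \int[m1]_x (f (x, y))%:E)%E}.
Proof.
apply: filterS (ae_integrable2 fI) => y fy.
by rewrite [in RHS]rint_EFin.
Qed.

Lemma rfubini1 : \int[m1]_x \int[m2]_y f (x, y) = \int[(m1 \x m2)%E]_z f z.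
Proof.
rewrite {1}/Rintegral [RHS]/Rintegral -(integral12_prod_meas1 fI).
congr fine; apply: ae_eq_integral => //.
- by apply/measurable_EFinP; exact: rfubini_meas1.
- exact: (measurable_int _ (integrable_fubini_F fI)).
- by apply: filterS ae1 => x /= + _ => ->.
Qed.

Lemma rfubini2 : \int[m2]_y \int[m1]_x f (x, y) = \int[(m1 \x m2)%E]_z f z.
Proof.
rewrite {1}/Rintegral [RHS]/Rintegral -(integral21_prod_meas1 fI).
congr fine; apply: ae_eq_integral => //.
- by apply/measurable_EFinP; exact: rfubini_meas2.
- exact: (measurable_fubini_G fI).
- by apply: filterS ae2 => x /= + _ => ->.
Qed.

End real_fubini.

Lemma cvg_dist0 (R : realType) T (F : set_system T) (FF : Filter F) (u : T -> R) l :
  u x @[x --> F] --> l -> `|u x - l| @[x --> F] --> (0 : R).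
Proof.
move=> /cvgrPdist_le ul; apply/cvgrPdist_le => e /ul; apply: filterS => x.
by rewrite sub0r normrN normr_id distrC.
Qed.

Section complex_integral.
Context d (T : measurableType d) (R : realType) (mu : {measure set T -> \bar R}).
Implicit Types (f g : T -> R[i]).
Local Notation rI f := (mu.-integrable setT (EFin \o f)).

Definition cmeas f := measurable_fun setT (fun x => complex.Re (f x)) /\
  measurable_fun setT (fun x => complex.Im (f x)).

Definition cI f := rI (fun x => complex.Re (f x)) /\ rI (fun x => complex.Im (f x)).

Definition cint f : R[i] :=
  (\int[mu]_x complex.Re (f x)) +i* (\int[mu]_x complex.Im (f x)).

Lemma cmeas_cst (a : R[i]) : cmeas (fun=> a).
Proof. by split; exact: measurable_cst. Qed.

Lemma cmeasD f g : cmeas f -> cmeas g -> cmeas (fun x => f x + g x).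
Proof.
move=> [f1 f2] [g1 g2]; split.
  by under eq_fun => x do rewrite cReD; exact: measurable_funD.
by under eq_fun => x do rewrite cImD; exact: measurable_funD.
Qed.

Lemma cmeasN f : cmeas f -> cmeas (fun x => - f x).
Proof.
move=> [f1 f2]; split.
  by under eq_fun => x do rewrite cReN; exact: measurable_funN.
by under eq_fun => x do rewrite cImN; exact: measurable_funN.
Qed.

Lemma cmeasB f g : cmeas f -> cmeas g -> cmeas (fun x => f x - g x).
Proof. by move=> mf mg; apply: cmeasD => //; exact: cmeasN. Qed.

Lemma cmeasM f g : cmeas f -> cmeas g -> cmeas (fun x => f x * g x).
Proof.
move=> [f1 f2] [g1 g2]; split.
  under eq_fun => x do rewrite cReM.
  by apply: measurable_funB; exact: measurable_funM.
under eq_fun => x do rewrite cImM.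
by apply: measurable_funD; exact: measurable_funM.
Qed.

Lemma cmeasJ f : cmeas f -> cmeas (fun x => ((f x)^*)%R).
Proof.
move=> [f1 f2]; split; first by under eq_fun => x do rewrite cReJ.
by under eq_fun => x do rewrite cImJ; exact: measurable_funN.
Qed.

Lemma cmeas_real (g : T -> R) : measurable_fun setT g -> cmeas (fun x => (g x)%:C).
Proof. by move=> mg; split => //=; exact: measurable_cst. Qed.

Lemma cmeas_sum n (F : nat -> T -> R[i]) : (forall j, (j < n)%N -> cmeas (F j)) ->
  cmeas (fun x => \sum_(j < n) F j x).
Proof.
elim: n => [|n IH] hF.
  by under eq_fun => x do rewrite big_ord0; exact: cmeas_cst.
under eq_fun => x do rewrite big_ord_recr/=.
by apply: cmeasD; [apply: IH => j /ltnW/hF|exact: hF].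
Qed.

Lemma measurable_normsq f : cmeas f -> measurable_fun setT (fun x => normsq (f x)).
Proof.
by move=> [f1 f2]; apply: measurable_funD; exact: measurable_funX.
Qed.

Lemma measurable_normc f : cmeas f -> measurable_fun setT (fun x => Normc.normc (f x)).
Proof.
move=> mf; under eq_fun => x do rewrite normc_normsq -powR12_sqrt ?normsq_ge0//.
apply: (@measurableT_comp _ _ _ _ _ _ (fun y : R => y `^ 2^-1)) => //.
exact: measurable_normsq.
Qed.

Lemma cI_meas f : cI f -> cmeas f.
Proof. by move=> [f1 f2]; split; [exact: (rI_meas f1)|exact: (rI_meas f2)]. Qed.

Lemma cI_le f (g : T -> R) : cmeas f -> (forall x, Normc.normc (f x) <= g x) ->
  rI g -> cI f.
Proof.
move=> [f1 f2] fg gI; split.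
  by apply: rI_le f1 _ gI => x; exact: le_trans (ler_normc_Re _) (fg x).
by apply: rI_le f2 _ gI => x; exact: le_trans (ler_normc_Im _) (fg x).
Qed.

Lemma cI_normc f : cI f -> rI (fun x => Normc.normc (f x)).
Proof.
move=> fI; have mf := cI_meas fI; have [f1 f2] := fI.
apply: (@rI_le _ _ _ _ _ (fun x => `|complex.Re (f x)| + `|complex.Im (f x)|)).
- exact: measurable_normc.
- by move=> x; rewrite ger0_norm ?normc_ge0// ler_normc_ReIm.
- by apply: rID; exact: rI_norm.
Qed.

Lemma cID f g : cI f -> cI g -> cI (fun x => f x + g x).
Proof.
move=> [f1 f2] [g1 g2]; split.
  by under eq_fun => x do rewrite cReD; exact: rID.
by under eq_fun => x do rewrite cImD; exact: rID.
Qed.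

Lemma cIM_bounded (B : R) f g : cI f -> cmeas g ->
  (forall x, Normc.normc (g x) <= B) -> cI (fun x => f x * g x).
Proof.
move=> fI mg gB; apply: (@cI_le _ (fun x => B * Normc.normc (f x))).
- by apply: cmeasM => //; exact: cI_meas.
- by move=> x; rewrite Normc.normcM mulrC ler_wpM2r ?normc_ge0.
- by apply: rIZ; exact: cI_normc.
Qed.

Lemma cIZ a f : cI f -> cI (fun x => a * f x).
Proof.
move=> fI; under eq_fun => x do rewrite mulrC.
by apply: (cIM_bounded (B := Normc.normc a) fI) => //; exact: cmeas_cst.
Qed.

Lemma cIJ f : cI f -> cI (fun x => ((f x)^*)%R).
Proof.
move=> [f1 f2]; split; first by under eq_fun => x do rewrite cReJ.
by under eq_fun => x do rewrite cImJ; exact: rIN.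
Qed.

Lemma cI0 : cI (fun=> 0).
Proof. by split; exact: rI0. Qed.

Lemma cI_real (g : T -> R) : rI g -> cI (fun x => (g x)%:C).
Proof. by move=> gI; split => //=; exact: rI0. Qed.

Lemma cI_sum n (F : nat -> T -> R[i]) : (forall j, (j < n)%N -> cI (F j)) ->
  cI (fun x => \sum_(j < n) F j x).
Proof.
elim: n => [|n IH] hF.
  by under eq_fun => x do rewrite big_ord0; exact: cI0.
under eq_fun => x do rewrite big_ord_recr/=.
by apply: cID; [apply: IH => j /ltnW/hF|exact: hF].
Qed.

Lemma cintD f g : cI f -> cI g -> cint (fun x => f x + g x) = cint f + cint g.
Proof.
move=> [f1 f2] [g1 g2]; apply: complex_eqP => /=.
  by under eq_Rintegral => x _ do rewrite cReD; rewrite RintegralD.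
by under eq_Rintegral => x _ do rewrite cImD; rewrite RintegralD.
Qed.

Lemma cintZ a f : cI f -> cint (fun x => a * f x) = a * cint f.
Proof.
move=> [f1 f2]; apply: complex_eqP; rewrite ?cReM ?cImM /=.
  under eq_Rintegral => x _ do rewrite cReM.
  by rewrite RintegralB ?RintegralZl//; exact: rIZ.
under eq_Rintegral => x _ do rewrite cImM.
by rewrite RintegralD ?RintegralZl//; exact: rIZ.
Qed.

Lemma cintJ f : cI f -> cint (fun x => ((f x)^*)%R) = ((cint f)^*)%R.
Proof.
move=> [f1 f2]; apply: complex_eqP; rewrite ?cReJ ?cImJ /=.
  by apply: eq_Rintegral => x _; rewrite cReJ.
under eq_Rintegral => x _ do rewrite cImJ -mulN1r.
by rewrite RintegralZl// mulN1r.
Qed.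

Lemma cint_real (g : T -> R) : cint (fun x => (g x)%:C) = (\int[mu]_x g x)%:C.
Proof. by rewrite /cint /= Rintegral_cst// mul0r. Qed.

Lemma cint_sum n (F : nat -> T -> R[i]) : (forall j, (j < n)%N -> cI (F j)) ->
  cint (fun x => \sum_(j < n) F j x) = \sum_(j < n) cint (F j).
Proof.
elim: n => [|n IH] hF.
  rewrite big_ord0; under eq_fun => x do rewrite big_ord0.
  by rewrite (cint_real (fun=> 0)) Rintegral_cst// mul0r.
under eq_fun => x do rewrite big_ord_recr/=.
rewrite big_ord_recr/= cintD//; last exact: hF.
  by rewrite IH// => j /ltnW/hF.
by apply: cI_sum => j /ltnW/hF.
Qed.

Lemma cint_ae f g : {ae mu, forall x, f x = g x} -> cmeas f -> cmeas g ->
  cint f = cint g.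
Proof.
move=> fg [f1 f2] [g1 g2]; congr (_ +i* _); apply: rint_ae => //;
by apply: filterS fg => x ->.
Qed.

Lemma cint_null f g (N : set T) : cmeas g -> measurable N -> mu N = 0%E ->
  (forall x, ~ N x -> f x = g x) -> cint f = cint g.
Proof.
move=> [g1 g2] mN N0 fg; congr (_ +i* _);
by apply: (rint_null _ mN N0) => // x /fg ->.
Qed.

Lemma cdct (f_ : nat -> T -> R[i]) f (g : T -> R) :
  (forall k, cmeas (f_ k)) -> cmeas f ->
  {ae mu, forall x, Normc.normc (f_ k x - f x) @[k --> \oo] --> (0 : R)} ->
  (forall k x, Normc.normc (f_ k x) <= g x) -> rI g ->
  cI f /\ Normc.normc (cint (f_ k) - cint f) @[k --> \oo] --> (0 : R).
Proof.
move=> mf_ [f1 f2] ff fg gI.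
have toR (u : nat -> R) (v : nat -> R[i]) l :
    (forall k, `|u k - l| <= Normc.normc (v k)) ->
    Normc.normc (v k) @[k --> \oo] --> (0 : R) -> u k @[k --> \oo] --> l.
  move=> uv v0; apply/cvgrPdist_le => e e0.
  move/cvgrPdist_le : v0 => /(_ e e0); apply: filterS => k.
  rewrite sub0r normrN ger0_norm ?normc_ge0// => h.
  by rewrite distrC; exact: le_trans (uv k) h.
have [|||||fI1 c1] := @rdct _ _ _ mu (fun k x => complex.Re (f_ k x))
    (fun x => complex.Re (f x)) g.
- by move=> k; have [] := mf_ k.
- exact: f1.
- apply: filterS ff => x fx; apply: toR fx => k.
  by rewrite -cReN -cReD ler_normc_Re.
- by move=> k x; exact: le_trans (ler_normc_Re _) (fg k x).
- exact: gI.
have [|||||fI2 c2] := @rdct _ _ _ mu (fun k x => complex.Im (f_ k x))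
    (fun x => complex.Im (f x)) g.
- by move=> k; have [] := mf_ k.
- exact: f2.
- apply: filterS ff => x fx; apply: toR fx => k.
  by rewrite -cImN -cImD ler_normc_Im.
- by move=> k x; exact: le_trans (ler_normc_Im _) (fg k x).
- exact: gI.
split => //.
apply: (@cvg0_le _ _ _ _ _ (fun k => `|complex.Re (cint (f_ k) - cint f)| +
   `|complex.Im (cint (f_ k) - cint f)|)).
  by move=> k; rewrite normc_ge0 ler_normc_ReIm.
rewrite -[X in _ --> X](addr0 (0 : R)); apply: cvgD.
- by under eq_cvg => k do rewrite cReD cReN; exact: cvg_dist0.
- by under eq_cvg => k do rewrite cImD cImN; exact: cvg_dist0.
Qed.

End complex_integral.

Section complex_fubini.
Context d1 d2 (T1 : measurableType d1) (T2 : measurableType d2) (R : realType).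
Variable m1 : {sigma_finite_measure set T1 -> \bar R}.
Variable m2 : {sigma_finite_measure set T2 -> \bar R}.

Lemma rI_prod (u : T1 -> R) (v : T2 -> R) :
  m1.-integrable setT (EFin \o u) -> m2.-integrable setT (EFin \o v) ->
  (m1 \x m2)%E.-integrable setT (EFin \o (fun z => u z.1 * v z.2)).
Proof.
move=> uI vI; have mu := rI_meas uI; have mv := rI_meas vI.
apply/integrable12ltyP.
  apply/measurable_EFinP; apply: measurable_funM.
    exact: measurableT_comp.
  exact: measurableT_comp.
have e x : (\int[m2]_y `|(EFin \o (fun z : T1 * T2 => (u z.1 * v z.2)%R)) (x, y)| =
    `|u x|%:E * \int[m2]_y `|v y|%:E)%E.
  under eq_integral => y _ do rewrite /= normrM EFinM.
  rewrite ge0_integralZl//.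
  by apply/measurable_EFinP; exact: measurableT_comp.
under eq_integral => x _ do rewrite e.
rewrite ge0_integralZr//; last 2 first.
- by apply/measurable_EFinP; exact: measurableT_comp.
- by apply: integral_ge0 => y _; rewrite lee_fin.
have := rI_ge0_lty (rI_norm uI); have := rI_ge0_lty (rI_norm vI) => h1 h2.
apply: lte_mul_pinfty => //; first by apply: integral_ge0 => y _; rewrite lee_fin.
by rewrite ge0_fin_numE//; apply: integral_ge0 => y _; rewrite lee_fin.
Qed.

Lemma cmeas_comp d3 (T3 : measurableType d3) (f : T1 -> R[i]) (h : T3 -> T1) :
  cmeas f -> measurable_fun setT h -> cmeas (fun x => f (h x)).
Proof.
move=> [f1 f2] mh; split.
  exact: (@measurableT_comp _ _ _ _ _ _ (fun x => complex.Re (f x))).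
exact: (@measurableT_comp _ _ _ _ _ _ (fun x => complex.Im (f x))).
Qed.

Lemma cI_prod (B : R) (f : T1 -> R[i]) (g : T2 -> R[i]) (b : T1 * T2 -> R[i]) :
  cI m1 f -> cI m2 g -> cmeas b -> (forall z, Normc.normc (b z) <= B) ->
  cI (m1 \x m2)%E (fun z => f z.1 * g z.2 * b z).
Proof.
move=> fI gI mb bB; apply: (@cI_le _ _ _ _ _
    (fun z => B * (Normc.normc (f z.1) * Normc.normc (g z.2)))).
- apply: cmeasM => //; apply: cmeasM.
    by have [f1 f2] := cI_meas fI; split;
      [exact: (measurableT_comp f1)|exact: (measurableT_comp f2)].
  by have [f1 f2] := cI_meas gI; split;
    [exact: (measurableT_comp f1)|exact: (measurableT_comp f2)].
- move=> z; rewrite !Normc.normcM mulrC ler_wpM2r// mulr_ge0 ?normc_ge0//.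
- by apply: rIZ; apply: (@rI_prod (fun x => Normc.normc (f x))
    (fun x => Normc.normc (g x))); exact: cI_normc.
Qed.

Lemma cfubini1 (f : T1 * T2 -> R[i]) : cI (m1 \x m2)%E f ->
  cint m1 (fun x => cint m2 (fun y => f (x, y))) = cint (m1 \x m2)%E f.
Proof.
move=> [f1 f2]; congr (_ +i* _).
  exact: (rfubini1 (f := fun z => complex.Re (f z))).
exact: (rfubini1 (f := fun z => complex.Im (f z))).
Qed.

Lemma cfubini2 (f : T1 * T2 -> R[i]) : cI (m1 \x m2)%E f ->
  cint m2 (fun y => cint m1 (fun x => f (x, y))) = cint (m1 \x m2)%E f.
Proof.
move=> [f1 f2]; congr (_ +i* _).
  exact: (rfubini2 (f := fun z => complex.Re (f z))).
exact: (rfubini2 (f := fun z => complex.Im (f z))).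
Qed.

Lemma cfubini (f : T1 * T2 -> R[i]) : cI (m1 \x m2)%E f ->
  cint m1 (fun x => cint m2 (fun y => f (x, y))) =
  cint m2 (fun y => cint m1 (fun x => f (x, y))).
Proof. by move=> fI; rewrite cfubini1// cfubini2. Qed.

Lemma cfubini_meas1 (f : T1 * T2 -> R[i]) : cI (m1 \x m2)%E f ->
  cmeas (fun x => cint m2 (fun y => f (x, y))).
Proof.
move=> [f1 f2]; split; [exact: (rfubini_meas1 f1)|exact: (rfubini_meas1 f2)].
Qed.

End complex_fubini.

(** * Square integrable functions *)

(** Subtracting and adding 2 C 2^-j, which bounds the sum of all later steps, gives nested
    intervals: [b] increases, [c] decreases, and the limit lies between them. *)
Lemma geometric_steps_cvg (R : realType) (a : nat -> R) (C : R) :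
  (forall j, `|a j.+1 - a j| <= C * 2 ^- j) ->
  exists l, a j @[j --> \oo] --> l /\ forall j, `|l - a j| <= 2 * C * 2 ^- j.
Proof.
move=> aC; pose b j := a j - 2 * C * 2 ^- j; pose c j := a j + 2 * C * 2 ^- j.
have half j : 2 ^- j.+1 = 2 ^- j / 2 :> R by rewrite exprS invfM mulrC.
have bnd : nondecreasing_seq b.
  apply/nondecreasing_seqP => j; rewrite /b half.
  have := aC j; rewrite ler_norml; lra.
have cni : nonincreasing_seq c.
  apply/nonincreasing_seqP => j; rewrite /c half.
  have := aC j; rewrite ler_norml; lra.
have C0 j : 0 <= C * 2 ^- j by exact: le_trans (aC j).
have bc j : b j <= c j by rewrite /b /c; have := C0 j; lra.
have ub : has_ubound (range b).
  exists (c 0%N) => _ [j _ <-]; exact: le_trans (bc j) (cni _ _ (leq0n j)).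
have bcv := nondecreasing_is_cvgn bnd ub.
have t0 : (2 * C * 2 ^- j) @[j --> \oo] --> (0 : R).
  rewrite -[X in _ --> X](mulr0 (2 * C)); apply: cvgM; first exact: cvg_cst.
  have /cvg_geometric h : `|2^-1 : R| < 1 by rewrite ger0_norm ?invr_ge0//; lra.
  have := h 1; apply: cvg_trans; apply: near_eq_cvg; apply: nearW => k /=.
  by rewrite mul1r exprVn.
exists (limn b); split.
  have -> : a = (fun j => b j + 2 * C * 2 ^- j) by apply/funext => j; rewrite /b subrK.
  by rewrite -[X in _ --> X]addr0; apply: cvgD.
move=> j; have h1 := nondecreasing_cvgn_le bnd bcv j.
have h2 : limn b <= c j.
  apply: limr_le => //; near=> k.
  have jk : (j <= k)%N by near: k; exists j.
  exact: le_trans (bc k) (cni _ _ jk).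
rewrite ler_norml; move: h1 h2; rewrite /b /c; lra.
Unshelve. all: by end_near.
Qed.

Section real_L2.
Context d (T : measurableType d) (R : realType) (mu : {measure set T -> \bar R}).
Implicit Types (f g : T -> R) (u : nat -> T -> R).
Local Notation rI f := (mu.-integrable setT (EFin \o f)).
Local Notation sqI f := (rI (fun x => f x ^+ 2)).

Lemma Lfun2P f : f \in Lfun mu 2%:E <-> measurable_fun setT f /\ sqI f.
Proof.
split=> [f2|[mf f2]].
  split; last exact: Lfun2_integrable_sqr.
  by move: f2; rewrite inE => /andP[]; rewrite inE.
rewrite inE; apply/andP; split; rewrite inE//= /finite_norm unlock.
apply: poweR_lty.
apply: le_lt_trans (rI_ge0_lty f2).
rewrite le_eqVlt; apply/orP; left; apply/eqP; apply: eq_integral => x _ /=.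
by rewrite powR_mulrn// real_normK ?num_real.
Qed.

Lemma sqI_D f g : measurable_fun setT f -> measurable_fun setT g ->
  sqI f -> sqI g -> sqI (fun x => f x + g x).
Proof.
move=> mf mg f2 g2; apply: (@rI_le _ _ _ _ _ (fun x => 2 * f x ^+ 2 + 2 * g x ^+ 2)).
- by apply: measurable_funX; exact: measurable_funD.
- move=> x; rewrite ger0_norm ?sqr_ge0// -subr_ge0.
  have -> : 2 * f x ^+ 2 + 2 * g x ^+ 2 - (f x + g x) ^+ 2 = (f x - g x) ^+ 2 by ring.
  exact: sqr_ge0.
- by apply: rID; exact: rIZ.
Qed.

Lemma sqI_N f : sqI f -> sqI (fun x => - f x).
Proof. by under [X in _ -> rI X]eq_fun => x do rewrite sqrrN. Qed.

Lemma sqI_B f g : measurable_fun setT f -> measurable_fun setT g ->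
  sqI f -> sqI g -> sqI (fun x => f x - g x).
Proof.
move=> mf mg f2 g2; apply: (@sqI_D f (fun x => - g x)) => //.
  exact: measurable_funN.
exact: sqI_N.
Qed.

Lemma rint_sqD_le f g : measurable_fun setT f -> measurable_fun setT g ->
  sqI f -> sqI g ->
  \int[mu]_x (f x + g x) ^+ 2 <= 2 * \int[mu]_x f x ^+ 2 + 2 * \int[mu]_x g x ^+ 2.
Proof.
move=> mf mg f2 g2; rewrite -!RintegralZl// -RintegralD//; [|exact: rIZ|exact: rIZ].
apply: le_Rintegral => //; [exact: sqI_D|by apply: rID; exact: rIZ|move=> x _].
rewrite -subr_ge0.
have -> : 2 * f x ^+ 2 + 2 * g x ^+ 2 - (f x + g x) ^+ 2 = (f x - g x) ^+ 2 by ring.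
exact: sqr_ge0.
Qed.

(* A subsequence whose steps have squared norm at most [8 ^- j] has
   [sum_j 4 ^ j (v_(j+1) - v_j)^2] finite almost everywhere, hence converges
   geometrically there. *)
Lemma real_L2_complete u : (forall k, measurable_fun setT (u k)) ->
  (forall k, sqI (u k)) ->
  (forall eps : R, 0 < eps -> exists N : nat, forall j k : nat,
     (N <= j)%N -> (N <= k)%N -> \int[mu]_x (u j x - u k x) ^+ 2 <= eps) ->
  exists f, [/\ measurable_fun setT f, sqI f &
    \int[mu]_x (u k x - f x) ^+ 2 @[k --> \oo] --> (0 : R)].
Proof.
move=> mu_ u2 uC.
have /choice[K KP] : forall i : nat, exists N : nat, forall j k : nat,
    (N <= j)%N -> (N <= k)%N -> \int[mu]_x (u j x - u k x) ^+ 2 <= 8 ^- i.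
  by move=> i; apply: uC; rewrite invr_gt0 exprn_gt0.
(* The maximum makes the chosen indices nondecreasing, so that k_ i and k_ i.+1 are both at least K
   i. *)
pose k_ i := (\max_(j < i.+1) K j)%N.
have kK i : (K i <= k_ i)%N by apply: (leq_bigmax (@Ordinal i.+1 i _)).
have kS i : (k_ i <= k_ i.+1)%N by rewrite /k_ [X in (_ <= X)%N]big_ord_recr/= leq_maxl.
pose v i := u (k_ i).
have mv i : measurable_fun setT (v i) by exact: mu_.
pose D i x := 4 ^+ i * (v i.+1 x - v i x) ^+ 2.
have D0 i x : 0 <= D i x by apply: mulr_ge0; [exact: exprn_ge0|exact: sqr_ge0].
have mD i : measurable_fun setT (D i).
  apply: measurable_funM => //; apply: measurable_funX; exact: measurable_funB.
have v2 i : sqI (v i) by exact: u2.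
have vB2 i j : sqI (fun x => v i x - v j x) by apply: sqI_B => //; exact: v2.
have iD i : (\int[mu]_x (D i x)%:E <= (2 ^- i)%:E)%E.
  rewrite rint_EFin; last by apply: rIZ; exact: vB2.
  rewrite lee_fin RintegralZl//.
  have -> : 2 ^- i = 4 ^+ i * 8 ^- i :> R.
    have -> : (8 : R) = 2 * 4 by ring.
    by rewrite exprMn; field; rewrite !expf_neq0 ?pnatr_eq0.
  rewrite ler_wpM2l ?exprn_ge0//; apply: KP => //.
  exact: leq_trans (kS i).
pose G x : \bar R := (\sum_(i <oo) (D i x)%:E)%E.
have G0 x : (0 <= G x)%E by apply: nneseries_ge0 => i _ _; rewrite lee_fin.
have mG : measurable_fun setT G.
  rewrite /G; apply: (ge0_emeasurable_sum (P := xpredT)) => //.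
    by move=> i x _ _; rewrite lee_fin.
  by move=> i _; exact/measurable_EFinP.
have iG : (\int[mu]_x G x <= 2%:E)%E.
  rewrite integral_nneseries//; last 2 first.
    by move=> i; exact/measurable_EFinP.
    by move=> i x _; rewrite lee_fin.
  apply: lime_le.
    by apply: is_cvg_nneseries => i _ _; apply: integral_ge0 => x _; rewrite lee_fin.
  apply: nearW => m.
  apply: (@le_trans _ _ (\sum_(0 <= i < m) (2 ^- i)%:E)%E); first exact: lee_sum.
  rewrite sumEFin lee_fin.
  have -> : \sum_(0 <= i < m) 2 ^- i = 2 - 2 * 2 ^- m :> R.
    elim: m => [|m IH]; first by rewrite big_nil expr0 invr1; ring.
    by rewrite big_nat_recr//= IH exprS invfM; field; rewrite expf_neq0// pnatr_eq0.
  by rewrite gerBl mulr_ge0// invr_ge0 exprn_ge0.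
have GI : mu.-integrable setT G.
  apply/integrableP; split => //; under eq_integral => x _ do rewrite gee0_abs//.
  by apply: le_lt_trans iG _; rewrite ltry.
have [N [mN N0 NP]] := integrable_ae measurableT GI.
pose g x := fine (G x).
have g0 x : 0 <= g x by rewrite fine_ge0.
have mg : measurable_fun setT g by apply: (@measurableT_comp _ _ _ _ _ _ fine).
have gI : rI g.
  apply/integrableP; split; first exact/measurable_EFinP.
  apply: le_lt_trans (_ : (\int[mu]_x G x < +oo)%E); last first.
    by apply: le_lt_trans iG _; rewrite ltry.
  apply: ge0_le_integral => //.
  - by apply: measurableT_comp => //; exact/measurable_EFinP.
  - move=> x _ /=; rewrite ger0_norm// /g; have := G0 x.
    by case: (G x) => [r||]//= _; rewrite ?leey// leey.
have Gg x : ~ N x -> forall i, D i x <= g x.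
  move=> Nx i; have Gfin : G x \is a fin_num.
    by apply: contrapT => nG; apply: Nx; apply: NP => /(_ I).
  rewrite -lee_fin /g fineK//.
  apply: le_trans (@nneseries_lim_ge _ (fun i => (D i x)%:E) xpredT 0%N i.+1 _).
    rewrite big_nat_recr//= leeDr// sume_ge0// => j _; by rewrite lee_fin.
  by move=> j _ _; rewrite lee_fin.
have step x : ~ N x -> forall i, `|v i.+1 x - v i x| <= Num.sqrt (g x) * 2 ^- i.
  move=> Nx i; rewrite ler_pdivlMr ?exprn_gt0// -sqrtr_sqr.
  have -> : (2 ^+ i : R) = Num.sqrt ((2 ^+ i) ^+ 2) by rewrite sqrtr_sqr ger0_norm ?exprn_ge0.
  rewrite -sqrtrM ?sqr_ge0// ler_wsqrtr// mulrC -exprM mulnC exprM.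
  have -> : (2 ^+ 2 : R) = 4 by rewrite expr2; ring.
  exact: Gg.
have /choice[f fP] : forall x, exists l, ~ N x ->
    v j x @[j --> \oo] --> l /\ forall j, `|l - v j x| <= 2 * Num.sqrt (g x) * 2 ^- j.
  move=> x; have [Nx|Nx] := pselect (N x); first by exists 0.
  by have [l lP] := geometric_steps_cvg (step x Nx); exists l.
(* Set to 0 on the exceptional null set, F is an everywhere pointwise limit of measurable
   functions. *)
pose F x := if x \in N then 0 else f x.
have mF : measurable_fun setT F.
  apply: (@measurable_fun_cvg _ _ _ _ (fun j x => if x \in N then 0 else v j x)).
    move=> j; apply: measurable_fun_ifT => //; exact: measurable_fun_in.
  move=> x _; rewrite /F; case: ifPn => [_|/negP xN]; first exact: cvg_cst.
  by have [] := fP x (fun h => xN (mem_set h)).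
have aeN : {ae mu, forall x, ~ N x}.
  by exists N; split => // x /= /contrapT.
have vF j x : ~ N x -> (v j x - F x) ^+ 2 <= 4 * 4 ^- j * g x.
  move=> Nx; have [_ /(_ j)] := fP x Nx; rewrite /F memNset// distrC => h.
  rewrite -real_normK ?num_real//.
  have -> : 4 * 4 ^- j * g x = (2 * Num.sqrt (g x) * 2 ^- j) ^+ 2.
    rewrite !exprMn sqr_sqrtr// exprVn -exprM mulnC exprM.
    have -> : (2 ^+ 2 : R) = 4 by rewrite expr2; ring.
    by ring.
  by rewrite ler_pXn2r ?nnegrE// mulr_ge0 ?mulr_ge0 ?sqrtr_ge0 ?invr_ge0 ?exprn_ge0.
pose h j x := if x \in N then 0 else v j x - F x.
have mh j : measurable_fun setT (h j).
  apply: measurable_fun_ifT => //; [exact: measurable_fun_in|exact: measurable_funB].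
have hle j x : `|h j x ^+ 2| <= 4 * 4 ^- j * g x.
  rewrite ger0_norm ?sqr_ge0// /h; case: ifPn => [_|/negP xN].
    by rewrite expr0n mulr_ge0// mulr_ge0// invr_ge0 exprn_ge0.
  by apply: vF => /mem_set.
have h2 j : sqI (h j).
  by apply: rI_le (hle j) _; [exact: measurable_funX|exact: rIZ].
have hae j : {ae mu, forall x, h j x ^+ 2 = (v j x - F x) ^+ 2}.
  by apply: filterS aeN => x nx; rewrite /h memNset.
have mvF j : measurable_fun setT (fun x => v j x - F x) by exact: measurable_funB.
have vF2 j : sqI (fun x => v j x - F x).
  by apply: rI_ae (hae j) _ (h2 j); exact: measurable_funX.
have ivF j : \int[mu]_x (v j x - F x) ^+ 2 <= 8 * 4 ^- j.
  rewrite -(rint_ae (hae j)); [|exact: measurable_funX|exact: measurable_funX].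
  apply: (@le_trans _ _ (\int[mu]_x (4 * 4 ^- j * g x))).
    apply: le_Rintegral => //; first exact: rIZ.
    by move=> x _; exact: le_trans (ler_norm _) (hle j x).
  rewrite RintegralZl//.
  have -> : 8 * 4 ^- j = 4 * 4 ^- j * 2 :> R by ring.
  rewrite ler_wpM2l ?mulr_ge0 ?invr_ge0 ?exprn_ge0//.
  rewrite -lee_fin -rint_EFin//; apply: le_trans iG.
  apply: ge0_le_integral => //.
    by move=> x _; rewrite lee_fin.
    exact/measurable_EFinP.
  move=> x _; rewrite /g; have := G0 x; by case: (G x) => [r||]//= _; rewrite leey.
have F2 : sqI F.
  rewrite (_ : (fun x => F x ^+ 2) = (fun x => (v 0%N x - (v 0%N x - F x)) ^+ 2)).
    by apply: sqI_B => //; exact: u2.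
  by apply/funext => x; congr (_ ^+ 2); ring.
exists F; split => //; apply/cvgrPdist_le => eps e0.
(* 18 = 2 + 16: twice the squared distance 8^-j <= 4^-j from u k to v j, and twice the bound 8 4^-j
   for that from v j to F. *)
pose j := (Num.truncn (18 / eps)).+1.
have j4 : 18 * 4 ^- j <= eps.
  rewrite ler_pdivrMr ?exprn_gt0// mulrC -ler_pdivrMr//.
  apply: (le_trans (ltW (truncnS_gt _))).
  by rewrite -natrX ler_nat ltnW// ltn_expl.
exists (K j) => // k /= Kk.
rewrite sub0r normrN ger0_norm; last by apply: Rintegral_ge0 => x _; exact: sqr_ge0.
have -> : (fun x => (u k x - F x) ^+ 2) =
    (fun x => ((u k x - v j x) + (v j x - F x)) ^+ 2).
  by apply/funext => x; congr (_ ^+ 2); ring.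
have h1 : \int[mu]_x (u k x - v j x) ^+ 2 <= 8 ^- j by exact: KP.
have ukv : measurable_fun setT (fun x => u k x - v j x) by exact: measurable_funB.
have h3 := rint_sqD_le ukv (mvF j) (sqI_B (mu_ k) (mv j) (u2 k) (u2 _)) (vF2 j).
have h4 := ivF j.
have h5 : 8 ^- j <= 4 ^- j :> R.
  by rewrite lef_pV2 ?posrE ?exprn_gt0// lerXn2r ?nnegrE//; lra.
apply: (le_trans h3); lra.
Qed.

End real_L2.

Section complex_L2.
Context {R : realType} {n : nat}.
Local Notation V := 'rV[R]_n.
Local Notation mu := (@lebesgue_rV R n).
Implicit Types (f g h : V -> R[i]).
Local Notation rI f := (mu.-integrable setT (EFin \o f)).
Local Notation ipn := (ip_norm (@inner R n)).

Lemma L2P f : L2 f <-> cmeas f /\ rI (fun x => normsq (f x)).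
Proof.
split=> [[/Lfun2P[f1 f12] /Lfun2P[f2 f22]]|[[f1 f2] fn]].
  by split; [split|exact: rID].
split; apply/Lfun2P; split => //.
- apply: rI_le _ _ fn; first exact: measurable_funX.
  by move=> x; rewrite ger0_norm ?sqr_ge0// /normsq lerDl sqr_ge0.
- apply: rI_le _ _ fn; first exact: measurable_funX.
  by move=> x; rewrite ger0_norm ?sqr_ge0// /normsq lerDr sqr_ge0.
Qed.

Lemma L2_meas f : L2 f -> cmeas f.
Proof. by move=> /L2P[]. Qed.

Lemma L2_normsq f : L2 f -> rI (fun x => normsq (f x)).
Proof. by move=> /L2P[]. Qed.

Lemma normsqD_le (z w : R[i]) : normsq (z + w) <= 2 * normsq z + 2 * normsq w.
Proof.
rewrite /normsq cReD cImD -subr_ge0.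
rewrite (_ : _ - _ = (complex.Re z - complex.Re w) ^+ 2 +
  (complex.Im z - complex.Im w) ^+ 2); first by rewrite addr_ge0 ?sqr_ge0.
by ring.
Qed.

Lemma L2_lin a f g : L2 f -> L2 g -> L2 (a *: f + g).
Proof.
move=> /L2P[mf f2] /L2P[mg g2]; apply/L2P.
have m : cmeas (a *: f + g) by apply: cmeasD => //; apply: cmeasM => //; exact: cmeas_cst.
split => //; apply: (@rI_le _ _ _ _ _
    (fun x => 2 * normsq a * normsq (f x) + 2 * normsq (g x))).
- exact: measurable_normsq.
- move=> x; rewrite ger0_norm ?normsq_ge0//.
  by apply: (le_trans (normsqD_le _ _)); rewrite normsqM mulrA.
- by apply: rID; exact: rIZ.
Qed.

Lemma L2_0 : L2 (0 : V -> R[i]).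
Proof.
apply/L2P; split; first exact: cmeas_cst.
by under eq_fun => x do rewrite normsq0; exact: rI0.
Qed.

Lemma normcM_le (z w : R[i]) : Normc.normc (z * w) <= normsq z + normsq w.
Proof.
rewrite Normc.normcM -!sqr_normc_normsq.
have := sqr_ge0 (Normc.normc z - Normc.normc w); rewrite sqrrB.
have : 0 <= Normc.normc z ^+ 2 by exact: sqr_ge0.
have : 0 <= Normc.normc w ^+ 2 by exact: sqr_ge0.
lra.
Qed.

Lemma L2_mulJ f g : L2 f -> L2 g -> cI mu (fun x => f x * (g x)^*).
Proof.
move=> /L2P[mf f2] /L2P[mg g2].
apply: (@cI_le _ _ _ _ _ (fun x => normsq (f x) + normsq (g x))).
- by apply: cmeasM => //; exact: cmeasJ.
- by move=> x; apply: le_trans (normcM_le _ _) _; rewrite normsqJ.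
- exact: rID.
Qed.

Lemma innerE f g : inner f g = cint mu (fun x => f x * (g x)^*).
Proof. by []. Qed.

Lemma inner_self f : complex.Re (inner f f) = \int[mu]_x normsq (f x).
Proof. by rewrite innerE /=; apply: eq_Rintegral => x _; rewrite mulcJ. Qed.

Lemma inner_lin a f g h : L2 f -> L2 g -> L2 h ->
  inner (a *: f + g) h = a * inner f h + inner g h.
Proof.
move=> f2 g2 h2; have fh := L2_mulJ f2 h2; have gh := L2_mulJ g2 h2.
rewrite !innerE -cintZ// -cintD//; last exact: cIZ.
by congr cint; apply/funext => x; rewrite mulrA -mulrDl.
Qed.

Lemma inner_conj f g : L2 f -> L2 g -> inner g f = ((inner f g)^*)%R.
Proof.
move=> f2 g2; rewrite !innerE -cintJ; last exact: L2_mulJ.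
by congr cint; apply/funext => x; rewrite rmorphM/= conjCK mulrC.
Qed.

Lemma sqr_ipn f : L2 f -> ipn f ^+ 2 = \int[mu]_x normsq (f x).
Proof.
move=> f2; rewrite /ip_norm inner_self sqr_sqrtr//.
by apply: Rintegral_ge0 => x _; exact: normsq_ge0.
Qed.

Lemma L2_complete (u : nat -> V -> R[i]) : (forall k, L2 (u k)) ->
  (forall eps : R, 0 < eps -> exists N : nat, forall j k : nat,
      (N <= j)%N -> (N <= k)%N -> ipn (u j - u k) <= eps) ->
  exists2 f, L2 f & ipn (u k - f) @[k --> \oo] --> (0 : R).
Proof.
move=> u2 uC.
have L2B f g : L2 f -> L2 g -> L2 (f - g).
  by move=> f2 g2; rewrite addrC -scaleN1r; exact: L2_lin.
have mu_ k := L2_meas (u2 k).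
(* Real and imaginary parts are treated alike: both are additive maps whose square is at most
   [normsq]. *)
have int_part (p : R[i] -> R) : (forall z w, p (z - w) = p z - p w) ->
    (forall z, p z ^+ 2 <= normsq z) ->
    (forall k, measurable_fun setT (fun x => p (u k x))) ->
  exists f : V -> R, [/\ measurable_fun setT f, rI (fun x => f x ^+ 2) &
    \int[mu]_x (p (u k x) - f x) ^+ 2 @[k --> \oo] --> (0 : R)].
  move=> pB pn mp.
  have p2 k : rI (fun x => p (u k x) ^+ 2).
    apply: rI_le _ _ (L2_normsq (u2 k)); first exact: measurable_funX.
    by move=> x; rewrite ger0_norm ?sqr_ge0.
  apply: (real_L2_complete mp p2) => eps e0.
  have [N NP] := uC (Num.sqrt eps) (eq_ind_r is_true e0 (sqrtr_gt0 eps)).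
  exists N => j k Nj Nk; have := NP j k Nj Nk => h.
  have h2 : ipn (u j - u k) ^+ 2 <= eps.
    rewrite -(sqr_sqrtr (ltW e0)).
    by rewrite ler_pXn2r ?nnegrE ?sqrtr_ge0 ?ip_norm_ge0.
  apply: le_trans h2; rewrite sqr_ipn; last exact: L2B.
  apply: le_Rintegral => //.
  - apply: (@rI_le _ _ _ _ _ (fun x => 2 * p (u j x) ^+ 2 + 2 * p (u k x) ^+ 2)).
    + by apply: measurable_funX; exact: measurable_funB.
    + move=> x; rewrite ger0_norm ?sqr_ge0// -subr_ge0.
      rewrite (_ : _ - _ = (p (u j x) + p (u k x)) ^+ 2) ?sqr_ge0//; ring.
    + by apply: rID; exact: rIZ.
  - by apply: L2_normsq; exact: L2B.
  - by move=> x _; rewrite -pB; exact: pn.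
have [f1 [mf1 f12 c1]] : exists f : V -> R, [/\ measurable_fun setT f, rI (fun x => f x ^+ 2) &
    \int[mu]_x (complex.Re (u k x) - f x) ^+ 2 @[k --> \oo] --> (0 : R)].
  apply: int_part => [z w|z|k].
  - by rewrite cReD cReN.
  - by rewrite /normsq lerDl sqr_ge0.
  - by have [] := mu_ k.
have [f2 [mf2 f22 c2]] : exists f : V -> R, [/\ measurable_fun setT f, rI (fun x => f x ^+ 2) &
    \int[mu]_x (complex.Im (u k x) - f x) ^+ 2 @[k --> \oo] --> (0 : R)].
  apply: int_part => [z w|z|k].
  - by rewrite cImD cImN.
  - by rewrite /normsq lerDr sqr_ge0.
  - by have [] := mu_ k.
pose f x := f1 x +i* f2 x.
have fL : L2 f by apply/L2P; split; [split|exact: rID].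
exists f => //.
have e k : ipn (u k - f) = Num.sqrt (\int[mu]_x (complex.Re (u k x) - f1 x) ^+ 2 +
    \int[mu]_x (complex.Im (u k x) - f2 x) ^+ 2).
  rewrite /ip_norm inner_self; congr Num.sqrt.
  have [mr mi] := mu_ k; have ukf := L2B _ _ (u2 k) fL.
  rewrite -RintegralD//.
  - by apply: eq_Rintegral => x _; rewrite /normsq cReD cImD cReN cImN.
  - apply: rI_le _ _ (L2_normsq ukf).
      by apply: measurable_funX; exact: measurable_funB.
    by move=> x; rewrite ger0_norm ?sqr_ge0// /normsq cReD cReN lerDl sqr_ge0.
  - apply: rI_le _ _ (L2_normsq ukf).
      by apply: measurable_funX; exact: measurable_funB.
    by move=> x; rewrite ger0_norm ?sqr_ge0// /normsq cImD cImN lerDr sqr_ge0.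
have h : (\int[mu]_x (complex.Re (u k x) - f1 x) ^+ 2 +
    \int[mu]_x (complex.Im (u k x) - f2 x) ^+ 2) @[k --> \oo] --> (0 : R).
  by rewrite -[X in _ --> X](addr0 (0 : R)); exact: cvgD.
have := cvg_comp _ _ h (@sqrt_continuous R 0); rewrite sqrtr0.
by apply: cvg_trans; apply: near_eq_cvg; apply: nearW => k /=; rewrite e.
Qed.

Lemma hilbert_L2 : hilbert (@inner R n) (@L2 R n).
Proof.
split.
- exact: L2_0.
- exact: L2_lin.
- exact: inner_lin.
- exact: inner_conj.
- move=> f _; rewrite inner_self; apply: Rintegral_ge0 => x _; exact: normsq_ge0.
- exact: L2_complete.
Qed.

Lemma inner_ae f f' g g' : {ae mu, forall x, f x = f' x} ->
  {ae mu, forall x, g x = g' x} -> L2 f -> L2 f' -> L2 g -> L2 g' ->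
  inner f g = inner f' g'.
Proof.
move=> ff' gg' f2 f'2 g2 g'2; rewrite !innerE; apply: cint_ae.
- by apply: filterS2 ff' gg' => x -> ->.
- by apply: cI_meas; exact: L2_mulJ.
- by apply: cI_meas; exact: L2_mulJ.
Qed.

Lemma ipn_eq0 f g : L2 f -> L2 g -> ipn (f - g) = 0 ->
  {ae mu, forall x, f x = g x}.
Proof.
move=> f2 g2 fg0; have fg2 := hB hilbert_L2 f2 g2.
have : \int[mu]_x normsq ((f - g) x) = 0 by rewrite -sqr_ipn// fg0 expr0n.
move=> /(rint_eq0 (L2_normsq fg2) (fun x => normsq_ge0 _)).
apply: filterS => x /normsq_eq0 h; apply/eqP; rewrite -subr_eq0; exact/eqP.
Qed.

Lemma ipn_ae f g : L2 f -> L2 g -> {ae mu, forall x, f x = g x} ->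
  ipn (f - g) = 0.
Proof.
move=> f2 g2 fg; have fg2 := hB hilbert_L2 f2 g2.
rewrite /ip_norm inner_self (_ : \int[mu]_x _ = 0) ?sqrtr0//.
transitivity (\int[mu]_x (0 : R)); last by rewrite Rintegral_cst// mul0r.
apply: rint_ae; last exact: measurable_cst.
  by apply: filterS fg => x e; rewrite (_ : (f - g) x = f x - g x)// e subrr normsq0.
by apply: measurable_normsq; exact: L2_meas.
Qed.

End complex_L2.

(** * Lebesgue measure on R^n *)

Lemma pushforward_measure d d' (T1 : measurableType d) (T2 : measurableType d')
    (R : realType) (m : {measure set T1 -> \bar R}) (f : T1 -> T2) :
  measurable_fun setT f ->
  exists nu : {measure set T2 -> \bar R}, nu = pushforward m f :> (set T2 -> \bar R).
Proof.
by move=> mf; unshelve eexists (pushforward m f : {measure set T2 -> \bar R}).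
Qed.

Section lebesgue_rV_theory.
Context {R : realType}.
Local Notation leb := (@lebesgue_measure R).
Local Notation mu n := (@lebesgue_rV R n).

(** Rational corners make these boxes countable. They serve as a base of the topology, as a
    pi-system generating the Borel sets, and as a total family in L2. *)
Definition rbox n (pq : 'rV[rat]_n * 'rV[rat]_n) : set 'rV[R]_n :=
  [set x | forall i, ratr (pq.1 ord0 i) < x ord0 i < ratr (pq.2 ord0 i)].

Definition box_open n (U : set 'rV[R]_n) := forall x, U x ->
  exists2 e : R, 0 < e & forall y : 'rV[R]_n, (forall i, `|y ord0 i - x ord0 i| < e) -> U y.

Lemma rbox_sub n (U : set 'rV[R]_n) x : box_open U -> U x ->
  exists pq, rbox pq x /\ rbox pq `<=` U.
Proof.
move=> oU Ux; have [e e0 eU] := oU x Ux.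
have /choice[p pP] : forall i, exists r : rat, x ord0 i - e < ratr r < x ord0 i.
  move=> i; have xe : x ord0 i - e < x ord0 i by rewrite gtrBl.
  by have [r rP] := rat_in_itvoo xe; exists r; move: rP; rewrite in_itv.
have /choice[q qP] : forall i, exists r : rat, x ord0 i < ratr r < x ord0 i + e.
  move=> i; have xe : x ord0 i < x ord0 i + e by rewrite ltrDl.
  by have [r rP] := rat_in_itvoo xe; exists r; move: rP; rewrite in_itv.
exists (\row_i p i, \row_i q i); split=> [i|y yb]; rewrite ?mxE.
  by have /andP[_ ->] := pP i; have /andP[-> _] := qP i.
apply: eU => i; have := yb i; rewrite !mxE ltr_norml.
have := pP i; have := qP i; lra.
Qed.

Lemma rboxI n (b1 b2 : 'rV[rat]_n * 'rV[rat]_n) :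
  exists b, rbox b = rbox b1 `&` rbox b2.
Proof.
exists (\row_i Num.max (b1.1 ord0 i) (b2.1 ord0 i),
        \row_i Num.min (b1.2 ord0 i) (b2.2 ord0 i)).
apply/seteqP; split => [x xb|x [xb1 xb2] i].
  split => i; have := xb i; rewrite !mxE !maxEle !minEle;
  case: ifPn => h1; case: ifPn => h2 /andP[];
  rewrite -?ltNge -?(ler_rat R) -?(ltr_rat R) in h1 h2; lra.
have := xb1 i; have := xb2 i; rewrite !mxE.
by rewrite maxEle minEle; case: ifP; case: ifP => _ _ /andP[a b] /andP[c d]; apply/andP.
Qed.

Definition rbox_sets n : set (set 'rV[R]_n) := range (@rbox n).

Lemma rbox_sets_setI n : setI_closed (@rbox_sets n).
Proof.
move=> _ _ [b1 _ <-] [b2 _ <-]; have [b <-] := rboxI b1 b2.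
by exists b.
Qed.

Lemma sigma_algebra_countable_bigcup T (G : set (set T)) (I : countType)
    (P : I -> Prop) (F : I -> set T) : (forall i, P i -> <<s G >> (F i)) ->
  <<s G >> (\bigcup_(i in [set i | P i]) F i).
Proof.
move=> GF.
pose K k := if unpickle k is Some i then (if `[< P i >] then F i else set0) else set0.
rewrite (_ : \bigcup_(i in _) _ = \bigcup_k K k).
  apply: sigma_algebra_bigcup => k; rewrite /K.
  case: unpickle => [i|]; last exact: sigma_algebra0.
  by case: asboolP => [/GF//|_]; exact: sigma_algebra0.
apply/seteqP; split=> x.
  by move=> [i Pi Fi]; exists (pickle i) => //; rewrite /K pickleK asboolT.
move=> [k _]; rewrite /K; case: unpickle => // i.
by case: asboolP => // Pi Fi; exists i.
Qed.

Lemma box_open_sigma n (U : set 'rV[R]_n) : box_open U -> <<s @rbox_sets n >> U.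
Proof.
move=> oU.
rewrite (_ : U = \bigcup_(b in [set b | rbox b `<=` U]) rbox b).
  apply: sigma_algebra_countable_bigcup => b _.
  by apply: sub_sigma_algebra; exists b.
apply/seteqP; split=> x; last by move=> [b bU /bU].
by move=> /(rbox_sub oU)[b [bx bU]]; exists b.
Qed.

Lemma measurable_rbox n (b : 'rV[rat]_n * 'rV[rat]_n) :
  measurable (rbox b : set 'rV[R]_n).
Proof.
rewrite (_ : rbox b = \bigcap_(i in [set: 'I_n]) ((fun x : 'rV[R]_n => x ord0 i) @^-1`
   `]ratr (b.1 ord0 i), ratr (b.2 ord0 i)[)); last first.
  apply/seteqP; split => [x xb i _|x xb i]; first by rewrite /= in_itv/=; exact: xb.
  by have := xb i I; rewrite /= in_itv/=.
apply: fin_bigcap_measurable => // i _.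
by rewrite -[X in measurable X]setTI; apply: measurable_coord => //; exact: measurable_itv.
Qed.

(** Replaces the coordinate preimages of the definition by a family stable under intersection, as
    uniqueness of measures and Dynkin induction require. The preimage of a half line is open, hence
    a countable union of rational boxes. *)
Lemma measurable_rVE n : @measurable _ 'rV[R]_n = <<s @rbox_sets n >>.
Proof.
apply/seteqP; split; last first.
  apply: smallest_sub; first exact: sigma_algebra_measurable.
  by move=> _ [b _ <-]; exact: measurable_rbox.
apply: smallest_sub; first exact: smallest_sigma_algebra.
move=> A; rewrite -bigcup_seq/= => -[i _ [B mB <-]] /=; rewrite setTI.
have {}mB : <<s @RGenOInfty.G R >> B by have := @RGenOInfty.measurableE R => e; rewrite [X in X B](esym e).
suff : @RGenOInfty.G R `<=`
    [set B | <<s @rbox_sets n >> ((fun x : 'rV[R]_n => x ord0 i) @^-1` B)].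
  move=> sub; apply: (smallest_sub _ sub mB); split => /=.
  - by rewrite preimage_set0; exact: sigma_algebra0.
  - by move=> C GC; rewrite setTD preimage_setC; exact: sigma_algebraC.
  - by move=> F GF; rewrite preimage_bigcup; exact: sigma_algebra_bigcup.
move=> _ [a ->] /=; apply: box_open_sigma => x /=; rewrite in_itv/= andbT => ax.
exists (x ord0 i - a); first by rewrite subr_gt0.
by move=> y /(_ i); rewrite in_itv/= andbT ltr_norml; lra.
Qed.

Lemma box_open_measurable n (U : set 'rV[R]_n) : box_open U -> measurable U.
Proof. by rewrite measurable_rVE; exact: box_open_sigma. Qed.

Lemma lebesgue_itvoo (p q : R) : p <= q -> leb `]p, q[%classic = (q - p)%:E.
Proof.
rewrite le_eqVlt => /orP[/eqP->|pq]; first by rewrite lebesgue_measure_itv/= ltxx subrr.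
by rewrite lebesgue_measure_itv/= lte_fin pq.
Qed.

Lemma lebesgue_rV_boxoo n (p q : 'I_n -> R) : (forall i, p i <= q i) ->
  mu n [set x | forall i, p i < x ord0 i < q i] = (\prod_(i < n) (q i - p i))%:E.
Proof.
move=> pq.
have := @lebesgue_rV_box R n (fun i => `]p i, q i[%classic) (fun i => measurable_itv _).
under eq_bigr => i _ do rewrite lebesgue_itvoo//.
by rewrite prodEFin => <-.
Qed.

Lemma lebesgue_rV_hyperplane n (i : 'I_n) (a : R) :
  mu n [set x | x ord0 i = a] = 0%E.
Proof.
pose A (j : 'I_n) : set R := if j == i then [set a] else setT.
have mA j : measurable (A j) by rewrite /A; case: ifP.
transitivity (mu n [set x | forall j, A j (x ord0 j)]).
  congr (mu n _); apply/seteqP; split => [x xi j|x /(_ i)]; rewrite /A /=.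
    by case: eqP => [->|].
  by rewrite eqxx.
rewrite lebesgue_rV_box// (bigD1 i)//= {1}/A eqxx lebesgue_measure_set1.
by rewrite mul0e.
Qed.

Definition cube n (N : nat) : 'rV[rat]_n * 'rV[rat]_n :=
  (const_mx (- N%:R), const_mx N%:R).

Lemma cubeE n N (x : 'rV[R]_n) :
  rbox (cube n N) x <-> forall i, `|x ord0 i| < N%:R.
Proof.
split=> h i; have := h i; rewrite !mxE ?rmorphN/= ?ratr_nat ltr_norml//.
Qed.

Lemma bigcup_cube n : \bigcup_N rbox (cube n N) = [set: 'rV[R]_n].
Proof.
apply/seteqP; split => // x _.
exists (\max_(i < n) (Num.truncn `|x ord0 i|).+1)%N => //; apply/cubeE => i.
apply: (lt_le_trans (truncnS_gt _)); rewrite ler_nat.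
exact: (leq_bigmax i).
Qed.

Lemma nondecreasing_cube n : nondecreasing_seq (fun N => rbox (cube n N) : set 'rV[R]_n).
Proof.
move=> N M NM; apply/subsetPset => x /cubeE h; apply/cubeE => i.
by apply: lt_le_trans (h i) _; rewrite ler_nat.
Qed.

Lemma rbox_lty n (b : 'rV[rat]_n * 'rV[rat]_n) : (mu n (rbox b) < +oo)%E.
Proof.
have [[x xb]|nb] := pselect (rbox b !=set0).
  rewrite lebesgue_rV_boxoo ?ltry// => i; have := xb i; lra.
rewrite (_ : rbox b = set0) ?measure0//.
by apply/seteqP; split => // x xb; apply: nb; exists x.
Qed.

(** Both sides are measures, the left one a scaled pushforward, and they agree on rational boxes by
    the product formula; cubes of finite measure exhaust the space, so uniqueness of measures
    applies. *)
Lemma lebesgue_rV_affine n (a : R) (b : 'rV[R]_n) A : 0 < a -> measurable A ->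
  ((a ^+ n)%:E * mu n ((fun x => (b + a *: x)%R) @^-1` A) = mu n A)%E.
Proof.
move=> a0 mA.
have mf : measurable_fun setT (fun x : 'rV[R]_n => b + a *: x).
  apply: measurable_fun_rV => i; under eq_fun => x do rewrite !mxE.
  apply: measurable_funD => //; apply: measurable_funM => //.
  exact: measurable_coord.
have [nu nuE] := pushforward_measure (mu n) mf.
have an0 : 0 <= a ^+ n by rewrite exprn_ge0// ltW.
pose m : {measure set 'rV[R]_n -> \bar R} := mscale (NngNum an0) nu.
have -> : ((a ^+ n)%:E * mu n ((fun x => (b + a *: x)%R) @^-1` A) = m A)%E.
  by rewrite /m /= /mscale /= nuE.
apply/esym; apply: (@measure_unique _ _ _ (@rbox_sets n) (fun N => rbox (cube n N))) => //.
- exact: measurable_rVE.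
- exact: rbox_sets_setI.
- by move=> N; exists (cube n N).
- exact: bigcup_cube.
- move=> _ [c _ <-].
  have -> : m (rbox c) = ((a ^+ n)%:E * mu n ((fun x => (b + a *: x)%R) @^-1` (rbox c)))%E.
    by rewrite /m /= /mscale /= nuE.
  have E i (x : 'rV[R]_n) : (ratr (c.1 ord0 i) < (b + a *: x) ord0 i < ratr (c.2 ord0 i)) =
      ((ratr (c.1 ord0 i) - b ord0 i) / a < x ord0 i < (ratr (c.2 ord0 i) - b ord0 i) / a).
    rewrite !mxE; move: (ratr (c.1 ord0 i)) (ratr (c.2 ord0 i)) => p q.
    by rewrite ltr_pdivrMr// ltr_pdivlMr// ltrBlDl ltrBrDl [a * _]mulrC.
  have preE : ((fun x => (b + a *: x)%R) @^-1` (rbox c)) = [set x | forall i,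
      (ratr (c.1 ord0 i) - b ord0 i) / a < x ord0 i < (ratr (c.2 ord0 i) - b ord0 i) / a]
      :> set 'rV[R]_n.
    by apply/seteqP; split => x xb i; have := xb i; rewrite E.
  have [[x xb]|nb] := pselect (rbox c !=set0); last first.
    have c0 : rbox c = set0.
      by apply/seteqP; split => // x xb; apply: nb; exists x.
    by rewrite c0 preimage_set0 !measure0 mule0.
  have cc i : ratr (c.1 ord0 i) <= ratr (c.2 ord0 i) :> R by have := xb i; lra.
  have cc' i : (ratr (c.1 ord0 i) - b ord0 i) / a <= (ratr (c.2 ord0 i) - b ord0 i) / a.
    by rewrite ler_pM2r ?invr_gt0// lerD2r.
  rewrite preE; apply: etrans (lebesgue_rV_boxoo cc) _.
  apply: esym; apply: etrans (congr1 _ (lebesgue_rV_boxoo cc')) _; apply: esym.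
  rewrite -EFinM; congr EFin.
  rewrite -[X in a ^+ X](card_ord n) -prodr_const -big_split/=.
  by apply: eq_bigr => i _; field; rewrite gt_eqF.
- by move=> N; exact: rbox_lty.
Qed.

Lemma measurable_affine n (a : R) (b : 'rV[R]_n) :
  measurable_fun setT (fun x : 'rV[R]_n => b + a *: x).
Proof.
apply: measurable_fun_rV => i; under eq_fun => x do rewrite !mxE.
apply: measurable_funD => //; apply: measurable_funM => //.
exact: measurable_coord.
Qed.

Lemma ge0_integral_affine n (a : R) (b : 'rV[R]_n) (h : 'rV[R]_n -> \bar R) :
  0 < a -> measurable_fun setT h -> (forall x, 0 <= h x)%E ->
  ((a ^+ n)%:E * \int[mu n]_x h (b + a *: x)%R = \int[mu n]_x h x)%E.
Proof.
move=> a0 mh h0; have mf := measurable_affine a b.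
have [nu nuE] := pushforward_measure (mu n) mf.
have an0 : 0 <= a ^+ n by rewrite exprn_ge0// ltW.
have := ge0_integral_pushforward mf (mu n) measurableT mh (fun x _ => h0 x).
rewrite preimage_setT -nuE => <-.
rewrite -(ge0_integral_mscale nu measurableT (NngNum an0))//.
apply: eq_measure_integral => A mA _; rewrite /= /mscale /= nuE.
exact: lebesgue_rV_affine.
Qed.

Lemma rI_affine n (a : R) (b : 'rV[R]_n) (f : 'rV[R]_n -> R) : 0 < a ->
  (mu n).-integrable setT (EFin \o f) ->
  (mu n).-integrable setT (EFin \o (fun x => f (b + a *: x))).
Proof.
move=> a0 fI; have mf := rI_meas fI; have /integrableP[_ foo] := fI.
have mc : measurable_fun setT (fun x : 'rV[R]_n => f (b + a *: x)).
  by apply: (measurableT_comp mf); exact: measurable_affine.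
apply/integrableP; split; first exact/measurable_EFinP.
have h := @ge0_integral_affine n a b (fun x => `|f x|%:E) a0.
move: foo; rewrite /= -h; [|exact/measurable_EFinP/measurableT_comp|by move=> x; rewrite lee_fin].
rewrite -ge0_fin_numE ?mule_ge0 ?lee_fin ?exprn_ge0 ?(ltW a0)//; last first.
  by apply: integral_ge0 => x _; rewrite lee_fin.
rewrite -ge0_fin_numE; last by apply: integral_ge0 => x _; rewrite lee_fin.
have : (0 <= \int[mu n]_x `|f (b + a *: x)|%:E)%E.
  by apply: integral_ge0 => x _; rewrite lee_fin.
case: (\int[mu n]_x _)%E => [r||]//= _.
by rewrite gt0_muley ?lte_fin ?exprn_gt0.
Qed.

Lemma rint_affine n (a : R) (b : 'rV[R]_n) (f : 'rV[R]_n -> R) : 0 < a ->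
  (mu n).-integrable setT (EFin \o f) ->
  a ^+ n * \int[mu n]_x f (b + a *: x) = \int[mu n]_x f x.
Proof.
move=> a0 fI; have mf := measurable_int _ fI.
have gI := rI_affine b a0 fI.
apply: EFin_inj; rewrite EFinM -!rint_EFin//.
rewrite integralE [RHS]integralE muleBr//; last first.
  apply: fin_num_adde_defl; rewrite fin_numN; exact: (integral_fune_fin_num _ (integrable_funeneg _ gI)).
congr (_ - _)%E.
  rewrite -(@ge0_integral_affine n a b _ a0 (measurable_funepos mf))//.
  congr (_ * _)%E; apply: eq_integral => x _; by rewrite !funeposE.
rewrite -(@ge0_integral_affine n a b _ a0 (measurable_funeneg mf))//.
congr (_ * _)%E; apply: eq_integral => x _; by rewrite !funenegE.
Qed.

Lemma cint_affine n (a : R) (b : 'rV[R]_n) (f : 'rV[R]_n -> R[i]) : 0 < a ->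
  cI (mu n) f -> (a ^+ n)%:C * cint (mu n) (fun x => f (b + a *: x)) = cint (mu n) f.
Proof.
move=> a0 [f1 f2]; apply: complex_eqP; rewrite ?cReM ?cImM /= mul0r.
  by rewrite subr0 (rint_affine b a0 f1).
by rewrite addr0 (rint_affine b a0 f2).
Qed.

Lemma cI_affine n (a : R) (b : 'rV[R]_n) (f : 'rV[R]_n -> R[i]) : 0 < a ->
  cI (mu n) f -> cI (mu n) (fun x => f (b + a *: x)).
Proof.
by move=> a0 [f1 f2]; split; [exact: (rI_affine b a0 f1)|exact: (rI_affine b a0 f2)].
Qed.

End lebesgue_rV_theory.

(** * Density of boxes and approximate identities *)

Section boxes_total.
Context {R : realType} {n : nat}.
Local Notation V := 'rV[R]_n.
Local Notation mu := (@lebesgue_rV R n).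
Local Notation rI f := (mu.-integrable setT (EFin \o f)).

Lemma rI_indicM (f : V -> R) (A : set V) : measurable A -> rI f ->
  rI (fun x => f x * \1_A x).
Proof.
move=> mA fI; apply: rI_le _ _ (rI_norm fI).
  by apply: measurable_funM; [exact: rI_meas fI|exact: measurable_indic].
by move=> x; rewrite normrM ler_piMr// indicE; case: (_ \in _); rewrite ?normr1 ?normr0.
Qed.

Lemma rI_indic (A : set V) : measurable A -> (mu A < +oo)%E -> rI (\1_A : V -> R).
Proof.
move=> mA Aoo; apply: rI_ge0; first exact: measurable_indic.
  by move=> x; rewrite indicE ler0n.
by rewrite integral_indic// setIT.
Qed.

Lemma rint_indic (A : set V) : measurable A -> \int[mu]_x (\1_A x : R) = fine (mu A).
Proof. by move=> mA; rewrite /Rintegral integral_indic// setIT. Qed.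

(** Dynkin induction on the sets over which f integrates to 0. Stability under complement needs the
    integral over the whole space, which is 0 as a limit over growing cubes. *)
Lemma boxes_total_integrable (f : V -> R) : rI f ->
  (forall b, \int[mu]_x (f x * \1_(rbox b) x) = 0) -> {ae mu, forall x, f x = 0}.
Proof.
move=> fI f0.
have PE E : measurable E -> (\int[mu]_(x in E) (f x)%:E = 0)%E <->
    \int[mu]_x (f x * \1_E x) = 0.
  move=> mE; rewrite integral_mkcond.
  rewrite (_ : _ \_ E = fun x => (f x * \1_E x)%:E); last first.
    apply/funext => x; rewrite patchE indicE.
    by case: ifP => _; rewrite ?mulr1 ?mulr0.
  by rewrite rint_EFin; [split=> [[]|->]|exact: rI_indicM].
have fT0 : \int[mu]_x f x = 0.
  have [|k x|_ cv] := @rdct _ _ _ mu (fun N x => f x * \1_(rbox (cube n N)) x) f (fun x => `|f x|)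
    (fun k => rI_meas (rI_indicM (measurable_rbox _) fI)) (rI_meas fI) _ _ (rI_norm fI).
  - apply: aeW => x; apply: cvg_near_cst.
    have [N _ xN] : (\bigcup_N rbox (cube n N)) x by rewrite bigcup_cube.
    exists N => // k /= Nk; rewrite indicE mem_set ?mulr1//.
    by have /subsetPset := @nondecreasing_cube R n N k Nk; exact.
  - rewrite normrM ler_piMr// indicE.
    by case: (_ \in _); rewrite ?normr1 ?normr0.
  move: cv; rewrite (_ : (fun N => _) = fun=> 0); last by apply/funext => N; exact: f0.
  by move=> /(cvg_unique _ (cvg_cst _)) => /(_ _) <-.
have key E : measurable E -> \int[mu]_x (f x * \1_E x) = 0.
  rewrite [in X in X -> _]measurable_rVE; apply: (@dynkin_induction _ V _
     (fun E : set V => \int[mu]_x (f x * \1_E x) = 0) (measurable_rVE n) (@rbox_sets_setI R n)).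
  - by under eq_Rintegral do rewrite indicT mulr1.
  - by move=> _ [b _ <-]; exact: f0.
  - move=> S mS S0.
    rewrite (_ : (fun x => _) = (fun x => f x - f x * \1_S x)); last first.
      apply/funext => x; rewrite !indicE in_setC.
      by case: (x \in S); rewrite /= ?mulr1 ?mulr0 ?subrr ?subr0.
    by rewrite RintegralB//; [rewrite fT0 S0 subr0|exact: rI_indicM].
  - move=> F mF tF F0; apply/PE; first exact: bigcup_measurable.
    rewrite integral_bigcup//; last first.
      by apply: (integrableS measurableT) => //; exact: bigcup_measurable.
    by apply: eseries0 => k _ _; apply/PE.
have := @integral_ae_eq _ _ _ mu setT measurableT (fun=> 0%E) (EFin \o f) fI (measurable_cst _).
move=> /(_ _)[|N [mN N0 sN]].
  by move=> E _ mE; rewrite integral0; apply/PE => //; exact: key.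
exists N; split => // x /= fx; apply: sN => /= h; apply: fx.
by have [] := h I.
Qed.

Definition cind (A : set V) : V -> R[i] := fun x => (\1_A x)%:C.

Lemma cmeas_cind (A : set V) : measurable A -> cmeas (cind A).
Proof. by move=> mA; apply: cmeas_real; exact: measurable_indic. Qed.

Lemma normsq_cind (A : set V) x : normsq (cind A x) = \1_A x.
Proof. by rewrite /cind normsq_real indicE; case: (_ \in _); rewrite ?expr1n ?expr0n. Qed.

Lemma L2_cind (A : set V) : measurable A -> (mu A < +oo)%E -> L2 (cind A).
Proof.
move=> mA Aoo; apply/L2P; split; first exact: cmeas_cind.
rewrite (_ : (fun x => _) = \1_A); first exact: rI_indic.
by apply/funext => x; exact: normsq_cind.
Qed.

Lemma mulJ_cind (f : V -> R[i]) (A : set V) x : f x * ((cind A x)^*)%R = f x * cind A x.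
Proof. by rewrite /cind conjcR. Qed.

Lemma boxes_total (f : V -> R[i]) : L2 f ->
  (forall b, inner f (cind (rbox b)) = 0) -> {ae mu, forall x, f x = 0}.
Proof.
move=> fL f0.
(* f is only square integrable; cut to a cube it becomes integrable, and the intersection of two
   boxes is again a box. *)
have aeN N : {ae mu, forall x, f x * cind (rbox (cube n N)) x = 0}.
  have [f1 f2] : cI mu (fun x => f x * cind (rbox (cube n N)) x).
    have := L2_mulJ fL (L2_cind (measurable_rbox (cube n N)) (rbox_lty _)).
    by under [X in cI mu X]eq_fun do rewrite mulJ_cind.
  have E b x : f x * cind (rbox (cube n N)) x * (\1_(rbox b) x)%:C =
      f x * cind (rbox (cube n N) `&` rbox b) x.
    by rewrite /cind indicI -mulrA -rmorphM.
  have z b : cint mu (fun x => f x * cind (rbox (cube n N)) x * (\1_(rbox b) x)%:C) = 0.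
    have [c cE] := @rboxI R n (cube n N) b; rewrite -[RHS](f0 c) innerE.
    by congr (cint mu _); apply/funext => x; rewrite E -cE mulJ_cind.
  have := boxes_total_integrable f1; have := boxes_total_integrable f2.
  move=> /(_ _)h2 /(_ _)h1.
  have {}h1 : {ae mu, forall x, complex.Re (f x * cind (rbox (cube n N)) x) = 0}.
    apply: h1 => b; have := congr1 (@complex.Re R) (z b); rewrite /= => <-.
    by apply: eq_Rintegral => x _; rewrite [RHS]cReM /= mulr0 subr0.
  have {}h2 : {ae mu, forall x, complex.Im (f x * cind (rbox (cube n N)) x) = 0}.
    apply: h2 => b; have := congr1 (@complex.Im R) (z b); rewrite /= => <-.
    by apply: eq_Rintegral => x _; rewrite [RHS]cImM /= mulr0 add0r.
  by apply: filterS2 h1 h2 => x h1 h2; exact: complex_eqP.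
move/ae_foralln : aeN; apply: filterS => x xN.
have [N _ xb] : (\bigcup_N rbox (cube n N)) x by rewrite bigcup_cube.
by have := xN N; rewrite /cind indicE mem_set// mulr1.
Qed.

(** One box inside [U] is sliced along its first coordinate at p + (q - p)/(k + 1). The indicator
    functions of the slices form the infinite orthogonal family that Gram-Schmidt requires. *)
Lemma disjoint_boxes (U : set V) : (0 < n)%N -> box_open U -> U !=set0 ->
  exists b : nat -> 'rV[rat]_n * 'rV[rat]_n,
    [/\ forall k, rbox (b k) `<=` U, forall k, (0 < mu (rbox (b k)))%E &
     forall j k, j != k -> rbox (b j) `&` rbox (b k) = set0 :> set V].
Proof.
move=> n0 oU [x Ux]; have [[p q] [xb bU]] := rbox_sub oU Ux.
pose i0 := Ordinal n0.
have pq i : p ord0 i < q ord0 i.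
  by rewrite -(ltr_rat R); have /andP[] := xb i; exact: lt_trans.
pose r k : rat := p ord0 i0 + (q ord0 i0 - p ord0 i0) / k.+1%:R.
have pr k : p ord0 i0 < r k by rewrite ltrDl divr_gt0 ?subr_gt0.
have rr j k : (j <= k)%N -> r k <= r j.
  by move=> jk; rewrite lerD2l ler_pM2l ?subr_gt0// lef_pV2 ?posrE// ler_nat.
have rrS k : r k.+1 < r k.
  by rewrite ltrD2l ltr_pM2l ?subr_gt0// ltf_pV2 ?posrE// ltr_nat.
have r0 : r 0 = q ord0 i0 by rewrite /r divr1 addrC subrK.
pose b k : 'rV[rat]_n * 'rV[rat]_n :=
  (\row_i if i == i0 then r k.+1 else p ord0 i, \row_i if i == i0 then r k else q ord0 i).
exists b; split=> [k y yb|k|j k].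
- apply: bU => i; have := yb i; rewrite !mxE; case: eqP => [->|//] /andP[h1 h2].
  rewrite (lt_trans _ h1) ?ltr_rat//=; apply: (lt_le_trans h2).
  by rewrite ler_rat -r0 rr.
- have bb i : (b k).1 ord0 i < (b k).2 ord0 i.
    by rewrite !mxE; case: eqP => // _; exact: rrS.
  have bb' i : ratr ((b k).1 ord0 i) <= ratr ((b k).2 ord0 i) :> R by rewrite ler_rat ltW.
  have -> : mu (rbox (b k)) = _ := lebesgue_rV_boxoo bb'.
  by rewrite lte_fin prodr_gt0// => i _; rewrite subr_gt0 ltr_rat.
- wlog jk : j k / (j < k)%N => [wh|_].
    by case: (ltngtP j k) => // h _; [|rewrite setIC]; apply: wh; rewrite ?ltn_eqF// gt_eqF.
  apply/seteqP; split=> // y [/(_ i0) + /(_ i0)]; rewrite !mxE eqxx => /andP[h1 _] /andP[_ h2].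
  by have := lt_trans h1 h2; rewrite ltr_rat ltNge rr.
Qed.

End boxes_total.

Section L2_density.
Context {R : realType} {n : nat}.
Local Notation V := 'rV[R]_n.
Local Notation mu := (@lebesgue_rV R n).
Local Notation rI f := (mu.-integrable setT (EFin \o f)).
Local Notation ipn := (ip_norm (@inner R n)).
Hypothesis n_gt0 : (0 < n)%N.

Lemma inner_cind (A B : set V) : measurable A -> measurable B ->
  inner (cind A) (cind B) = (fine (mu (A `&` B)))%:C.
Proof.
move=> mA mB; rewrite innerE -rint_indic; last exact: measurableI.
rewrite -cint_real; congr (cint mu _); apply/funext => x.
by rewrite mulJ_cind /cind indicI -rmorphM.
Qed.

Let box_of i : V -> R[i] :=
  if @unpickle ('rV[rat]_n * 'rV[rat]_n)%type i is Some b then cind (rbox b) else 0.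

Lemma L2_boxes_basis : exists2 e, orthonormal_basis (@inner R n) (@L2 R n) e &
  forall K : set (V -> R[i]), K 0 -> (forall a f g, K f -> K g -> K (a *: f + g)) ->
  (forall b, K (cind (rbox b))) -> forall j, K (e j).
Proof.
have hb i : L2 (box_of i).
  rewrite /box_of; case: unpickle => [b|]; last exact: L2_0.
  by apply: L2_cind; [exact: measurable_rbox|exact: rbox_lty].
have btot f : L2 f -> (forall i, inner f (box_of i) = 0) -> complex.Re (inner f f) = 0.
  move=> fL f0; have f0' : {ae mu, forall x, f x = 0}.
    by apply: boxes_total => // b; rewrite -(f0 (pickle b)) /box_of pickleK.
  rewrite (inner_ae (f' := 0) (g' := 0) f0' f0')//; try exact: L2_0.
  by rewrite (ip0l hilbert_L2)//; exact: L2_0.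
have oT : box_open [set: V] by move=> x _; exists 1.
have [b [_ bpos bdisj]] := disjoint_boxes n_gt0 oT (ex_intro _ 0 I).
pose u k := pickle (b k).
have uE k : box_of (u k) = cind (rbox (b k)) by rewrite /box_of pickleK.
have dK (K : set (V -> R[i])) : K 0 -> (forall b, K (cind (rbox b))) -> forall i, K (box_of i).
  by move=> K0 Kb i; rewrite /box_of; case: unpickle.
move: box_of u hb btot uE dK => d u hb btot uE dK.
have uo i j : i != j -> inner (d (u i)) (d (u j)) = 0.
  move=> ij; rewrite !uE (inner_cind (measurable_rbox _) (measurable_rbox _)).
  by rewrite (bdisj _ _ ij) measure0.
have u0 i : 0 < complex.Re (inner (d (u i)) (d (u i))).
  rewrite !uE inner_cind ?setIid; try exact: measurable_rbox.
  by rewrite /= fine_gt0// bpos rbox_lty.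
exists (gs_basis (@inner R n) d).
  exact: (@gram_schmidt_basis R (V -> R[i]) (@inner R n) (@L2 R n) hilbert_L2 d hb btot u uo u0).
by move=> K K0 Kl Kb j; exact: (gs_span (@inner R n) K0 Kl (dK K K0 Kb)).
Qed.

Definition translate (w : V) (f : V -> R[i]) : V -> R[i] := fun x => f (w + x).

Lemma L2_translate w f : L2 f -> L2 (translate w f).
Proof.
move=> /L2P[mf f2]; apply/L2P; split.
  apply: (cmeas_comp (h := fun x => w + x) mf).
  have := @measurable_affine R n 1 w; congr measurable_fun.
  by apply/funext => x; rewrite scale1r.
have := rI_affine w ltr01 f2.
by under [X in EFin \o X]eq_fun do rewrite scale1r.
Qed.

Lemma rint_translate w (f : V -> R) : rI f -> \int[mu]_x f (w + x) = \int[mu]_x f x.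
Proof.
move=> fI; rewrite -(rint_affine w ltr01 fI) expr1n mul1r.
by under [in RHS]eq_Rintegral do rewrite scale1r.
Qed.

Lemma ipn_translate w f : L2 f -> ipn (translate w f) = ipn f.
Proof.
move=> fL; rewrite /ip_norm !inner_self; congr Num.sqrt.
exact: (rint_translate w (L2_normsq fL)).
Qed.

Definition L2_cont (f : V -> R[i]) := L2 f /\ forall w : nat -> V,
  (forall i, w k ord0 i @[k --> \oo] --> (0 : R)) ->
  ipn (translate (w k) f - f) @[k --> \oo] --> (0 : R).

Lemma L2_cont_lin a f g : L2_cont f -> L2_cont g -> L2_cont (a *: f + g).
Proof.
move=> [fL fc] [gL gc]; split; first exact: L2_lin.
move=> w w0; have hH := @hilbert_L2 R n.
have hf k : L2 (translate (w k) f - f) by apply: (hB hH) => //; exact: L2_translate.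
have hg k : L2 (translate (w k) g - g) by apply: (hB hH) => //; exact: L2_translate.
apply: (@cvg0_le _ _ _ _ _ (fun k => Normc.normc a * ipn (translate (w k) f - f) +
    ipn (translate (w k) g - g))).
  move=> k; rewrite ip_norm_ge0/=.
  have -> : translate (w k) (a *: f + g) - (a *: f + g) =
      a *: (translate (w k) f - f) + (translate (w k) g - g).
    by apply/funext => x; rewrite /translate !fctE; ring.
  rewrite -(ip_normZ hH)//; apply: (ip_normD hH) => //; exact: (hZ hH).
rewrite -[X in _ --> X]addr0 -[X in _ --> X + _](mulr0 (Normc.normc a)).
by apply: cvgD; [apply: cvgMr; exact: fc|exact: gc].
Qed.

Lemma L2_cont_closed (f_ : nat -> V -> R[i]) f : (forall k, L2_cont (f_ k)) -> L2 f ->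
  ipn (f - f_ k) @[k --> \oo] --> (0 : R) -> L2_cont f.
Proof.
move=> fc fL ff; split; first exact: fL.
move=> w w0; have hH := @hilbert_L2 R n.
apply/cvgrPdist_le => /= e e0.
have e4 : 0 < e / 4 by rewrite divr_gt0.
have [K _ /(_ K (leqnn K)) fK] : \forall k \near \oo, ipn (f - f_ k) <= e / 4.
  move/cvgrPdist_le : ff => /(_ _ e4); apply: filterS => k.
  by rewrite sub0r normrN ger0_norm ?ip_norm_ge0.
have [fKL /(_ w w0)/cvgrPdist_le/(_ _ e4)] := fc K.
apply: filterS => k; rewrite !sub0r !normrN !ger0_norm ?ip_norm_ge0// => h.
have h1 : L2 (translate (w k) f) by exact: L2_translate.
have h2 : L2 (translate (w k) (f_ K)) by exact: L2_translate.
apply: (le_trans (ip_normB_trans hH h1 h2 fL)).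
have -> : translate (w k) f - translate (w k) (f_ K) = translate (w k) (f - f_ K) by [].
rewrite ipn_translate; last exact: (hB hH).
have := ip_normB_trans hH h2 fKL fL; rewrite (ip_norm_distC hH fKL fL); lra.
Qed.

Lemma sqr_ipn_cvg0 T (F : set_system T) (FF : Filter F) (f : T -> V -> R[i]) :
  (forall k, L2 (f k)) -> \int[mu]_x normsq (f k x) @[k --> F] --> (0 : R) ->
  ipn (f k) @[k --> F] --> (0 : R).
Proof.
move=> fL cv; rewrite -sqrtr0.
rewrite (_ : (fun k => ipn (f k)) = (fun k => Num.sqrt (\int[mu]_x normsq (f k x)))).
  by apply: continuous_cvg => //; exact: sqrt_continuous.
by apply/funext => k; rewrite -sqr_ipn// sqrtr_sqr ger0_norm ?ip_norm_ge0.
Qed.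

Lemma ae_coord_neq (i : 'I_n) (a : R) : {ae mu, forall x : V, x ord0 i != a}.
Proof.
exists [set x : V | x ord0 i = a]; split; last by move=> x /negP; rewrite negbK => /eqP.
  have := @measurable_coord R n i measurableT [set a] (measurable_set1 _).
  by rewrite setTI.
exact: lebesgue_rV_hyperplane.
Qed.

Lemma L2_cont_box b : L2_cont (cind (rbox b)).
Proof.
have bL : L2 (cind (rbox b) : V -> R[i]).
  by apply: L2_cind; [exact: measurable_rbox|exact: rbox_lty].
split => // w w0; have hH := @hilbert_L2 R n.
(* Shifts by less than 1 keep all translates inside one larger cube, which provides the dominating
   function; [w] agrees with [w'] from some index on. *)
pose w' k := if [forall i, `|w k ord0 i| < 1] then w k else 0.
have w'1 k i : `|w' k ord0 i| < 1.
  by rewrite /w'; case: ifPn => [/forallP//|_]; rewrite mxE normr0.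
have ww' : \forall k \near \oo, w k = w' k.
  have : \forall k \near \oo, forall i, `|w k ord0 i| < 1.
    apply: filter_forall => i; have /cvgr0_norm_lt := w0 i.
    exact.
  by apply: filterS => k h; rewrite /w'; case: forallP.
have w'0 i : w' k ord0 i @[k --> \oo] --> (0 : R).
  by apply: cvg_trans (w0 i); apply: near_eq_cvg; apply: filterS ww' => k ->.
have LT k : L2 (translate (w' k) (cind (rbox b)) - cind (rbox b)).
  by apply: (hB hH) => //; exact: L2_translate.
suff : ipn (translate (w' k) (cind (rbox b)) - cind (rbox b)) @[k --> \oo] --> (0 : R).
  by apply: cvg_trans; apply: near_eq_cvg; apply: filterS ww' => k ->.
apply: sqr_ipn_cvg0 => //.
have [N0 bN] : exists N : nat, forall x : V, rbox b x -> forall i, `|x ord0 i| < N%:R.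
  pose m i := Num.max `|ratr (b.1 ord0 i) : R| `|ratr (b.2 ord0 i) : R|.
  exists (\max_(i < n) (Num.truncn (m i)).+1)%N => x xb i.
  have : m i < (\max_(i < n) (Num.truncn (m i)).+1)%:R.
    apply: (lt_le_trans (truncnS_gt _)); rewrite ler_nat.
    exact: (leq_bigmax i).
  apply: le_lt_trans; rewrite /m le_max; have /andP[h1 h2] := xb i.
  case: (leP 0 (x ord0 i)) => h; apply/orP; [right|left].
    by rewrite ger0_norm// (le_trans (ltW h2))// ler_norm.
  by rewrite (ltr0_norm h) ler_normr; apply/orP; right; rewrite lerN2 ltW.
have [|k x|_] := @rdct _ _ _ mu
    (fun k x => normsq ((translate (w' k) (cind (rbox b)) - cind (rbox b)) x))
    (fun=> 0) (\1_(rbox (cube n N0.+1))) (fun k => rI_meas (L2_normsq (LT k)))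
    (measurable_cst _) _ _ (rI_indic (measurable_rbox _) (rbox_lty _)).
(* Off the finitely many hyperplanes that carry the faces of the box, small shifts do not change
   membership. *)
- pose bd (x : V) := forall i : 'I_n,
      x ord0 i != ratr (b.1 ord0 i) :> R /\ x ord0 i != ratr (b.2 ord0 i) :> R.
  have bdP : {ae mu, forall x, bd x}.
    by apply: filter_forall => i; apply: filterI; exact: ae_coord_neq.
  apply: filterS bdP => x xb; apply: cvg_near_cst.
  have xi i : w' k ord0 i + x ord0 i @[k --> \oo] --> x ord0 i.
    by rewrite -[X in _ --> X]add0r; apply: cvgD => //; exact: cvg_cst.
  have : \forall k \near \oo, forall i,
     (ratr (b.1 ord0 i) < w' k ord0 i + x ord0 i < ratr (b.2 ord0 i)) =
     (ratr (b.1 ord0 i) < x ord0 i < ratr (b.2 ord0 i)).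
    apply: filter_forall => i; have [x1 x2] := xb i.
    have h1 : \forall k \near \oo, (ratr (b.1 ord0 i) < w' k ord0 i + x ord0 i) = (ratr (b.1 ord0 i) < x ord0 i).
      move: x1; rewrite neq_lt => /orP[] x1.
        have : \forall k \near \oo, w' k ord0 i + x ord0 i < ratr (b.1 ord0 i) by exact: (cvgr_lt _ (xi i)).
        apply: filterS => k h.
        by rewrite !ltNge (ltW h) (ltW x1).
      have : \forall k \near \oo, w' k ord0 i + x ord0 i > ratr (b.1 ord0 i) by exact: (cvgr_gt _ (xi i)).
        apply: filterS => k h.
      by rewrite h x1.
    have h2 : \forall k \near \oo, (w' k ord0 i + x ord0 i < ratr (b.2 ord0 i)) = (x ord0 i < ratr (b.2 ord0 i)).
      move: x2; rewrite neq_lt => /orP[] x2.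
        have : \forall k \near \oo, w' k ord0 i + x ord0 i < ratr (b.2 ord0 i) by exact: (cvgr_lt _ (xi i)).
        apply: filterS => k h.
        by rewrite h x2.
      have : \forall k \near \oo, w' k ord0 i + x ord0 i > ratr (b.2 ord0 i) by exact: (cvgr_gt _ (xi i)).
        apply: filterS => k h.
      by rewrite !ltNge (ltW h) (ltW x2).
    by apply: filterS2 h1 h2 => k -> ->.
  apply: filterS => k h; rewrite !fctE /translate /cind.
  rewrite (_ : \1_(rbox b) (w' k + x) = \1_(rbox b) x) ?subrr ?normsq0//.
  rewrite !indicE; congr (_%:R); congr nat_of_bool.
  by apply/idP/idP; rewrite !inE => g i; have := g i; rewrite !mxE ?h// -h.
- rewrite ger0_norm ?normsq_ge0// !fctE /translate.
  have [xc|xc] := pselect (rbox (cube n N0.+1) x).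
    rewrite [leRHS]indicE mem_set//= /cind !indicE.
    by case: (_ \in _); case: (_ \in _); rewrite /normsq /=; lra.
  rewrite /cind !indicE !memNset ?subrr ?normsq0//.
    by move=> xb; apply: xc; apply/cubeE => i; apply: (lt_trans (bN _ xb i)); rewrite ltr_nat.
  move=> xb; apply: xc; apply/cubeE => i; have := bN _ xb i; have := w'1 k i.
  rewrite mxE -natr1 => h1 h2; have := ler_normB (w' k ord0 i + x ord0 i) (w' k ord0 i).
  rewrite addrAC subrr add0r; lra.
- by rewrite /Rintegral integral0.
Qed.

(** The property is linear, stable under L2 limits because translations are isometries, and true for
    boxes; f is expanded in a basis made from boxes. *)
Lemma L2_contP f : L2 f -> L2_cont f.
Proof.
move=> fL; have hH := @hilbert_L2 R n; have [e [eH eE ecv] eK] := L2_boxes_basis.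
have K0 : L2_cont 0.
  split; first exact: L2_0.
  move=> w _; rewrite (_ : (fun k => _) = fun=> 0); first exact: cvg_cst.
  apply/funext => k; rewrite (_ : _ - _ = 0); last by apply/funext => x; rewrite /translate !fctE subrr.
  by rewrite /ip_norm (ip0l hH) ?sqrtr0//; exact: L2_0.
have ec := eK L2_cont K0 L2_cont_lin L2_cont_box.
apply: (@L2_cont_closed (fun N => \sum_(j < N) inner f (e j) *: e j) f _ fL (ecv f fL)).
elim=> [|N IH]; first by rewrite big_ord0.
by rewrite big_ord_recr/= addrC; exact: L2_cont_lin.
Qed.

Lemma measurable_shear (a : R) : measurable_fun setT (fun z : V * V => a *: z.1 + z.2).
Proof.
apply: measurable_fun_rV => i.
rewrite (_ : (fun x => _) = (fun z : V * V => a * z.1 ord0 i + z.2 ord0 i)); last first.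
  by apply/funext => z; rewrite !mxE.
apply: measurable_funD; last exact: measurableT_comp (measurable_coord i) measurable_snd.
by apply: measurable_funM => //; exact: measurableT_comp (measurable_coord i) measurable_fst.
Qed.

Lemma rI_shear (a : R) (Phi h : V -> R) : rI Phi -> rI h -> (forall z, 0 <= Phi z) ->
  (forall x, 0 <= h x) ->
  (mu \x mu)%E.-integrable setT (EFin \o (fun z : V * V => Phi z.1 * h (a *: z.1 + z.2))).
Proof.
move=> PI hI P0 h0.
have mF : measurable_fun setT (fun z : V * V => Phi z.1 * h (a *: z.1 + z.2)).
  apply: measurable_funM; first exact: measurableT_comp (rI_meas PI) measurable_fst.
  exact: measurableT_comp (rI_meas hI) (measurable_shear a).
apply: rI_ge0 => //; first by move=> z; rewrite mulr_ge0.
rewrite fubini_tonelli1//; last 2 first.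
- exact/measurable_EFinP.
- by move=> z; rewrite lee_fin mulr_ge0.
rewrite /fubini_F /=.
rewrite (eq_integral (fun z => (Phi z * \int[mu]_x h x)%:E)); last first.
  move=> z _; rewrite -(rint_translate (a *: z) hI) -RintegralZl//; last first.
    have := rI_affine (a *: z) ltr01 hI.
    by under [X in EFin \o X]eq_fun do rewrite scale1r.
  rewrite rint_EFin//; apply: rIZ; have := rI_affine (a *: z) ltr01 hI.
  by under [X in EFin \o X]eq_fun do rewrite scale1r.
apply: rI_ge0_lty; under eq_fun do rewrite mulrC; exact: rIZ.
Qed.

Lemma cI_shear (a : R) (Phi : V -> R) g : rI Phi -> (forall z, 0 <= Phi z) -> L2 g ->
  cI (mu \x mu)%E (fun z : V * V => (Phi z.1)%:C * (g (a *: z.1 + z.2) * ((g z.2)^*)%R)).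
Proof.
move=> PI P0 gL; have gm := L2_meas gL.
apply: (cI_le (g := fun z => Phi z.1 * normsq (g (a *: z.1 + z.2)) + Phi z.1 * normsq (g z.2))).
- apply: cmeasM.
    by apply: cmeas_real; exact: measurableT_comp (rI_meas PI) measurable_fst.
  apply: cmeasM; first exact: (cmeas_comp gm (measurable_shear a)).
  by apply: cmeasJ; exact: (cmeas_comp gm measurable_snd).
- move=> z; rewrite Normc.normcM normc_real ger0_norm// -mulrDr ler_wpM2l//.
  by apply: (le_trans (normcM_le _ _)); rewrite normsqJ.
- apply: rID.
    exact: (rI_shear a PI (L2_normsq gL) P0 (fun x => normsq_ge0 _)).
  exact: (rI_prod PI (L2_normsq gL)).
Qed.

Lemma inner_translate w g : inner (translate w g) g =
  cint mu (fun x => g (w + x) * ((g x)^*)%R).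
Proof. by rewrite innerE. Qed.

Lemma cint_shear (a : R) (Phi : V -> R) g : rI Phi -> (forall z, 0 <= Phi z) -> L2 g ->
  cint mu (fun x => cint mu (fun z => (Phi z)%:C * (g (a *: z + x) * ((g x)^*)%R))) =
  cint mu (fun z => (Phi z)%:C * inner (translate (a *: z) g) g).
Proof.
move=> PI P0 gL; rewrite -(cfubini (cI_shear a PI P0 gL)) /=.
congr (cint mu _); apply/funext => z; rewrite inner_translate -cintZ//.
by have := L2_mulJ (L2_translate (a *: z) gL) gL.
Qed.

(** Dominated convergence: the integrand is bounded by |g|^2 Phi and tends to <g, g> Phi(z) by
    continuity of translations. It serves twice, with the Poisson kernel for Plancherel and with
    [berezin_kernel] for the Toeplitz operators. *)
Lemma approximate_identity (a : nat -> R) (Phi : V -> R) g : rI Phi -> (forall z, 0 <= Phi z) ->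
  L2 g -> a k @[k --> \oo] --> (0 : R) ->
  Normc.normc (cint mu (fun z => (Phi z)%:C * inner (translate (a k *: z) g) g) -
     (\int[mu]_z Phi z)%:C * inner g g) @[k --> \oo] --> (0 : R).
Proof.
move=> PI P0 gL a0; have hH := @hilbert_L2 R n.
rewrite [_ * inner g g]mulrC -cint_real -cintZ; last exact: cI_real.
have [|||||] := @cdct _ _ _ mu
   (fun k z => (Phi z)%:C * inner (translate (a k *: z) g) g)
   (fun z => inner g g * (Phi z)%:C) (fun z => ipn g ^+ 2 * Phi z).
- move=> k; have := cfubini_meas1 (cI_shear (a k) PI P0 gL).
  congr cmeas; apply/funext => z; rewrite inner_translate -cintZ//.
  by have := L2_mulJ (L2_translate (a k *: z) gL) gL.
- by apply: cmeasM; [exact: cmeas_cst|exact: cmeas_real (rI_meas PI)].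
- apply: aeW => z; have tL k := L2_translate (a k *: z) gL.
  apply: (@cvg0_le _ _ _ _ _ (fun k => Phi z * ipn g * ipn (translate (a k *: z) g - g))).
    move=> k; rewrite normc_ge0 andTb [inner g g * _]mulrC -mulrBr -(ipBl hH (tL k) gL gL).
    rewrite Normc.normcM normc_real ger0_norm// -mulrA ler_wpM2l// mulrC.
    by apply: (cauchy_schwarz hH) => //; exact: (hB hH).
  rewrite -[X in _ --> X](mulr0 (Phi z * ipn g)); apply: cvgMr.
  have [_] := L2_contP gL; apply => i.
  rewrite (_ : (fun k => _) = (fun k => a k * z ord0 i)); last by apply/funext => k; rewrite !mxE.
  by rewrite -[X in _ --> X](mul0r (z ord0 i)); apply: cvgMl.
- move=> k z; rewrite Normc.normcM normc_real ger0_norm// mulrC ler_wpM2r// expr2.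
  have tL := L2_translate (a k *: z) gL.
  by rewrite -[X in X * _](ipn_translate (a k *: z) gL); exact: (cauchy_schwarz hH).
- exact: rIZ.
by [].
Qed.

End L2_density.

(** * The Poisson kernel *)

Section poisson1.
Context {R : realType}.
Local Notation leb := (@lebesgue_measure R).
Local Notation rI f := (leb.-integrable setT (EFin \o f)).

Lemma ge0_integral_fold (h : R -> R) : (forall t, 0 <= h t) -> continuous h ->
  (\int[leb]_t (h t)%:E = \int[leb]_(t in `[0%R, +oo[) (h t)%:E +
     \int[leb]_(t in `[0%R, +oo[) (h (- t)%R)%:E)%E.
Proof.
move=> h0 ch; have mh : measurable_fun setT h by exact: continuous_measurable_fun.
have mposnums : measurable [set x : R | 0 <= x] by rewrite -set_itvcy.
rewrite -(setUv [set x : R | 0 <= x]%R) ge0_integral_setU//= ; last 4 first.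
- exact: measurableC.
- by apply/measurable_EFinP; rewrite setUv.
- by move=> x _; rewrite lee_fin.
- exact/disj_setPCl.
rewrite -set_itvcy// setCitvr; congr (_ + _)%E.
rewrite integral_itv_bndo_bndc; last exact/measurable_EFinP/measurable_funTS.
by rewrite -{1}oppr0 ge0_integration_by_substitutionNy//; exact: continuous_subspaceT.
Qed.

Lemma continuous_expR_norm : continuous (fun t : R => expR (- `|t|)).
Proof.
move=> t; apply: continuous_comp; last exact: continuous_expR.
by apply: cvgN; exact: norm_continuous.
Qed.

Lemma continuous_sin_mul (z : R) : continuous (fun t : R => sin (t * z)).
Proof.
move=> t; apply: (@continuous_comp _ _ _ (fun t : R => t * z) sin); last exact: continuous_sin.
by apply: cvgMl; exact: cvg_id.
Qed.

Lemma continuous_cos_mul (z : R) : continuous (fun t : R => cos (t * z)).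
Proof.
move=> t; apply: (@continuous_comp _ _ _ (fun t : R => t * z) cos); last exact: continuous_cos.
by apply: cvgMl; exact: cvg_id.
Qed.

(** The 1 added to the cosine keeps the integrand nonnegative, as required by the fundamental
    theorem of calculus on a half line; its contribution is subtracted again in [rint_exp_cos]. *)
Lemma integral_exp_cos_half (z : R) :
  (\int[leb]_(t in `[0%R, +oo[) (expR (- `|t|) * (1 + cos (t * z)))%:E =
   (1 + (1 + z ^+ 2)^-1)%:E)%E.
Proof.
have z1 : 1 + z ^+ 2 != 0 by rewrite gt_eqF// ltr_pwDl// sqr_ge0.
pose F t := - expR (- t) + expR (- t) * (z * sin (t * z) - cos (t * z)) / (1 + z ^+ 2).
pose f t := expR (- t) * (1 + cos (t * z)).
have dF (t : R) : is_derive t 1 F (f t).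
  rewrite /F /f; apply: is_derive_eq.
  rewrite /GRing.scale /=.
  by field.
have cf : continuous f.
  move=> t; apply: cvgM.
    by apply: continuous_comp; [apply: cvgN; exact: cvg_id|exact: continuous_expR].
  by apply: cvgD; [exact: cvg_cst|exact: continuous_cos_mul].
transitivity (\int[leb]_(t in `[0%R, +oo[) (f t)%:E)%E.
  by apply: eq_integral => t; rewrite inE/= in_itv/= andbT => t0; rewrite /f ger0_norm.
rewrite (@ge0_continuous_FTC2y _ _ F 0 0).
- rewrite -EFinB /F !oppr0 expR0 mul0r sin0 cos0 mulr0 sub0r.
  by congr EFin; field.
- move=> t _; rewrite /f mulr_ge0 ?expR_ge0//; have := cos_geN1 (t * z); lra.
- exact: continuous_subspaceT.
- have -> : F = fun t => expR (- t) * (-1 + (z * sin (t * z) - cos (t * z)) / (1 + z ^+ 2)).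
    by apply/funext => t; rewrite /F; ring.
  apply/cvgr0Pnorm_le => /= e e0; pose B := `|z| + 2.
  have B0 : 0 < B by rewrite ltr_wpDl.
  have /cvgr0Pnorm_le/(_ (e / B)) := @cvgr_expR R; rewrite divr_gt0// => /(_ isT).
  apply: filterS => t; rewrite ger0_norm ?expR_ge0// => h.
  rewrite normrM ger0_norm ?expR_ge0// -[leRHS](divfK (lt0r_neq0 B0)).
  apply: ler_pM; rewrite ?expR_ge0//.
  apply: (le_trans (ler_normD _ _)); rewrite normrN1 normrM /B.
  have h1 : `|z * sin (t * z) - cos (t * z)| <= `|z| + 1.
    apply: (le_trans (ler_normB _ _)); rewrite normrM lerD ?cos_max ?ler_piMr ?sin_max//.
  have h2 : `|(1 + z ^+ 2)^-1| <= 1.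
    by rewrite ger0_norm ?invr_ge0 ?addr_ge0 ?sqr_ge0// invf_le1 ?lerDl ?sqr_ge0// ltr_pwDl// sqr_ge0.
  have : `|z * sin (t * z) - cos (t * z)| * `|(1 + z ^+ 2)^-1| <= `|z| + 1.
    by apply: (le_trans _ h1); rewrite ler_piMr.
  lra.
- by move=> t _; apply: ex_derive.
- by apply: cvg_at_right_filter; apply: differentiable_continuous; apply/derivable1_diffP; apply: ex_derive.
- by move=> t _; rewrite derive1E; exact: derive_val.
Qed.

Lemma rint_exp_cos1 (z : R) : let h t := expR (- `|t|) * (1 + cos (t * z)) in
  rI h /\ \int[leb]_t h t = 2 * (1 + (1 + z ^+ 2)^-1).
Proof.
move=> h.
have h0 t : 0 <= h t by rewrite /h mulr_ge0 ?expR_ge0//; have := cos_geN1 (t * z); lra.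
have ch : continuous h.
  move=> t; apply: cvgM; first exact: continuous_expR_norm.
  by apply: cvgD; [exact: cvg_cst|exact: continuous_cos_mul].
have hE : (\int[leb]_t (h t)%:E = (2 * (1 + (1 + z ^+ 2)^-1))%:E)%E.
  rewrite ge0_integral_fold// /h (integral_exp_cos_half z).
  under eq_integral => t _ do rewrite normrN mulNr cosN.
  by rewrite integral_exp_cos_half -EFinD; congr EFin; ring.
split; last by rewrite /Rintegral hE.
by apply: rI_ge0 => //; [exact: continuous_measurable_fun|rewrite hE ltry].
Qed.

Lemma rI_exp_norm : rI (fun t : R => expR (- `|t|)).
Proof.
have [hI _] := rint_exp_cos1 0.
rewrite (_ : (fun t : R => _) = (fun t => 2^-1 * (expR (- `|t|) * (1 + cos (t * 0))))).
  exact: rIZ.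
by apply/funext => t; rewrite mulr0 cos0; field.
Qed.

Lemma rint_exp_norm : \int[leb]_t expR (- `|t|) = 2.
Proof.
have [hI hE] := rint_exp_cos1 0.
rewrite (_ : (fun t : R => _) = (fun t => 2^-1 * (expR (- `|t|) * (1 + cos (t * 0))))).
  by rewrite RintegralZl// hE expr0n/= addr0 invr1; field.
by apply/funext => t; rewrite mulr0 cos0; field.
Qed.

Lemma rI_exp_cos (z : R) : rI (fun t => expR (- `|t|) * cos (t * z)).
Proof.
have [hI _] := rint_exp_cos1 z.
rewrite (_ : (fun t : R => _) = (fun t => expR (- `|t|) * (1 + cos (t * z)) - expR (- `|t|))).
  by apply: rIB => //; exact: rI_exp_norm.
by apply/funext => t; ring.
Qed.

Lemma rint_exp_cos (z : R) : \int[leb]_t (expR (- `|t|) * cos (t * z)) = 2 / (1 + z ^+ 2).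
Proof.
have [hI hE] := rint_exp_cos1 z.
rewrite (_ : (fun t : R => _) = (fun t => expR (- `|t|) * (1 + cos (t * z)) - expR (- `|t|))).
  rewrite RintegralB//; last exact: rI_exp_norm.
  by rewrite hE rint_exp_norm; ring.
by apply/funext => t; ring.
Qed.

Lemma rI_exp_sin (z : R) : rI (fun t => expR (- `|t|) * sin (t * z)).
Proof.
apply: rI_le _ _ rI_exp_norm.
  apply: continuous_measurable_fun => t; apply: cvgM; first exact: continuous_expR_norm.
  exact: continuous_sin_mul.
by move=> t; rewrite normrM ger0_norm ?expR_ge0// ler_piMr ?expR_ge0// sin_max.
Qed.

(** Oddness of the sine, carried out with the nonnegative functions exp(-|t|) (1 + b sin(t z)) for b
    = 1 and b = -1, which reflection exchanges. *)
Lemma rint_exp_sin (z : R) : \int[leb]_t (expR (- `|t|) * sin (t * z)) = 0.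
Proof.
pose S (b : R) t := expR (- `|t|) * (1 + b * sin (t * z)).
have sE b t : S b t = expR (- `|t|) + b * (expR (- `|t|) * sin (t * z)) by rewrite /S; ring.
have sI b : rI (S b).
  rewrite (_ : S b = fun t => expR (- `|t|) + b * (expR (- `|t|) * sin (t * z))).
    by apply: rID; [exact: rI_exp_norm|apply: rIZ; exact: rI_exp_sin].
  by apply/funext => t; exact: sE.
have cS b : continuous (S b).
  move=> t; apply: cvgM; first exact: continuous_expR_norm.
  by apply: cvgD; [exact: cvg_cst|apply: cvgMr; exact: continuous_sin_mul].
have S0 b t : `|b| <= 1 -> 0 <= S b t.
  move=> b1; rewrite mulr_ge0 ?expR_ge0//.
  have : `|b * sin (t * z)| <= 1 by rewrite normrM mulr_ile1// sin_max.
  by rewrite ler_norml; lra.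
have SN b t : S b (- t) = S (- b) t by rewrite /S normrN mulNr sinN; ring.
have E : (\int[leb]_t (S 1 t)%:E = \int[leb]_t (S (-1)%R t)%:E)%E.
  rewrite !ge0_integral_fold//; try by move=> t; apply: S0; rewrite ?normrN1 ?normr1.
  rewrite addeC; congr (_ + _)%E; apply: eq_integral => t _; first by rewrite SN.
  by rewrite SN opprK.
have {E} : \int[leb]_t S 1 t = \int[leb]_t S (-1) t by rewrite /Rintegral E.
have SI b : \int[leb]_t S b t = 2 + b * \int[leb]_t (expR (- `|t|) * sin (t * z)).
  under eq_Rintegral do rewrite sE.
  rewrite RintegralD//; [|exact: rI_exp_norm|by apply: rIZ; exact: rI_exp_sin].
  by rewrite rint_exp_norm RintegralZl//; exact: rI_exp_sin.
by rewrite !SI; lra.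
Qed.

(** The mass 2 pi of the one-dimensional Poisson kernel is where the factor (2 pi)^n of Plancherel
    comes from. *)
Lemma rI_oneDsqrV : rI (fun t : R => 2 / (1 + t ^+ 2)) /\
  \int[leb]_t (2 / (1 + t ^+ 2)) = 2 * pi.
Proof.
pose o (t : R) := (oneDsqr t)^-1.
have o0 t : 0 <= o t by rewrite /o invr_ge0 addr_ge0 ?sqr_ge0.
have co : continuous o by exact: continuous_oneDsqrV.
have E : (\int[leb]_t (o t)%:E = (pi : R)%:E)%E.
  rewrite ge0_integral_fold//.
  have oN t : o (- t) = o t by rewrite /o /oneDsqr sqrrN.
  under [X in (_ + X)%E]eq_integral => t _ do rewrite oN.
  by rewrite (integral0y_oneDsqr R) -EFinD; congr EFin; field.
have I : rI o.
  by apply: rI_ge0; [exact: continuous_measurable_fun|exact: o0|rewrite E ltry].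
split; first exact: rIZ.
transitivity (2 * \int[leb]_t o t); first by rewrite -RintegralZl.
by rewrite /Rintegral E.
Qed.

Lemma cI_poisson (z : R) : cI leb (fun t => (expR (- `|t|))%:C * expi (t * z)).
Proof.
split.
  rewrite (_ : (fun t => _) = (fun t => expR (- `|t|) * cos (t * z))); first exact: rI_exp_cos.
  by apply/funext => t; rewrite cReM /= mul0r subr0.
rewrite (_ : (fun t => _) = (fun t => expR (- `|t|) * sin (t * z))); first exact: rI_exp_sin.
by apply/funext => t; rewrite cImM /= mul0r addr0.
Qed.

Lemma cint_poisson (z : R) :
  cint leb (fun t => (expR (- `|t|))%:C * expi (t * z)) = (2 / (1 + z ^+ 2))%:C.
Proof.
apply: complex_eqP => /=.
  by rewrite -rint_exp_cos; apply: eq_Rintegral => t _; rewrite /= mul0r subr0.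
by apply: etrans (rint_exp_sin z); apply: eq_Rintegral => t _; rewrite mul0r addr0.
Qed.

End poisson1.

(** * Integrals of product functions over R^n *)

Section product_integrals.
Context {R : realType}.
Local Notation leb := (@lebesgue_measure R).
Local Notation mu n := (@lebesgue_rV R n).

Lemma ge0_integral_cons_rV n (h : 'rV[R]_n.+1 -> \bar R) : measurable_fun setT h ->
  (forall x, 0 <= h x)%E ->
  (\int[mu n.+1]_x h x = \int[(leb \x mu n)%E]_z h (cons_rV z))%E.
Proof.
move=> mh h0.
have mc : measurable_fun setT (@cons_rV R n : (measurableTypeR R * 'rV[R]_n)%type -> _).
  exact: measurable_cons_rV.
have [nu nuE] := pushforward_measure (leb \x mu n)%E mc.
have := ge0_integral_pushforward mc (leb \x mu n)%E measurableT mh (fun x _ => h0 x).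
rewrite preimage_setT -nuE => <-.
by apply: eq_measure_integral => A mA _; rewrite nuE.
Qed.

Lemma rint_cons_rV n (f : 'rV[R]_n.+1 -> R) : measurable_fun setT f ->
  (leb \x mu n)%E.-integrable setT (EFin \o (fun z => f (cons_rV z))) ->
  (mu n.+1).-integrable setT (EFin \o f) /\
  \int[mu n.+1]_x f x = \int[(leb \x mu n)%E]_z f (cons_rV z).
Proof.
move=> mf fI.
have mfe : measurable_fun setT (EFin \o f) by exact/measurable_EFinP.
have I : (mu n.+1).-integrable setT (EFin \o f).
  apply/integrableP; split=> //; have /integrableP[_] := fI.
  by rewrite ge0_integral_cons_rV//; exact: measurableT_comp.
split => //; apply: EFin_inj; rewrite -!rint_EFin// integralE [RHS]integralE.
congr (_ - _)%E.
  rewrite (ge0_integral_cons_rV (measurable_funepos mfe))//.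
  by apply: eq_integral => z _; rewrite !funeposE.
rewrite (ge0_integral_cons_rV (measurable_funeneg mfe))//.
by apply: eq_integral => z _; rewrite !funenegE.
Qed.

Lemma cint_cons_rV n (f : 'rV[R]_n.+1 -> R[i]) : cmeas f ->
  cI (leb \x mu n)%E (fun z => f (cons_rV z)) ->
  cI (mu n.+1) f /\ cint (mu n.+1) f = cint (leb \x mu n)%E (fun z => f (cons_rV z)).
Proof.
move=> [m1 m2] [I1 I2]; have [J1 E1] := rint_cons_rV m1 I1.
have [J2 E2] := rint_cons_rV m2 I2.
by split; [split|rewrite /cint E1 E2].
Qed.

Lemma cmeas_prod d (T : measurableType d) n (F : 'I_n -> T -> R[i]) :
  (forall i, cmeas (F i)) -> cmeas (fun x => \prod_(i < n) F i x).
Proof.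
elim: n F => [|n IHn] F mF.
  by under eq_fun do rewrite big_ord0; exact: cmeas_cst.
by under eq_fun do rewrite big_ord_recl; apply: cmeasM => //; exact: IHn.
Qed.

Lemma cint_prod_rV n (f : 'I_n -> R -> R[i]) : (forall i, cI leb (f i)) ->
  cI (mu n) (fun x => \prod_(i < n) f i (x ord0 i)) /\
  cint (mu n) (fun x => \prod_(i < n) f i (x ord0 i)) = \prod_(i < n) cint leb (f i).
Proof.
elim: n f => [|n IHn] f fI.
  have -> : (fun x : 'rV[R]_0 => \prod_(i < 0) f i (x ord0 i)) = fun=> (1 : R)%:C.
    by apply/funext => x; rewrite big_ord0.
  have I1 : (mu 0).-integrable setT (EFin \o (fun=> 1 : R)).
    apply: rI_ge0 => //; rewrite integral_cst// mul1e /= diracE; case: (_ \in _); exact: ltry.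
  split; first exact: cI_real.
  have m1 : mu 0 [set: 'rV[R]_0] = 1%E by rewrite /= diracE mem_set.
  rewrite cint_real big_ord0 /Rintegral integral_cst// mul1e.
  exact: (congr1 (fun x => (fine x)%:C) m1).
have [gI gE] := IHn (fun i => f (lift ord0 i)) (fun i => fI _).
set g := (fun x : 'rV[R]_n => _) in gI gE.
have E z : \prod_(i < n.+1) f i (cons_rV z ord0 i) = f ord0 z.1 * g z.2.
  rewrite big_ord_recl mxE unlift_none/=; congr (_ * _).
  by apply: eq_bigr => i _; rewrite mxE liftK.
have I : cI (leb \x mu n)%E (fun z => f ord0 z.1 * g z.2).
  have := @cI_prod _ _ _ _ _ leb (mu n) 1 (f ord0) g (fun=> 1) (fI _) gI (cmeas_cst _ _) _.
  under eq_fun do rewrite mulr1; apply => z.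
  by rewrite -[1]/((1 : R)%:C) normc_real normr1.
have [||J ->] := @cint_cons_rV n (fun x => \prod_(i < n.+1) f i (x ord0 i)).
- apply: cmeas_prod => i; apply: (cmeas_comp (cI_meas (fI i))).
  exact: measurable_coord.
- by under eq_fun do rewrite E.
split => //; under [X in cint _ X]eq_fun do rewrite E.
rewrite -(cfubini1 I) big_ord_recl -gE /=.
under [X in cint _ X]eq_fun do rewrite cintZ// mulrC.
by rewrite cintZ// mulrC.
Qed.

End product_integrals.

(** * The Plancherel identity *)

Lemma rmct d (T : measurableType d) (R : realType) (m : {measure set T -> \bar R})
    (f_ : nat -> T -> R) (f : T -> R) (L : R) : (forall k, m.-integrable setT (EFin \o f_ k)) ->
  (forall k x, 0 <= f_ k x) -> (forall x, nondecreasing_seq (f_^~ x)) ->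
  (forall x, f_ k x @[k --> \oo] --> f x) -> \int[m]_x f_ k x @[k --> \oo] --> L ->
  m.-integrable setT (EFin \o f) /\ \int[m]_x f x = L.
Proof.
move=> fI f0 nd fc fL.
have cv := @cvg_monotone_convergence _ _ _ m setT measurableT (fun k x => (f_ k x)%:E)
  (fun k => measurable_int _ (fI k)).
have {}cv : (\int[m]_x (f_ k x)%:E @[k --> \oo] --> \int[m]_x (f x)%:E)%E.
  have -> : (\int[m]_x (f x)%:E = \int[m]_x limn (fun k => (f_ k x)%:E))%E.
    apply: eq_integral => x _; apply/esym/cvg_lim => //.
    by apply: cvg_EFin => //; [exact: nearW|exact: fc].
  apply: cv; first by move=> k x _; rewrite lee_fin.
  by move=> x _ i j ij; rewrite lee_fin; exact: nd.
have E : (\int[m]_x (f x)%:E = L%:E)%E.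
  apply: (cvg_unique _ cv) => //.
  have -> : (fun k => \int[m]_x (f_ k x)%:E)%E = EFin \o (fun k => \int[m]_x f_ k x).
    by apply/funext => k; exact: rint_EFin.
  by apply: cvg_EFin => //; exact: nearW.
split; last by rewrite /Rintegral E.
apply: rI_ge0; last by rewrite E ltry.
  by apply: measurable_fun_cvg; [move=> k; exact: rI_meas (fI k)|move=> x _; exact: fc].
move=> x; rewrite -oppr_le0; apply: (@le_cvg0 _ _ (fun k => f_ k x - f x)).
  by move=> k; rewrite lerBrDr addrC subrr.
by rewrite -[X in _ --> X](subrr (f x)); apply: cvgB => //; exact: cvg_cst.
Qed.

Section characters.
Context {R : realType}.

Lemma expi0 : expi (0 : R) = 1.
Proof. by apply: complex_eqP; rewrite /expi /= ?cos0 ?sin0. Qed.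

Lemma expiD (s t : R) : expi (s + t) = expi s * expi t.
Proof. by apply: complex_eqP; rewrite ?cReM ?cImM /= ?cosD ?sinD; ring. Qed.

Lemma expiN (t : R) : expi (- t) = ((expi t)^*)%R.
Proof. by apply: complex_eqP; rewrite ?cReJ ?cImJ /= ?cosN ?sinN. Qed.

Lemma normsq_expi (t : R) : normsq (expi t) = 1.
Proof. exact: cos2Dsin2. Qed.

Lemma normc_expi (t : R) : Normc.normc (expi t) = 1.
Proof. by rewrite normc_normsq normsq_expi sqrtr1. Qed.

Lemma expi_sum n (F : 'I_n -> R) : expi (\sum_(i < n) F i) = \prod_(i < n) expi (F i).
Proof.
elim: n F => [|n IH] F; first by rewrite !big_ord0 expi0.
by rewrite !big_ord_recl expiD IH.
Qed.

Lemma cmeas_expi d (T : measurableType d) (h : T -> R) : measurable_fun setT h ->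
  cmeas (fun x => expi (h x)).
Proof.
move=> mh; split; apply: measurableT_comp => //; apply: continuous_measurable_fun.
  exact: continuous_cos.
exact: continuous_sin.
Qed.

Section dotv.
Context {n : nat}.
Implicit Types x y z : 'rV[R]_n.

Lemma dotvC x y : dotv x y = dotv y x.
Proof. by apply: eq_bigr => i _; rewrite mulrC. Qed.

Lemma dotvDl x y z : dotv (x + y) z = dotv x z + dotv y z.
Proof. by rewrite -big_split; apply: eq_bigr => i _; rewrite /= mxE mulrDl. Qed.

Lemma dotvZl (a : R) x y : dotv (a *: x) y = a * dotv x y.
Proof. by rewrite /dotv big_distrr; apply: eq_bigr => i _; rewrite /= mxE mulrA. Qed.

Lemma dotvNl x y : dotv (- x) y = - dotv x y.
Proof. by rewrite -scaleN1r dotvZl mulN1r. Qed.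

Lemma dotvBl x y z : dotv (x - y) z = dotv x z - dotv y z.
Proof. by rewrite dotvDl dotvNl. Qed.

Lemma dotv0l y : dotv 0 y = 0.
Proof. by rewrite -(scale0r 0) dotvZl mul0r. Qed.

Lemma measurable_dotv d (T : measurableType d) (f g : T -> 'rV[R]_n) :
  measurable_fun setT f -> measurable_fun setT g ->
  measurable_fun setT (fun t => dotv (f t) (g t)).
Proof.
move=> mf mg; apply: measurable_sum => i.
by apply: measurable_funM; [exact: measurableT_comp (measurable_coord i) mf|
  exact: measurableT_comp (measurable_coord i) mg].
Qed.

End dotv.
End characters.

Section plancherel.
Context {R : realType} {n : nat}.
Local Notation V := 'rV[R]_n.
Local Notation mu := (@lebesgue_rV R n).
Local Notation rI f := (mu.-integrable setT (EFin \o f)).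
Local Notation ipn := (ip_norm (@inner R n)).
Hypothesis n_gt0 : (0 < n)%N.

Definition abel (y : V) : R := expR (- \sum_(i < n) `|y ord0 i|).

(** The product of one-dimensional kernels, not the rotation-invariant Poisson kernel of R^n, and
    without normalization, so that its mass is (2 pi)^n. *)
Definition poisson (z : V) : R := \prod_(i < n) (2 / (1 + z ord0 i ^+ 2)).

Lemma abelE y : abel y = \prod_(i < n) expR (- `|y ord0 i|).
Proof. by rewrite /abel -expR_sum sumrN. Qed.

Lemma abelZ (a : R) y : 0 <= a -> abel (a *: y) = expR (- (a * \sum_(i < n) `|y ord0 i|)).
Proof.
move=> a0; rewrite /abel big_distrr; congr (expR (- _)); apply: eq_bigr => i _ /=.
by rewrite mxE normrM ger0_norm.
Qed.

Lemma prod_realC (I : Type) (r : seq I) (F : I -> R) :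
  (\prod_(i <- r) F i)%:C = \prod_(i <- r) (F i)%:C :> R[i].
Proof. exact: rmorph_prod. Qed.

Lemma abel_char y z : (abel y)%:C * expi (dotv y z) =
  \prod_(i < n) ((expR (- `|y ord0 i|))%:C * expi (y ord0 i * z ord0 i)).
Proof. by rewrite big_split /= abelE prod_realC expi_sum. Qed.

Lemma cI_abel z : cI mu (fun y => (abel y)%:C * expi (dotv y z)).
Proof.
have [I _] := cint_prod_rV (fun i => cI_poisson (z ord0 i)).
by under eq_fun do rewrite abel_char.
Qed.

Lemma cint_abel z : cint mu (fun y => (abel y)%:C * expi (dotv y z)) = (poisson z)%:C.
Proof.
have [_ E] := cint_prod_rV (fun i => cI_poisson (z ord0 i)).
rewrite prod_realC; under [RHS]eq_bigr do rewrite -cint_poisson.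
by rewrite -E; congr (cint mu _); apply/funext => y; exact: abel_char.
Qed.

Lemma rI_abel : rI abel.
Proof.
have [+ _] := cI_abel 0; congr (mu.-integrable _ (EFin \o _)); apply/funext => y.
by rewrite dotvC dotv0l expi0 mulr1.
Qed.

Lemma rint_poisson : rI poisson /\ \int[mu]_z poisson z = (2 * pi) ^+ n.
Proof.
have [I E] := @rI_oneDsqrV R.
have [J] := cint_prod_rV (fun i : 'I_n => cI_real I).
have PE : (fun x : V => \prod_(i < n) (2 / (1 + x ord0 i ^+ 2))%:C) = (fun x => (poisson x)%:C).
  by apply/funext => x; rewrite -prod_realC.
rewrite PE in J *; move=> F; split; first by case: J.
apply: (@complexI R); rewrite -cint_real F.
under eq_bigr do rewrite cint_real E.
by rewrite prodr_const card_ord rmorphXn.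
Qed.

Lemma poisson_ge0 z : 0 <= poisson z.
Proof.
by apply: prodr_ge0 => i _; rewrite divr_ge0// addr_ge0// sqr_ge0.
Qed.

Lemma poisson_le z : `|poisson z| <= 2 ^+ n.
Proof.
rewrite ger0_norm ?poisson_ge0//.
rewrite -[X in _ <= _ ^+ X](card_ord n) -prodr_const; apply: ler_prod => i _.
rewrite divr_ge0 ?addr_ge0 ?sqr_ge0//= ler_pdivrMr ?ltr_pwDl ?sqr_ge0//.
by have := sqr_ge0 (z ord0 i); lra.
Qed.

(** The exponential has sign +, so this is the inverse transform without its factor (2 pi)^-n; the
    forward transform of f is the conjugate of [fint] at the conjugate of f. *)
Definition fint (g : V -> R[i]) (xi : V) : R[i] := cint mu (fun x => g x * expi (dotv x xi)).

Lemma cmeas_expi_dotv (xi : V) : cmeas (fun x : V => expi (dotv x xi)).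
Proof. by apply: cmeas_expi; apply: measurable_dotv; [exact: measurable_id|exact: measurable_cst]. Qed.

Lemma cI_fint g xi : cI mu g -> cI mu (fun x => g x * expi (dotv x xi)).
Proof.
move=> gI; apply: (cIM_bounded (B := 1) gI (cmeas_expi_dotv xi)) => x.
by rewrite normc_expi.
Qed.

Lemma normc_fint_le g : cI mu g -> exists B : R, forall xi, Normc.normc (fint g xi) <= B.
Proof.
(* The 2 comes from bounding real and imaginary parts separately. *)
move=> gI; exists (2 * \int[mu]_x Normc.normc (g x)) => xi.
have [I1 I2] := cI_fint xi gI; have gn := cI_normc gI.
apply: (le_trans (ler_normc_ReIm _)); rewrite mulr_natl mulr2n.
have E x : Normc.normc (g x) = Normc.normc (g x * expi (dotv x xi)).
  by rewrite Normc.normcM normc_expi mulr1.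
apply: lerD; apply: (le_trans (le_normr_Rintegral measurableT _)) => //.
  by apply: le_Rintegral => // [|x _]; [exact: rI_norm|rewrite E ler_normc_Re].
by apply: le_Rintegral => // [|x _]; [exact: rI_norm|rewrite E ler_normc_Im].
Qed.

Lemma abel_gt0 y : 0 < abel y. Proof. exact: expR_gt0. Qed.

Lemma rI_abelZ (e : R) : 0 < e -> rI (fun y => abel (e *: y)).
Proof.
by move=> e0; have := rI_affine 0 e0 rI_abel; under eq_fun do rewrite add0r.
Qed.

Lemma cI_prod_char (F g : V -> R[i]) (h : V * V -> R) : cI mu F -> cI mu g ->
  measurable_fun setT h -> cI (mu \x mu)%E (fun z => F z.1 * g z.2 * expi (h z)).
Proof.
move=> FI gI mh; apply: (cI_prod (B := 1) FI gI (cmeas_expi mh)) => z.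
by rewrite normc_expi.
Qed.

(** Measurability comes out of Fubini, which needs integrability in both variables: the positive
    weight [abel] is inserted and divided out afterwards. *)
Lemma cmeas_fint g : cI mu g -> cmeas (fint g).
Proof.
move=> gI; have aI := cI_real rI_abel.
have := cfubini_meas1 (cI_prod_char aI gI (measurable_dotv measurable_snd measurable_fst)).
move=> /cmeasM /(_ (@cmeas_real _ _ _ (fun y => (abel y)^-1) _)).
have mV : measurable_fun setT (fun y => (abel y)^-1).
  rewrite (_ : (fun y => _) = (fun y : V => expR (- - \sum_(i < n) `|y ord0 i|))); last first.
    by apply/funext => y; rewrite expRN.
  under eq_fun do rewrite opprK.
  apply: measurableT_comp => //; apply: measurable_sum => i.
  by apply: measurableT_comp => //; exact: measurable_coord.
move=> /(_ mV); congr cmeas; apply/funext => xi /=.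
under [X in cint _ X]eq_fun do rewrite -mulrA.
rewrite cintZ; last exact: cI_fint.
by rewrite mulrAC -rmorphM /= divff ?gt_eqF ?abel_gt0// mul1r.
Qed.

Lemma fintJ g xi : cI mu g ->
  ((fint g xi)^*)%R = cint mu (fun x => ((g x)^*)%R * expi (- dotv x xi)).
Proof.
move=> gI; rewrite -cintJ; last exact: cI_fint.
by congr (cint mu _); apply/funext => x; rewrite rmorphM/= expiN.
Qed.

Lemma cint_abelZ (e : R) z : 0 < e ->
  cint mu (fun xi => (abel (e *: xi))%:C * expi (dotv xi z)) =
  (e ^- n * poisson (e^-1 *: z))%:C.
Proof.
move=> e0; have en0 : e ^+ n != 0 by rewrite expf_neq0// gt_eqF.
rewrite rmorphM/= -cint_abel -(cint_affine 0 e0 (cI_abel _)) mulrA -rmorphM mulVf// mul1r.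
congr (cint mu _); apply/funext => xi; rewrite add0r.
by rewrite dotvZl [dotv xi (_ *: _)]dotvC dotvZl mulrA divff ?gt_eqF// mul1r dotvC.
Qed.

(** Fubini moves the transform of the weight, a Poisson kernel of width e around y, onto g; the
    substitution x = y + e z then removes e from the kernel. *)
Lemma cint_abelZ_fint (e : R) g y : 0 < e -> cI mu g ->
  cint mu (fun xi => (abel (e *: xi))%:C * fint g xi * expi (- dotv y xi)) =
  cint mu (fun z => (poisson z)%:C * g (e *: z + y)).
Proof.
move=> e0 gI; have en0 : e ^+ n != 0 by rewrite expf_neq0// gt_eqF.
have aI := cI_real (rI_abelZ e0).
pose h (z : V * V) := dotv z.2 z.1 - dotv y z.1.
have mh : measurable_fun setT h.
  apply: measurable_funB; apply: measurable_dotv; first exact: measurable_snd.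
  - exact: measurable_fst.
  - exact: measurable_cst.
  - exact: measurable_fst.
have FI := cI_prod_char aI gI mh.
transitivity (cint mu (fun xi => cint mu (fun x => (abel (e *: xi))%:C * g x * expi (h (xi, x))))).
  congr (cint mu _); apply/funext => xi; rewrite /h /=.
  under [in RHS]eq_fun do rewrite expiD mulrA.
  under [X in _ = cint _ X]eq_fun => x do rewrite mulrC -mulrA.
  rewrite cintZ; last by apply: cIZ; exact: cI_fint.
  by rewrite cintZ; [rewrite mulrC mulrA|exact: cI_fint].
rewrite (cfubini FI) /=.
pose f x := (e ^- n)%:C * (g x * (poisson (e^-1 *: (x - y)))%:C).
transitivity (cint mu f).
  congr (cint mu _); apply/funext => x; rewrite /f /h /=.
  under eq_fun => xi do rewrite -dotvBl mulrAC mulrC [dotv (x - y) _]dotvC.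
  rewrite cintZ; last first.
    apply: (cIM_bounded (B := 1) aI); last by move=> ?; rewrite normc_expi.
    by apply: cmeas_expi; apply: measurable_dotv; [exact: measurable_id|exact: measurable_cst].
  by rewrite (cint_abelZ _ e0) rmorphM/= mulrCA.
have fI : cI mu f.
  apply: cIZ; apply: (cIM_bounded (B := 2 ^+ n) gI).
    apply: cmeas_real; apply: (measurableT_comp (rI_meas rint_poisson.1)).
    have := @measurable_affine R n e^-1 (- (e^-1 *: y)); congr measurable_fun.
    by apply/funext => x; rewrite scalerBr addrC.
  by move=> x; rewrite normc_real poisson_le.
rewrite -(cint_affine y e0 fI) -cintZ; last exact: cI_affine.
congr (cint mu _); apply/funext => z.
rewrite /f mulrA -rmorphM divff// mul1r mulrC [y + _]addrC; congr ((poisson _)%:C * _).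
by rewrite addrK scalerA mulVf ?gt_eqF// scale1r.
Qed.

(** Writing the conjugate transform as an integral and exchanging, the weighted inversion of
    [fint g] appears inside, and [cint_abelZ_fint] turns it into a Poisson average of g. *)
Lemma abel_plancherel (e : R) g : 0 < e -> cI mu g -> L2 g ->
  cint mu (fun xi => (abel (e *: xi))%:C * (fint g xi * ((fint g xi)^*)%R)) =
  cint mu (fun z => (poisson z)%:C * inner (translate (e *: z) g) g).
Proof.
move=> e0 gI gL; have aI := cI_real (rI_abelZ e0).
have [B GB] := normc_fint_le gI.
have FI : cI mu (fun xi => (abel (e *: xi))%:C * fint g xi).
  exact: (cIM_bounded aI (cmeas_fint gI) GB).
have mh : measurable_fun setT (fun z : V * V => - dotv z.2 z.1).
  by apply: measurableT_comp => //; apply: measurable_dotv; [exact: measurable_snd|exact: measurable_fst].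
have PI := cI_prod_char FI (cIJ gI) mh.
rewrite -(cint_shear e rint_poisson.1 poisson_ge0 gL).
transitivity (cint mu (fun xi => cint mu (fun y =>
   (abel (e *: xi))%:C * fint g xi * ((g y)^*)%R * expi (- dotv y xi)))).
  congr (cint mu _); apply/funext => xi; rewrite mulrA fintJ// -cintZ.
    by congr (cint mu _); apply/funext => y; rewrite mulrA.
  apply: (cIM_bounded (B := 1) (cIJ gI)); last by move=> ?; rewrite normc_expi.
  by apply: cmeas_expi; apply: measurableT_comp => //; apply: measurable_dotv;
    [exact: measurable_id|exact: measurable_cst].
rewrite (cfubini PI) /=; congr (cint mu _); apply/funext => y.
under eq_fun => xi do rewrite mulrAC mulrC.
rewrite cintZ; last first.
  apply: (cIM_bounded (B := 1) FI); last by move=> ?; rewrite normc_expi.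
  by apply: cmeas_expi; apply: measurableT_comp => //; apply: measurable_dotv;
    [exact: measurable_cst|exact: measurable_id].
rewrite (cint_abelZ_fint y e0 gI) -cintZ.
  by congr (cint mu _); apply/funext => z; rewrite mulrC mulrA.
have := cIM_bounded (cI_affine y e0 gI) (cmeas_real (rI_meas rint_poisson.1)).
move=> /(_ (2 ^+ n)); under eq_fun do rewrite mulrC addrC; apply => z.
by rewrite normc_real poisson_le.
Qed.

Lemma sqr_cvg_plancherel g : cI mu g -> L2 g ->
  \int[mu]_xi (abel (k.+1%:R^-1 *: xi) * normsq (fint g xi)) @[k --> \oo] -->
    (2 * pi) ^+ n * \int[mu]_x normsq (g x).
Proof.
move=> gI gL.
have := approximate_identity n_gt0 rint_poisson.1 poisson_ge0 gL (@cvg_harmonic R).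
rewrite rint_poisson.2 (ip_self (hilbert_L2) gL) inner_self -rmorphM => cv.
apply/cvgrPdist_le => /= e e0; move/cvgr0Pnorm_le : cv => /(_ e e0).
apply: filterS => k; rewrite ger0_norm ?normc_ge0// => h.
rewrite distrC; apply: le_trans h.
have k0 : 0 < k.+1%:R^-1 :> R by rewrite invr_gt0.
rewrite -(abel_plancherel k0 gI gL).
have -> : (fun xi => (abel (k.+1%:R^-1 *: xi))%:C * (fint g xi * ((fint g xi)^*)%R)) =
    (fun xi => (abel (k.+1%:R^-1 *: xi) * normsq (fint g xi))%:C).
  by apply/funext => xi; rewrite mulcJ -rmorphM.
by rewrite cint_real -rmorphB normc_real.
Qed.

(** The weights increase to 1 as their parameter 1/(k + 1) decreases, so monotone convergence
    applies without knowing beforehand that [fint g] is square integrable; the approximate identity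
    gives the limit of the integrals. *)
Theorem plancherel g : cI mu g -> L2 g -> L2 (fint g) /\
  \int[mu]_xi normsq (fint g xi) = (2 * pi) ^+ n * \int[mu]_x normsq (g x).
Proof.
move=> gI gL; have mG := cmeas_fint gI; have [B GB] := normc_fint_le gI.
have [|k xi|xi|xi||I E] := @rmct _ _ _ mu
   (fun k xi => abel (k.+1%:R^-1 *: xi) * normsq (fint g xi)) (fun xi => normsq (fint g xi))
   ((2 * pi) ^+ n * \int[mu]_x normsq (g x)).
- move=> k; have k0 : 0 < k.+1%:R^-1 :> R by rewrite invr_gt0.
  apply: rI_le _ _ (rIZ (B ^+ 2) (rI_abelZ k0)).
    by apply: measurable_funM; [exact: rI_meas (rI_abelZ k0)|exact: measurable_normsq].
  move=> xi; rewrite ger0_norm ?mulr_ge0 ?normsq_ge0 ?(ltW (abel_gt0 _))//.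
  rewrite mulrC ler_wpM2r ?(ltW (abel_gt0 _))// -sqr_normc_normsq ler_pXn2r ?nnegrE ?normc_ge0//.
  exact: le_trans (normc_ge0 _) (GB xi).
- by rewrite mulr_ge0 ?normsq_ge0 ?(ltW (abel_gt0 _)).
- move=> j k jk; rewrite ler_wpM2r ?normsq_ge0// !abelZ ?invr_ge0//.
  rewrite ler_expR lerN2 ler_wpM2r ?sumr_ge0//.
  by rewrite lef_pV2 ?posrE ?ltr0n// ler_nat.
- pose S : R := \sum_(i < n) `|xi ord0 i|.
  have cH : k.+1%:R^-1 @[k --> \oo] --> (0 : R) by exact: (@cvg_harmonic R).
  have cS : - (k.+1%:R^-1 * S) @[k --> \oo] --> (0 : R).
    by rewrite -[X in _ --> X]oppr0 -[X in _ --> - X](mul0r S); apply: cvgN; apply: cvgM => //; exact: cvg_cst.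
  have {}cS : expR (- (k.+1%:R^-1 * S)) @[k --> \oo] --> (1 : R).
    by rewrite -[X in _ --> X]expR0; apply: continuous_cvg => //; exact: continuous_expR.
  rewrite -[X in _ --> X]mul1r; apply: cvgM; last exact: cvg_cst.
  by under eq_fun do rewrite abelZ ?invr_ge0//.
- exact: sqr_cvg_plancherel.
by split => //; apply/L2P.
Qed.

End plancherel.

(** * Convex sets *)

Section convex_sets.
Context {R : realType} {n : nat}.
Local Notation V := 'rV[R]_n.
Local Notation mu := (@lebesgue_rV R n).

Lemma coord_le_norm (x : V) i : `|x ord0 i| <= `|x|.
Proof.
by rewrite [leRHS]/Num.norm /= mx_normrE; apply/bigmax_geP; right => /=; exists (ord0, i).
Qed.

Lemma norm_le_coord (x : V) (r : R) : 0 <= r -> (`|x| <= r) <-> (forall i, `|x ord0 i| <= r).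
Proof.
move=> r0; split=> [h i|h]; first exact: le_trans (coord_le_norm x i) h.
rewrite [leLHS]/Num.norm /= mx_normrE; apply/bigmax_leP; split=> // -[i j] _ /=.
by rewrite (ord1 i).
Qed.

Lemma nbhs_rVP (x : V) (U : set V) : nbhs x U <->
  exists2 e : R, 0 < e & forall y : V, (forall i, `|y ord0 i - x ord0 i| < e) -> U y.
Proof.
split=> [/nbhs_ballP[e /= e0 eU]|[e e0 eU]].
  exists e => // y ye; apply: eU; split=> // i j.
  by rewrite (ord1 i) -ball_normE /= distrC.
apply/nbhs_ballP; exists e => //= y [_ ye]; apply: eU => i.
by have := ye ord0 i; rewrite -ball_normE /= distrC.
Qed.

Lemma box_open_interior (U : set V) : box_open U°.
Proof.
move=> x Ux; apply/nbhs_rVP; exact: (open_nbhs_nbhs (conj (open_interior U) Ux)).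
Qed.

Lemma convex_comb (U : set V) (x y : V) (t : R) : convex_set U -> U x -> U y ->
  0 <= t <= 1 -> U ((1 - t) *: x + t *: y).
Proof.
move=> cU Ux Uy t01.
have /andP[t0 t1] : 0 <= 1 - t <= 1 by lra.
have := cU x y (Itv01 t0 t1); rewrite !inE => /(_ Ux Uy).
by rewrite /conv /= /unstable.onem subKr.
Qed.

Lemma interior_comb (U : set V) (x0 x : V) (t : R) : convex_set U -> U° x0 -> U x ->
  0 <= t < 1 -> U° ((1 - t) *: x0 + t *: x).
Proof.
move=> cU /nbhs_rVP[e e0 eU] Ux /andP[t0 t1]; apply/nbhs_rVP.
have t1' : 0 < 1 - t by rewrite subr_gt0.
exists ((1 - t) * e); first by rewrite mulr_gt0.
(* z solves y = (1 - t) z + t x and lies within e of x0. *)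
move=> y ye; pose z := x0 + (1 - t)^-1 *: (y - ((1 - t) *: x0 + t *: x)).
have -> : y = (1 - t) *: z + t *: x.
  rewrite /z scalerDr scalerA divff ?gt_eqF// scale1r; apply/rowP => i.
  by rewrite !mxE; ring.
apply: convex_comb => //; last by rewrite t0 ltW.
apply: eU => i; have := ye i; rewrite !mxE => h.
rewrite addrAC subrr add0r normrM ger0_norm ?invr_ge0 ?(ltW t1')//.
by rewrite ltr_pdivrMl.
Qed.

Lemma bounded_coord (U : set V) : bounded_set U ->
  exists2 B : R, 0 <= B & forall x, U x -> forall i, `|x ord0 i| <= B.
Proof.
move=> [M [Mr MB]]; exists (Num.max 0 (M + 1)); first by rewrite le_max lexx.
move=> x Ux i; apply: (le_trans (coord_le_norm x i)); rewrite le_max; apply/orP; right.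
by apply: (MB (M + 1)) => //; rewrite ltrDl.
Qed.

Lemma bounded_lty (U : set V) (B : R) : measurable U ->
  (forall x, U x -> forall i, `|x ord0 i| <= B) -> (mu U < +oo)%E.
Proof.
move=> mU UB; apply: le_lt_trans (rbox_lty (cube n (Num.truncn B).+1)).
apply: le_measure; rewrite ?inE//; first exact: measurable_rbox.
by move=> x Ux; apply/cubeE => i; exact: le_lt_trans (UB x Ux i) (truncnS_gt _).
Qed.

(** The contraction towards an interior point x0 by a factor t k < 1 maps U into its interior, so U
    lies in [W k], whose measure is that of the interior divided by (t k)^n. As t k tends to 1, the
    intersection of the [W k] minus the interior is null, and it is Borel even if U is not. *)
Lemma convex_boundary_null (U : set V) : bounded_set U -> convex_set U -> U° !=set0 ->
  exists N, [/\ measurable N, mu N = 0%E & U `<=` U° `|` N].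
Proof.
move=> bU cU [x0 Ux0]; have oU := box_open_interior (U := U).
have mU : measurable U° by exact: box_open_measurable.
have [B B0 UB] := bounded_coord bU.
have Uoo : (mu U° < +oo)%E.
  by apply: (@bounded_lty _ B) => // x /interior_subset; exact: UB.
pose t k : R := (1 + k.+1%:R^-1)^-1.
have h0 k : 0 < k.+1%:R^-1 :> R by rewrite invr_gt0.
have t0 k : 0 < t k by rewrite invr_gt0 addr_gt0.
have t1 k : t k < 1 by rewrite invf_lt1 ?ltrDl// addr_gt0.
pose W k := (fun x : V => (1 - t k) *: x0 + t k *: x) @^-1` U°.
have mW k : measurable (W k).
  have := @measurable_affine R n (t k) ((1 - t k) *: x0) measurableT _ mU.
  by rewrite setTI.
have muW k : ((t k ^+ n)%:E * mu (W k) = mu U°)%E by exact: lebesgue_rV_affine.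
have UW k : U `<=` W k.
  by move=> x Ux; apply: interior_comb => //; rewrite (ltW (t0 k)) t1.
pose N := (\bigcap_k W k) `\` U°.
have mN : measurable N by apply: measurableD => //; exact: bigcap_measurable.
exists N; split=> //; last first.
  move=> x Ux; have [?|?] := pselect (U° x); [by left|right; split => // k _; exact: UW].
have WE k : mu (W k) = (((1 + k.+1%:R^-1) ^+ n) * fine (mu U°))%:E.
  have tn : t k ^+ n != 0 by rewrite expf_neq0// gt_eqF.
  have Ufin : mu U° \is a fin_num by rewrite ge0_fin_numE.
  rewrite EFinM fineK// -(muW k) muleA -EFinM -exprMn /t divff ?expr1n ?mul1e//.
have NW k : (mu N <= (((1 + k.+1%:R^-1) ^+ n - 1) * fine (mu U°))%:E)%E.
  have UWk : U° `<=` W k by apply: subset_trans (UW k); exact: interior_subset.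
  apply: (@le_trans _ _ (mu (W k `\` U°))).
    apply: le_measure; rewrite ?inE//; first exact: measurableD.
    by move=> x [xW ?]; split => //; exact: xW.
  have Woo : (mu (W k) < +oo)%E by rewrite WE ltry.
  have E : mu (W k `\` U°) = (mu (W k) - mu U°)%E.
    by rewrite -[in RHS](setIidr UWk); exact: measureD.
  rewrite E WE -{2}[mu U°]fineK ?ge0_fin_numE// -EFinB.
  by rewrite lee_fin; rewrite mulrBl mul1r.
have Nfin : mu N \is a fin_num.
  by rewrite ge0_fin_numE//; apply: (le_lt_trans (NW 0)); exact: ltry.
rewrite -[mu N]fineK//; congr EFin; apply/eqP; rewrite eq_le fine_ge0// andbT.
apply: (@le_cvg0 _ _ (fun k => ((1 + k.+1%:R^-1) ^+ n - 1) * fine (mu U°))).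
  by move=> k; rewrite -lee_fin fineK.
have -> : (0 : R) = ((1 + 0) ^+ n - 1) * fine (mu U°) by rewrite addr0 expr1n subrr mul0r.
apply: cvgM; last exact: cvg_cst.
apply: cvgB; last exact: cvg_cst.
apply: (@continuous_cvg _ _ _ _ _ _ (fun x : R => x ^+ n)); first exact: exprn_continuous.
by apply: cvgD; [exact: cvg_cst|exact: (@cvg_harmonic R)].
Qed.

Lemma dilationE (a : R) (U : set V) : 0 < a ->
  dilation a U = (fun x : V => 0 + a^-1 *: x) @^-1` U.
Proof.
move=> a0; have an0 : a != 0 by rewrite gt_eqF.
apply/seteqP; split=> [_ [x Ux <-]|x /= Ux].
  by rewrite /= add0r scalerA mulVf// scale1r.
by exists (0 + a^-1 *: x) => //; rewrite add0r scalerA divff// scale1r.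
Qed.

Lemma measurable_dilation (a : R) (U : set V) : 0 < a -> measurable U ->
  measurable (dilation a U).
Proof.
move=> a0 mU; rewrite dilationE//.
by have := @measurable_affine R n a^-1 0 measurableT _ mU; rewrite setTI.
Qed.

Lemma lebesgue_dilation (a : R) (U : set V) : 0 < a -> measurable U ->
  mu (dilation a U) = ((a ^+ n)%:E * mu U)%E.
Proof.
move=> a0 mU; have ai0 : 0 < a^-1 by rewrite invr_gt0.
rewrite -(lebesgue_rV_affine 0 ai0 mU) -dilationE// muleA -EFinM -exprMn.
by rewrite divff ?gt_eqF// expr1n mul1e.
Qed.

Lemma box_open_dilation (a : R) (U : set V) : 0 < a -> box_open U -> box_open (dilation a U).
Proof.
move=> a0 oU _ [x Ux <-]; have [e e0 eU] := oU x Ux.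
exists (a * e); first by rewrite mulr_gt0.
move=> y ye; rewrite dilationE//=; apply: eU => i; have := ye i; rewrite !mxE add0r => h.
have -> : a^-1 * y ord0 i - x ord0 i = a^-1 * (y ord0 i - a * x ord0 i).
  by rewrite mulrBr mulrA mulVf ?gt_eqF// mul1r.
by rewrite normrM ger0_norm ?invr_ge0 ?(ltW a0)// ltr_pdivrMl.
Qed.

Lemma convex_volume (U : set V) : bounded_set U -> convex_set U -> U° !=set0 ->
  volume U = fine (mu U°).
Proof.
move=> bU cU U0; have [N [mN N0 UN]] := convex_boundary_null bU cU U0.
have mU : measurable U° by exact: box_open_measurable (box_open_interior (U := U)).
rewrite /volume; congr fine; apply/eqP; rewrite eq_le; apply/andP; split.
  apply: (@le_trans _ _ (mu_ext mu (U° `|` N))); first exact: le_mu_ext.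
  rewrite measurable_mu_extE; last exact: measurableU.
  apply: (le_trans (measureU2 _ mU mN)) => //.
  by rewrite [X in (_ + X)%E]N0 adde0.
by rewrite -(measurable_mu_extE mu mU); apply: le_mu_ext; exact: interior_subset.
Qed.

Lemma interior_lebesgue_gt0 (U : set V) : U° !=set0 -> (0 < n)%N -> (0 < mu U°)%E.
Proof.
move=> U0 n0; have [b [bU b0 _]] := disjoint_boxes n0 (box_open_interior (U := U)) U0.
apply: (lt_le_trans (b0 0)); apply: le_measure; rewrite ?inE//.
- exact: measurable_rbox.
- exact: box_open_measurable (box_open_interior (U := U)).
Qed.

End convex_sets.

(** * Fourier transform and Paley-Wiener spaces *)

Section fourier.
Context {R : realType} {n : nat}.
Local Notation V := 'rV[R]_n.
Local Notation mu := (@lebesgue_rV R n).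
Local Notation rI f := (mu.-integrable setT (EFin \o f)).
Local Notation N := (ip_norm (@inner R n)).
Hypothesis n_gt0 : (0 < n)%N.
Local Notation hH := (@hilbert_L2 R n).
Implicit Types (f g h : V -> R[i]).

Definition twopi : R := (2 * pi) ^+ n.

Lemma twopi_gt0 : 0 < twopi.
Proof. by rewrite exprn_gt0// mulr_gt0// pi_gt0. Qed.

Lemma normc_le1D (z : R[i]) : Normc.normc z <= 1 + normsq z.
Proof.
by rewrite -sqr_normc_normsq; have := sqr_ge0 (Normc.normc z - 2^-1); rewrite sqrrB; lra.
Qed.

Lemma L2_cI_supp g (D : set V) : measurable D -> (mu D < +oo)%E -> L2 g ->
  (forall x, ~ D x -> g x = 0) -> cI mu g.
Proof.
move=> mD Doo gL g0; apply: (cI_le (g := fun x => \1_D x + normsq (g x))).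
- exact: L2_meas.
- move=> x; rewrite indicE; have [Dx|Dx] := pselect (D x).
    by rewrite mem_set// normc_le1D.
  by rewrite memNset// g0// normsq0 addr0 -[0]/((0 : R)%:C) normc_real normr0.
- by apply: rID; [exact: rI_indic|exact: L2_normsq].
Qed.

Definition trunc f (r : R) : V -> R[i] := fun x => f x * cind [set x : V | `|x| <= r] x.

Lemma measurable_ball_norm (r : R) : measurable [set x : V | `|x| <= r].
Proof.
have [r0|r0] := leP 0 r; last first.
  rewrite (_ : [set x | _] = set0) //; apply/seteqP; split => // x /= xr.
  by have := le_lt_trans xr r0; rewrite ltNge normr_ge0.
rewrite (_ : [set x | _] = \bigcap_(i in [set: 'I_n]) ((fun x : V => x ord0 i) @^-1` `[- r, r])).
  apply: fin_bigcap_measurable => // i _.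
  by rewrite -[X in measurable X]setTI; apply: measurable_coord => //; exact: measurable_itv.
apply/seteqP; split => [x /(norm_le_coord _ r0) xr i _|x xr].
  by rewrite /= in_itv/= -ler_norml.
by apply/(norm_le_coord _ r0) => i; have := xr i I; rewrite /= in_itv/= -ler_norml.
Qed.

Lemma ball_norm_lty (r : R) : (mu [set x : V | (`|x| <= r)%R] < +oo)%E.
Proof.
apply: (@bounded_lty _ _ _ r); first exact: measurable_ball_norm.
by move=> x /= xr i; exact: le_trans (coord_le_norm x i) xr.
Qed.

Lemma L2_mul_cind f (D : set V) : measurable D -> L2 f -> L2 (fun x => f x * cind D x).
Proof.
move=> mD fL; apply/L2P; split.
  by apply: cmeasM; [exact: L2_meas|exact: cmeas_cind].
apply: rI_le _ _ (L2_normsq fL).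
  by apply: measurable_normsq; apply: cmeasM; [exact: L2_meas|exact: cmeas_cind].
move=> x; rewrite ger0_norm ?normsq_ge0// normsqM normsq_cind ler_piMr ?normsq_ge0//.
Qed.

Lemma L2_trunc f r : L2 f -> L2 (trunc f r).
Proof. by move=> fL; apply: L2_mul_cind => //; exact: measurable_ball_norm. Qed.

Lemma cI_trunc f r : L2 f -> cI mu (trunc f r).
Proof.
move=> fL; apply: (L2_cI_supp (measurable_ball_norm r) (ball_norm_lty r)).
  exact: L2_trunc.
by move=> x xr; rewrite /trunc /cind indicE memNset// mulr0.
Qed.

Lemma trunc_cvg f (u : nat -> R) : L2 f -> u k @[k --> \oo] --> +oo ->
  N (trunc f (u k) - f) @[k --> \oo] --> (0 : R).
Proof.
move=> fL uoo; have dL k : L2 (trunc f (u k) - f) by apply: (hB hH) => //; exact: L2_trunc.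
apply: sqr_ipn_cvg0 => //.
have [|k x|_] := @rdct _ _ _ mu (fun k x => normsq ((trunc f (u k) - f) x)) (fun=> 0)
   (fun x => normsq (f x)) (fun k => rI_meas (L2_normsq (dL k))) (measurable_cst _) _ _ (L2_normsq fL).
- apply: aeW => x; apply: cvg_near_cst.
  have /cvgryPge/(_ `|x|) := uoo; apply: filterS => k xu.
  by rewrite !fctE /trunc /cind indicE mem_set// mulr1 subrr normsq0.
- rewrite ger0_norm ?normsq_ge0// !fctE /trunc /cind indicE.
  by case: (_ \in _); rewrite ?mulr1 ?mulr0 ?subrr ?normsq0 ?normsq_ge0// sub0r /normsq cReN cImN !sqrrN.
- by rewrite /Rintegral integral0.
Qed.

Lemma cintegralE (D : set V) f : cintegral D f = cint mu (fun x => f x * cind D x).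
Proof.
rewrite /cintegral /cint; apply: complex_eqP => /=; rewrite Rintegral_mkcond;
  apply: eq_Rintegral => x _; rewrite patchE ?cReM ?cImM /cind /= indicE;
  by case: ifP; rewrite ?mulr0 ?mulr1 ?subr0 ?addr0 ?add0r.
Qed.

Definition conjf f : V -> R[i] := fun x => ((f x)^*)%R.

Lemma cintegral_trunc f r xi : L2 f ->
  cintegral [set x | `|x| <= r] (fun x => f x * expi (- dotv xi x)) =
  ((fint (conjf (trunc f r)) xi)^*)%R.
Proof.
move=> fL; rewrite cintegralE fintJ; last exact: cIJ (cI_trunc r fL).
congr (cint mu _); apply/funext => x; rewrite /conjf conjCK /trunc dotvC.
by rewrite mulrAC.
Qed.

(** Multiplication formula for the Fourier transform: by Fubini the character can be attached to
    either factor. The first factor on the left is the forward transform of h. *)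
Lemma fint_dual h g : cI mu h -> cI mu g ->
  cint mu (fun xi => ((fint (conjf h) xi)^*)%R * ((g xi)^*)%R) =
  cint mu (fun x => h x * ((fint g x)^*)%R).
Proof.
move=> hI gI.
have mh : measurable_fun setT (fun z : V * V => - dotv z.1 z.2).
  by apply: measurableT_comp => //; apply: measurable_dotv; [exact: measurable_fst|exact: measurable_snd].
have FI := cI_prod_char hI (cIJ gI) mh.
have expI F z : cI mu F -> cI mu (fun x => F x * expi (- dotv x z)).
  move=> FF; apply: (cIM_bounded (B := 1) FF); last by move=> ?; rewrite normc_expi.
  by under eq_fun do rewrite expiN; apply: cmeasJ; exact: cmeas_expi_dotv.
transitivity (cint mu (fun xi => cint mu (fun x => h x * ((g xi)^*)%R * expi (- dotv x xi)))).
  congr (cint mu _); apply/funext => xi; rewrite fintJ; last exact: cIJ.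
  rewrite mulrC -cintZ; last by apply: expI; under eq_fun do rewrite /conjf conjCK.
  by congr (cint mu _); apply/funext => x; rewrite /conjf conjCK mulrA [_ * h x]mulrC.
rewrite -(cfubini FI) /=; congr (cint mu _); apply/funext => x.
rewrite fintJ// -cintZ; last by apply: expI; exact: cIJ.
by congr (cint mu _); apply/funext => xi; rewrite mulrA dotvC.
Qed.

Lemma inner_fint h g : cI mu h -> L2 h -> cI mu g -> L2 g ->
  inner (conjf (fint (conjf h))) g = inner h (fint g).
Proof. by move=> hI hL gI gL; rewrite !innerE; exact: fint_dual. Qed.

Lemma L2_conjf f : L2 f -> L2 (conjf f).
Proof.
move=> /L2P[mf fI]; apply/L2P; split; first exact: cmeasJ.
by under eq_fun do rewrite normsqJ.
Qed.

Lemma nsq_conjf f : complex.Re (inner (conjf f) (conjf f)) = complex.Re (inner f f).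
Proof. by rewrite !inner_self; apply: eq_Rintegral => x _; rewrite normsqJ. Qed.

Lemma nsq_fint g : cI mu g -> L2 g ->
  complex.Re (inner (fint g) (fint g)) = twopi * complex.Re (inner g g).
Proof. by move=> gI gL; rewrite !inner_self; case: (plancherel n_gt0 gI gL). Qed.

Definition ift g : V -> R[i] := (twopi^-1)%:C *: fint g.

Lemma L2_ift g : cI mu g -> L2 g -> L2 (ift g).
Proof.
by move=> gI gL; apply: (hZ hH); case: (plancherel n_gt0 gI gL).
Qed.

(** Expanding both squares, the norms match by Plancherel and the cross terms by duality. This turns
    the error in [is_fourier] into a distance in the x variable, so the Plancherel transform never
    has to be built as an operator on L2. *)
Lemma nsq_trunc_fint f g r : L2 f -> cI mu g -> L2 g ->
  complex.Re (inner (g - conjf (fint (conjf (trunc f r)))) (g - conjf (fint (conjf (trunc f r))))) =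
  twopi * N (trunc f r - ift g) ^+ 2.
Proof.
move=> fL gI gL; set h := trunc f r.
have hI : cI mu h by exact: cI_trunc.
have hL : L2 h by exact: L2_trunc.
have hcI : cI mu (conjf h) by exact: cIJ.
have hcL : L2 (conjf h) by exact: L2_conjf.
have [FL _] := plancherel n_gt0 hcI hcL.
have [GL _] := plancherel n_gt0 gI gL.
have UL := L2_ift gI gL.
set F := fint (conjf h) in FL *.
have cFL : L2 (conjf F) by exact: L2_conjf.
have E0 : complex.Re (inner (conjf F) (conjf F)) = twopi * complex.Re (inner h h).
  by rewrite nsq_conjf (nsq_fint hcI hcL) nsq_conjf.
have E1 : complex.Re (inner g (conjf F)) = complex.Re (inner h (fint g)).
  by rewrite (inner_conj cFL gL) cReJ (inner_fint hI hL gI gL).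
have E2 : complex.Re (inner (ift g) (ift g)) = twopi^-1 ^+ 2 * (twopi * complex.Re (inner g g)).
  by rewrite (nsqZ hH _ GL) (nsq_fint gI gL) normsq_real.
have E3 : complex.Re (inner h (ift g)) = twopi^-1 * complex.Re (inner h (fint g)).
  by rewrite (ipZr hH _ GL hL) conjcR cReM mul0r subr0.
have alg (p X G I1 Q hh hF N2 I3 W : R) : p != 0 -> X = G - 2 * I1 + Q -> Q = p * hh ->
    I1 = hF -> N2 = hh - 2 * I3 + W -> W = p^-1 ^+ 2 * (p * G) -> I3 = p^-1 * hF -> X = p * N2.
  by move=> p0 -> -> -> -> -> ->; field.
exact: (alg _ _ _ _ _ _ _ _ _ _ (lt0r_neq0 twopi_gt0) (nsqB hH gL cFL) E0 E1
  (etrans (sqr_ip_norm hH (hB hH hL UL)) (nsqB hH hL UL)) E2 E3).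
Qed.

Lemma fourier_error f g r : L2 f -> cI mu g -> L2 g ->
  (\int[mu]_xi (normsq (g xi - cintegral [set x | (`|x| <= r)%R]
     (fun x => f x * expi (- dotv xi x))))%:E = (twopi * N (trunc f r - ift g) ^+ 2)%:E)%E.
Proof.
move=> fL gI gL; rewrite -(nsq_trunc_fint r fL gI gL) inner_self.
have [FL _] := plancherel n_gt0 (cIJ (cI_trunc r fL)) (L2_conjf (L2_trunc r fL)).
rewrite -rint_EFin; last by apply: L2_normsq; apply: (hB hH gL); exact: L2_conjf.
by apply: eq_integral => xi _; rewrite cintegral_trunc.
Qed.

Lemma trunc_cvgB f h : L2 f -> L2 h -> N (trunc f r - h) @[r --> +oo] --> N (f - h).
Proof.
move=> fL hL; apply/cvg_pinftyP => u uoo; have tL k := L2_trunc (u k) fL.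
apply/cvgrPdist_le => /= e e0.
have /cvgr0Pnorm_le/(_ e e0) := trunc_cvg fL uoo; apply: filterS => k.
rewrite ger0_norm ?ip_norm_ge0// => he; rewrite ler_distl; apply/andP; split.
  have := ip_normB_trans hH (tL k) fL hL; lra.
have := ip_normB_trans hH fL (tL k) hL.
rewrite (ip_norm_distC hH fL (tL k)); lra.
Qed.

(** For integrable g the error of the truncated transforms tends to (2 pi)^n |f - ift g|^2, which
    vanishes exactly when f and [ift g] agree almost everywhere. *)
Lemma is_fourierP f g : L2 f -> cI mu g -> L2 g ->
  is_fourier f g <-> {ae mu, forall x, f x = ift g x}.
Proof.
move=> fL gI gL; have UL := L2_ift gI gL.
have cv : twopi * N (trunc f r - ift g) ^+ 2 @[r --> +oo] --> twopi * N (f - ift g) ^+ 2.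
  apply: cvgMr; apply: (@continuous_cvg _ _ _ _ _ _ (fun x : R => x ^+ 2)).
    exact: exprn_continuous.
  exact: trunc_cvgB.
split=> [[_ _ h0]|ae].
  apply: ipn_eq0 => //.
  have {}h0 : twopi * N (trunc f r - ift g) ^+ 2 @[r --> +oo] --> (0 : R).
    move/fine_cvg : h0; apply: cvg_trans; apply: near_eq_cvg; apply: nearW => r /=.
    by rewrite fourier_error.
  have /eqP : twopi * N (f - ift g) ^+ 2 = 0 by exact: (cvg_unique _ cv h0).
  by rewrite mulf_eq0 (gt_eqF twopi_gt0) sqrf_eq0 => /eqP.
split=> //; move: cv; rewrite (ipn_ae fL UL ae) expr0n/= mulr0 => cv.
have -> : (fun r : R => \int[mu]_xi (normsq (g xi - cintegral [set x | (`|x| <= r)%R]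
     (fun x => f x * expi (- dotv xi x))))%:E)%E =
     EFin \o (fun r => twopi * N (trunc f r - ift g) ^+ 2).
  by apply/funext => r; exact: fourier_error.
by apply: cvg_EFin => //; exact: nearW.
Qed.

Lemma is_fourier_ae f g g' : L2 g -> L2 g' -> {ae mu, forall x, g x = g' x} ->
  is_fourier f g -> is_fourier f g'.
Proof.
move=> gL gL' gg [fL _ cv]; split=> //; move: cv; apply: cvg_trans; apply: near_eq_cvg.
apply: nearW => r.
have FL := (plancherel n_gt0 (cIJ (cI_trunc r fL)) (L2_conjf (L2_trunc r fL))).1.
have mF : cmeas (fun xi => cintegral [set x | `|x| <= r] (fun x => f x * expi (- dotv xi x))).
  have := L2_meas (L2_conjf FL); congr cmeas; apply/funext => xi.
  by rewrite cintegral_trunc.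
apply: ae_eq_integral => //.
- by apply/measurable_EFinP/measurable_normsq/cmeasB => //; exact: L2_meas.
- by apply/measurable_EFinP/measurable_normsq/cmeasB => //; exact: L2_meas.
- by apply: filterS gg => xi -> _.
Qed.

Lemma iftD a g h : cI mu g -> cI mu h -> ift (a *: g + h) = a *: ift g + ift h.
Proof.
move=> gI hI; apply/funext => x; rewrite /ift !fctE /fint.
rewrite -[RHS]/(a * ((twopi^-1)%:C * _) + (twopi^-1)%:C * _) mulrCA -mulrDr; congr (_ * _).
rewrite -cintZ; last exact: cI_fint.
rewrite -cintD; [|by apply: cIZ; exact: cI_fint|exact: cI_fint].
by congr (cint mu _); apply/funext => xi; rewrite -[a *: g xi]/(a * g xi) mulrDl mulrA.
Qed.

Lemma nsq_ift g : cI mu g -> L2 g ->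
  complex.Re (inner (ift g) (ift g)) = twopi^-1 * complex.Re (inner g g).
Proof.
move=> gI gL; have [GL _] := plancherel n_gt0 gI gL.
rewrite (nsqZ hH _ GL) (nsq_fint gI gL) normsq_real expr2 -mulrA mulKf//.
exact: lt0r_neq0 twopi_gt0.
Qed.

Lemma inner_ift g h : cI mu g -> L2 g -> cI mu h -> L2 h ->
  inner (ift g) (ift h) = (twopi^-1)%:C * inner g h.
Proof.
move=> gI gL hI hL.
have re k : cI mu k -> L2 k ->
    complex.Re (inner (ift g) (ift k)) = twopi^-1 * complex.Re (inner g k).
  move=> kI kL; have UgL := L2_ift gI gL; have UkL := L2_ift kI kL.
  have sI : cI mu (1 *: g + k).
    have := cID gI kI; congr cI; apply/funext => x.
    by rewrite -[RHS]/(1 * g x + k x) mul1r.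
  have sL : L2 (1 *: g + k) by exact: L2_lin.
  have := nsq_ift sI sL; rewrite (iftD 1 gI kI) !scale1r.
  have alg (p S S' a b c a' b' c' : R) : S = a + 2 * b + c -> S' = a' + 2 * b' + c' ->
      a = p * a' -> c = p * c' -> S = p * S' -> b = p * b'.
    by move=> -> -> -> ->; lra.
  exact: (alg _ _ _ _ _ _ _ _ _ (nsqD hH UgL UkL) (nsqD hH gL kL) (nsq_ift gI gL) (nsq_ift kI kL)).
(* Polarization: the norm identity at g + h gave the real part, and the real part for i h gives the
   imaginary one. *)
pose i : R[i] := 0 +i* 1.
have iI : cI mu (i *: h) by exact: cIZ.
have iL : L2 (i *: h) by exact: (hZ hH).
have r2 := re _ iI iL.
have UhL := L2_ift hI hL; have UgL := L2_ift gI gL.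
have iE : ift (i *: h) = i *: ift h.
  have := iftD i hI (cI0 mu); rewrite addr0 => ->.
  rewrite [X in _ + X](_ : _ = 0) ?addr0//; apply/funext => x.
  rewrite /ift -[LHS]/((twopi^-1)%:C * _) /fint.
  under eq_fun do rewrite mul0r.
  by rewrite cint_real /Rintegral integral0 mulr0.
apply: complex_eqP; first by rewrite (re _ hI hL) cReM mul0r subr0.
have cE (z : R[i]) : complex.Re ((i^*)%R * z) = complex.Im z.
  by rewrite cReM cReJ cImJ /=; ring.
move: r2; rewrite iE (ipZr hH _ UhL UgL) (ipZr hH _ hL gL) !cE => ->.
by rewrite cImM /=; ring.
Qed.

End fourier.

(** * Paley-Wiener spaces and their reproducing kernels *)

Section paley_wiener.
Context {R : realType} {n : nat}.
Local Notation V := 'rV[R]_n.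
Local Notation mu := (@lebesgue_rV R n).
Local Notation rI f := (mu.-integrable setT (EFin \o f)).
Local Notation N := (ip_norm (@inner R n)).
Hypothesis n_gt0 : (0 < n)%N.
Local Notation hH := (@hilbert_L2 R n).
Local Notation twopi := (@twopi R n).
Implicit Types (f g h : V -> R[i]).
Variables (A O Z : set V) (B : R).
Hypotheses (oO : box_open O) (O0 : O !=set0)
  (OB : forall x, O x -> forall i, `|x ord0 i| <= B) (OA : O `<=` A)
  (AO : A `<=` O `|` Z) (mZ : measurable Z) (Z0 : mu Z = 0%E).

Let mO : measurable O. Proof. exact: box_open_measurable. Qed.

Let Ooo : (mu O < +oo)%E. Proof. exact: bounded_lty OB. Qed.

(** Transforms are asked to vanish everywhere off the open set [O], not just almost everywhere off
    [A]: such functions are integrable, and [A], which may fail to be Borel, disappears from the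
    computations. *)
Definition L2_supp : set (V -> R[i]) := [set g | L2 g /\ forall x, ~ O x -> g x = 0].
Local Notation HO := L2_supp.

Lemma HO_L2 g : HO g -> L2 g. Proof. by case. Qed.

Lemma HO_cI g : HO g -> cI mu g.
Proof. by move=> [gL g0]; exact: L2_cI_supp g0. Qed.

Lemma HO_lin a g h : HO g -> HO h -> HO (a *: g + h).
Proof.
move=> [gL g0] [hL h0]; split; first exact: L2_lin.
by move=> x Ox; rewrite -[LHS]/(a * g x + h x) g0// h0// mulr0 addr0.
Qed.

Lemma HO_B g h : HO g -> HO h -> HO (g - h).
Proof.
by move=> gO hO; rewrite addrC -scaleN1r; exact: HO_lin.
Qed.

Lemma N_cut_le f : L2 f -> N (fun x => f x * cind O x) <= N f.
Proof.
move=> fL; rewrite /ip_norm ler_sqrt ?(ip_ge0 hH fL)// !inner_self.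
apply: le_Rintegral => //.
- by apply: L2_normsq; exact: L2_mul_cind.
- exact: L2_normsq.
move=> x _; rewrite normsqM normsq_cind ler_piMr ?normsq_ge0//.
Qed.

Lemma HO_0 : HO 0. Proof. by split; first exact: L2_0. Qed.

Lemma HO_cut g : L2 g -> HO (fun x => g x * cind O x).
Proof.
move=> gL; split; first exact: L2_mul_cind.
by move=> x Ox; rewrite /cind indicE memNset// mulr0.
Qed.

Lemma PWP f : PW A f <-> L2 f /\ exists2 g, HO g & {ae mu, forall x, f x = ift g x}.
Proof.
split=> [[g fg gA]|[fL [g gO fg]]].
  have [fL gL _] := fg; split => //.
  have cO := HO_cut gL; exists (fun x => g x * cind O x) => //.
  apply/(is_fourierP n_gt0 fL (HO_cI cO) (HO_L2 cO)).
  apply: is_fourier_ae fg => //; first exact: HO_L2.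
  have Zae : {ae mu, forall x, ~ Z x}.
    by exists Z; split=> // x /= /contrapT.
  apply: filterS2 gA Zae => x gx Zx; rewrite /cind indicE.
  have [Ox|Ox] := pselect (O x); first by rewrite mem_set// mulr1.
  by rewrite memNset// mulr0; apply: gx => /AO[].
exists g; first exact/(is_fourierP n_gt0 fL (HO_cI gO) (HO_L2 gO)).
by apply: aeW => x Ax; apply: gO.2 => /OA.
Qed.

Lemma PW_L2 f : PW A f -> L2 f. Proof. by move=> /PWP[]. Qed.

Lemma PW_ift g : HO g -> PW A (ift g).
Proof.
move=> gO; apply/PWP; split; first exact: L2_ift (HO_cI gO) (HO_L2 gO).
by exists g => //; exact: aeW.
Qed.

Lemma PW_ae f g : PW A f -> L2 g -> {ae mu, forall x, f x = g x} -> PW A g.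
Proof.
move=> /PWP[fL [h hO fh]] gL fg; apply/PWP; split=> //; exists h => //.
by apply: filterS2 fh fg => x <- <-.
Qed.

Lemma N_ift g : HO g -> N (ift g) = Num.sqrt twopi^-1 * N g.
Proof.
move=> gO; rewrite /ip_norm (nsq_ift n_gt0 (HO_cI gO) (HO_L2 gO)) sqrtrM//.
by rewrite invr_ge0 ltW// twopi_gt0.
Qed.

Lemma iftB g h : HO g -> HO h -> ift (g - h) = ift g - ift h.
Proof.
move=> gO hO; have := iftD (-1) (HO_cI hO) (HO_cI gO).
by rewrite !scaleN1r addrC => ->; rewrite addrC.
Qed.

(** Completeness is inherited from L2 on the transform side, as [ift] multiplies norms by (2
    pi)^(-n/2). *)
Lemma hilbert_PW : hilbert (@inner R n) (PW A).
Proof.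
have [h0 hP hl hc hg hcompl] := hH.
have sT := @twopi_gt0 R n.
split.
- by apply: (@PW_ae (ift 0)); [exact: PW_ift HO_0|exact: L2_0|
    apply: aeW => x; rewrite /ift -[LHS]/(_ * fint 0 x) /fint;
    under eq_fun do rewrite mul0r; rewrite cint_real /Rintegral integral0 mulr0].
- move=> a f g /PWP[fL [f' fO ff]] /PWP[gL [g' gO gg]]; apply/PWP.
  split; first exact: L2_lin.
  exists (a *: f' + g'); first exact: HO_lin.
  rewrite (iftD a (HO_cI fO) (HO_cI gO)).
  by apply: filterS2 ff gg => x /= fx gx; rewrite !fctE fx gx.
- by move=> a f g h /PW_L2 ? /PW_L2 ? /PW_L2 ?; exact: hl.
- by move=> f g /PW_L2 ? /PW_L2 ?; exact: hc.
- by move=> f /PW_L2; exact: hg.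
move=> u uP uC; have uL k := PW_L2 (uP k).
have [f fL uf] := hcompl u uL uC.
have /choice[g gP] : forall k, exists g, HO g /\ {ae mu, forall x, u k x = ift g x}.
  by move=> k; have /PWP[_ [g gO ug]] := uP k; exists g.
have gO k := (gP k).1; have gL k := HO_L2 (gO k).
have iL k : L2 (ift (g k)) by exact: L2_ift (HO_cI (gO k)) (gL k).
have Nu k h : L2 h -> N (u k - h) = N (ift (g k) - h).
  move=> hL; rewrite /ip_norm; congr (Num.sqrt (complex.Re _)).
  have dae : {ae mu, forall x, (u k - h) x = (ift (g k) - h) x}.
    by apply: filterS (gP k).2 => x /= ux; rewrite !fctE ux.
  have d1 := hB hH (uL k) hL; have d2 := hB hH (iL k) hL.
  exact: (inner_ae dae dae d1 d2 d1 d2).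
have [|g0 g0L gg0] := hcompl g gL.
  move=> eps e0; have s0 : 0 < Num.sqrt twopi^-1 by rewrite sqrtr_gt0 invr_gt0.
  have [M MP] := uC _ (mulr_gt0 s0 e0); exists M => j k Mj Mk.
  have := MP j k Mj Mk; rewrite (Nu _ _ (uL k)) (ip_norm_distC hH (iL j) (uL k)) (Nu _ _ (iL j)).
  rewrite -(iftB (gO k) (gO j)) (N_ift (HO_B (gO k) (gO j))) ler_pM2l//.
  by rewrite (ip_norm_distC hH (gL k) (gL j)).
(* The L2 limit g0 need not vanish off [O]. Cutting it there does not increase its distances to the
   g k, which do vanish off [O]. *)
pose g1 := fun x => g0 x * cind O x; have g1O : HO g1 by exact: HO_cut.
have UL : L2 (ift g1) by exact: L2_ift (HO_cI g1O) (HO_L2 g1O).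
exists f => //; apply: (PW_ae (PW_ift g1O) fL).
suff : N (f - ift g1) = 0.
  move=> /(ipn_eq0 fL UL); by apply: filterS => x ->.
apply/eqP; rewrite eq_le ip_norm_ge0 andbT.
apply: (@le_cvg0 _ _ (fun k => N (u k - f) + Num.sqrt twopi^-1 * N (g k - g0))).
  move=> k; have := ip_normB_trans hH fL (uL k) UL.
  rewrite (ip_norm_distC hH fL (uL k)) (Nu _ _ UL) -(iftB (gO k) g1O) (N_ift (HO_B (gO k) g1O)).
  move=> h; apply: (le_trans h); rewrite lerD2l ler_wpM2l ?sqrtr_ge0//.
  have -> : g k - g1 = (fun x => (g k - g0) x * cind O x).
    apply/funext => x; rewrite !fctE mulrBl; congr (_ - _).
    have [Ox|Ox] := pselect (O x); first by rewrite /cind indicE mem_set// mulr1.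
    by rewrite (gO k).2// mul0r.
  by apply: N_cut_le; exact: (hB hH).
rewrite -[X in _ --> X]addr0 -[X in _ --> _ + X](mulr0 (Num.sqrt twopi^-1)).
by apply: cvgD => //; exact: cvgMr.
Qed.

Definition char_supp x : V -> R[i] := fun xi => cind O xi * expi (- dotv xi x).
Local Notation ek := char_supp.
Definition kdensity : R := twopi^-1 * fine (mu O).
Local Notation cc := kdensity.

Lemma kdensity_gt0 : 0 < cc.
Proof.
rewrite mulr_gt0 ?invr_gt0 ?twopi_gt0// fine_gt0// Ooo andbT.
have [b [bO b0 _]] := disjoint_boxes n_gt0 oO O0.
apply: (lt_le_trans (b0 0)); apply: le_measure; rewrite ?inE//.
exact: measurable_rbox.
Qed.

Lemma cmeas_expiN_dotv x : cmeas (fun xi : V => expi (- dotv xi x)).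
Proof. by under eq_fun do rewrite expiN; apply: cmeasJ; exact: cmeas_expi_dotv. Qed.

Lemma HO_ek x : HO (ek x).
Proof.
split; last by move=> y Oy; rewrite /ek /cind indicE memNset// mul0r.
apply/L2P; split; first by apply: cmeasM; [exact: cmeas_cind|exact: cmeas_expiN_dotv].
under eq_fun do rewrite normsqM normsq_expi mulr1 normsq_cind.
exact: rI_indic.
Qed.

Lemma ek_expi x y xi : ek x xi * expi (dotv xi y) = cind O xi * expi (dotv xi (y - x)).
Proof.
rewrite /ek -mulrA -expiD; congr (_ * expi _).
by rewrite [dotv xi (y - x)]dotvC dotvBl [dotv y _]dotvC [dotv x _]dotvC addrC.
Qed.

Lemma ift_ekE x y : ift (ek x) y = (twopi^-1)%:C * fint (cind O) (y - x).
Proof.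
rewrite -[LHS]/(_ * fint _ _); congr (_ * cint mu _).
by apply/funext => xi; exact: ek_expi.
Qed.

Lemma reproducing_kernelE x y : reproducing_kernel A y x = ift (ek x) y.
Proof.
rewrite ift_ekE /reproducing_kernel cintegralE; congr (_ * _).
apply: (@cint_null _ _ _ mu _ _ Z) => //.
  by apply: cmeasM; [exact: cmeas_cind|exact: cmeas_expi_dotv].
move=> xi Zxi; rewrite mulrC; congr (_ * _); rewrite /cind !indicE.
congr (_%:R%:C); congr nat_of_bool; apply/idP/idP; rewrite !inE; last exact: OA.
by move=> /AO[].
Qed.

Lemma fint_cind0 : fint (cind O) (0 : V) = (fine (mu O))%:C.
Proof.
rewrite /fint; under eq_fun do rewrite dotvC dotv0l expi0 mulr1.
by rewrite cint_real rint_indic.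
Qed.

Lemma normalized_kernelE x :
  normalized_kernel A x = ((Num.sqrt cc)^-1)%:C *: ift (ek x).
Proof.
apply/funext => y; rewrite /normalized_kernel !reproducing_kernelE.
rewrite [ift (ek x) x]ift_ekE subrr fint_cind0 -rmorphM mulrC.
by rewrite -[RHS]/(_ * _); congr (_ * _); rewrite -fmorphV.
Qed.

Local Notation k := (normalized_kernel A).

Lemma PW_kernel x : PW A (k x).
Proof.
by rewrite normalized_kernelE; apply: (hZ hilbert_PW); exact: PW_ift (HO_ek x).
Qed.

(** The reproducing property. As f is known only almost everywhere, its value at x is read from the
    representative [ift g]; the pairing is computed on the transform side by [inner_ift]. *)
Lemma inner_kernel f g x : PW A f -> HO g -> {ae mu, forall y, f y = ift g y} ->
  inner f (k x) = ((Num.sqrt cc)^-1)%:C * ift g x.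
Proof.
move=> fP gO fg; have fL := PW_L2 fP; have eO := HO_ek x.
have UgL := L2_ift n_gt0 (HO_cI gO) (HO_L2 gO).
have UeL := L2_ift n_gt0 (HO_cI eO) (HO_L2 eO).
rewrite normalized_kernelE (ipZr hH _ UeL fL) conjcR; congr (_ * _).
have eae : {ae mu, forall y, ift (ek x) y = ift (ek x) y} by exact: aeW.
rewrite (inner_ae fg eae fL UgL UeL UeL).
rewrite (inner_ift n_gt0 (HO_cI gO) (HO_L2 gO) (HO_cI eO) (HO_L2 eO)).
rewrite -[RHS]/(_ * fint _ _); congr (_ * _); rewrite innerE.
congr (cint mu _); apply/funext => xi; rewrite /ek rmorphM /= expiN conjCK /cind conjcR.
have [Ox|Ox] := pselect (O xi); first by rewrite indicE mem_set// mul1r.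
by rewrite gO.2// !mul0r.
Qed.

Lemma cmeas_inner_kernel f : PW A f -> cmeas (fun x => inner f (k x)).
Proof.
move=> fP; have /PWP[fL [g gO fg]] := fP.
under eq_fun do rewrite (inner_kernel _ fP gO fg).
apply: cmeasM; first exact: cmeas_cst.
by have := L2_meas (L2_ift n_gt0 (HO_cI gO) (HO_L2 gO)).
Qed.

(** Resolution of the identity by the kernels: |<f, k_x>|^2 is the squared value of f at x divided
    by the density. *)
Lemma rint_inner_kernel f : PW A f ->
  rI (fun x => normsq (inner f (k x))) /\
  cc * \int[mu]_x normsq (inner f (k x)) = complex.Re (inner f f).
Proof.
move=> fP; have /PWP[fL [g gO fg]] := fP.
have UL := L2_ift n_gt0 (HO_cI gO) (HO_L2 gO).
have E x : normsq (inner f (k x)) = cc^-1 * normsq (ift g x).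
  rewrite (inner_kernel _ fP gO fg) normsqM normsq_real exprVn sqr_sqrtr//.
  exact: ltW kdensity_gt0.
have I := L2_normsq UL.
split; first by under eq_fun do rewrite E; exact: rIZ.
under eq_Rintegral do rewrite E.
rewrite RintegralZl// mulrA divff ?gt_eqF ?kdensity_gt0// mul1r.
by rewrite (inner_ae fg fg fL UL fL UL) inner_self.
Qed.

Lemma inner_kernels x y : inner (k y) (k x) = (twopi^-1 / cc)%:C * fint (cind O) (x - y).
Proof.
have eP := PW_ift (HO_ek y); have eL := PW_L2 eP.
rewrite [X in inner X _]normalized_kernelE (ipZl hH _ eL (PW_L2 (PW_kernel x))).
rewrite (inner_kernel x eP (HO_ek y) (aeW _ (fun=> erefl))) ift_ekE mulrA mulrA.
congr (_ * _); rewrite -!rmorphM; congr (_%:C).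
by rewrite -invfM -expr2 sqr_sqrtr ?(ltW kdensity_gt0)// mulrC.
Qed.

Lemma kernel_unit x : inner (k x) (k x) = 1.
Proof.
rewrite inner_kernels subrr fint_cind0 -rmorphM -[RHS]/((1 : R)%:C); congr (_%:C).
rewrite mulrAC -/cc divff// gt_eqF// kdensity_gt0//.
Qed.

Let box_of i : V -> R[i] :=
  if @unpickle ('rV[rat]_n * 'rV[rat]_n)%type i is Some b then cind (rbox b `&` O) else 0.

Lemma HO_cind b : HO (cind (rbox b `&` O)).
Proof.
split; last by move=> x Ox; rewrite /cind indicE memNset// => -[].
have mb : measurable (rbox b `&` O) by apply: measurableI => //; exact: measurable_rbox.
apply: L2_cind => //; apply: (le_lt_trans _ Ooo).
by apply: le_measure; rewrite ?inE//; exact: subIsetr.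
Qed.

(** Gram-Schmidt is applied to the inverse transforms of boxes cut to [O]. A transform orthogonal to
    these cut boxes is orthogonal to all boxes, hence null; disjoint boxes inside [O] give the
    infinite orthogonal family. *)
Lemma PW_basis : exists e, orthonormal_basis (@inner R n) (PW A) e.
Proof.
have hO i : HO (box_of i).
  by rewrite /box_of; case: unpickle => [b|]; [exact: HO_cind|exact: HO_0].
have innE b f : HO f -> inner f (cind (rbox b `&` O)) = inner f (cind (rbox b)).
  move=> fO; rewrite !innerE; congr (cint mu _); apply/funext => x.
  rewrite !mulJ_cind /cind indicI; have [Ox|Ox] := pselect (O x).
    by rewrite -[(_ \* _) x]/(_ x * \1_O x) [\1_O x]indicE mem_set// mulr1.
  by rewrite fO.2// !mul0r.
have htot g : HO g -> (forall i, inner g (box_of i) = 0) -> {ae mu, forall x, g x = 0}.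
  move=> gO g0; apply: boxes_total; first exact: HO_L2.
  by move=> b; rewrite -innE// -(g0 (pickle b)) /box_of pickleK.
have [b [bO bpos bdisj]] := disjoint_boxes n_gt0 oO O0.
pose u j := pickle (b j).
have uE j : box_of (u j) = cind (rbox (b j)).
  by rewrite /box_of pickleK (setIidl (bO j)).
move: box_of u hO htot uE => d u hO htot uE.
have twopi0 := @twopi_gt0 R n.
have inE2 f g : HO f -> HO g -> inner (ift f) (ift g) = (twopi^-1)%:C * inner f g.
  by move=> fO gO; apply: inner_ift => //; [exact: HO_cI|exact: HO_L2|exact: HO_cI|exact: HO_L2].
exists (gs_basis (@inner R n) (fun i => ift (d i))).
apply: (@gram_schmidt_basis R (V -> R[i]) (@inner R n) (PW A) hilbert_PW
   (fun i => ift (d i)) (fun i => PW_ift (hO i)) _ u).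
- move=> f fP f0; have /PWP[fL [g gO fg]] := fP.
  have UL := PW_L2 (PW_ift gO).
  have g0 : {ae mu, forall x, g x = 0}.
    apply: (htot _ gO) => i; have := f0 i; have dL := PW_L2 (PW_ift (hO i)).
    rewrite (inner_ae fg (aeW _ (fun=> erefl)) fL UL dL dL) inE2// => /eqP.
    rewrite mulf_eq0 => /orP[|/eqP//]; rewrite -[X in _ == X]/((0 : R)%:C) => /eqP/complexI/eqP.
    by rewrite invr_eq0 gt_eqF.
  rewrite (inner_ae fg fg fL UL fL UL) inE2//.
  have gL := HO_L2 gO; have L0 : L2 (0 : V -> R[i]) by exact: L2_0.
  by rewrite (inner_ae g0 g0 gL L0 gL L0) (ip0l hH)// mulr0.
- move=> i j ij; rewrite inE2// !uE (inner_cind (measurable_rbox (b i)) (measurable_rbox (b j))).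
  by rewrite (bdisj _ _ ij) measure0 mulr0.
- move=> i; rewrite inE2// !uE (inner_cind (measurable_rbox (b i)) (measurable_rbox (b i))).
  rewrite setIid -rmorphM /= mulr_gt0 ?invr_gt0// fine_gt0// bpos rbox_lty//.
Qed.

End paley_wiener.

Section dilated_kernel.
Context {R : realType} {n : nat}.
Local Notation V := 'rV[R]_n.
Local Notation mu := (@lebesgue_rV R n).

Lemma fint_dilation (a : R) (O : set V) z : 0 < a -> measurable O -> (mu O < +oo)%E ->
  fint (cind (dilation a O)) z = (a ^+ n)%:C * fint (cind O) (a *: z).
Proof.
move=> a0 mO Ooo; have mD := measurable_dilation a0 mO.
have Doo : (mu (dilation a O) < +oo)%E.
  by rewrite lebesgue_dilation// lte_mul_pinfty// ?lee_fin ?exprn_ge0// ltW.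
have DI : cI mu (cind (dilation a O)) by apply: cI_real; exact: rI_indic.
rewrite /fint -(cint_affine 0 a0 (cI_fint z DI)); congr (_ * cint mu _).
apply/funext => xi; congr (_ * expi _); last first.
  by rewrite add0r dotvZl dotvC -dotvZl dotvC.
rewrite /cind !indicE dilationE//; congr (_%:R%:C); congr nat_of_bool.
apply/idP/idP; rewrite !inE /= !add0r scalerA mulVf ?scale1r//; exact: lt0r_neq0.
Qed.

End dilated_kernel.

(** * Trace formula for Toeplitz operators *)

Lemma cmeas_cvg d (T : measurableType d) (R : realType) (f_ : nat -> T -> R[i]) f :
  (forall k, cmeas (f_ k)) ->
  (forall x, Normc.normc (f_ k x - f x) @[k --> \oo] --> (0 : R)) -> cmeas f.
Proof.
move=> mf fc.
have cvR x : complex.Re (f_ k x) @[k --> \oo] --> complex.Re (f x).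
  apply/cvgrPdist_le => /= e e0; have /cvgr0Pnorm_le/(_ e e0) := fc x.
  apply: filterS => k; rewrite ger0_norm ?normc_ge0// => h.
  by rewrite distrC -cReN -cReD; apply: le_trans (ler_normc_Re _) h.
have cvI x : complex.Im (f_ k x) @[k --> \oo] --> complex.Im (f x).
  apply/cvgrPdist_le => /= e e0; have /cvgr0Pnorm_le/(_ e e0) := fc x.
  apply: filterS => k; rewrite ger0_norm ?normc_ge0// => h.
  by rewrite distrC -cImN -cImD; apply: le_trans (ler_normc_Im _) h.
split.
  by apply: (measurable_fun_cvg (h := fun k x => complex.Re (f_ k x))) => [k|x _];
    [exact: (mf k).1|exact: cvR].
by apply: (measurable_fun_cvg (h := fun k x => complex.Im (f_ k x))) => [k|x _];
  [exact: (mf k).2|exact: cvI].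
Qed.

Lemma normc_cint_le d (T : measurableType d) (R : realType) (m : {measure set T -> \bar R})
    (f : T -> R[i]) (g : T -> R) : cI m f -> m.-integrable setT (EFin \o g) ->
  (forall x, Normc.normc (f x) <= g x) -> Normc.normc (cint m f) <= 2 * \int[m]_x g x.
Proof.
move=> [f1 f2] gI fg; apply: (le_trans (ler_normc_ReIm _)); rewrite mulr_natl mulr2n.
apply: lerD; apply: (le_trans (le_normr_Rintegral measurableT _)) => //.
  by apply: le_Rintegral => // [|x _]; [exact: rI_norm|exact: le_trans (ler_normc_Re _) (fg x)].
by apply: le_Rintegral => // [|x _]; [exact: rI_norm|exact: le_trans (ler_normc_Im _) (fg x)].
Qed.

(* [k x] are the normalized kernels of a reproducing kernel Hilbert space whose
   reproducing kernel is constantly [c] on the diagonal. *)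
Section toeplitz_trace.
Context {R : realType} {V : lmodType R[i]} (ip : V -> V -> R[i]) (H : set V).
Hypothesis hH : hilbert ip H.
Context d (X : measurableType d) (m : {measure set X -> \bar R}).
Local Notation rI f := (m.-integrable setT (EFin \o f)).
Local Notation N := (ip_norm ip).
Local Notation nsq f := (complex.Re (ip f f)).
Variables (k : X -> V) (c : R) (sigma : X -> R).
Hypotheses (kH : forall x, H (k x)) (k1 : forall x, ip (k x) (k x) = 1)
  (kmeas : forall f, H f -> cmeas (fun x => ip f (k x)))
  (kint : forall f, H f -> rI (fun x => normsq (ip f (k x))) /\
     c * \int[m]_x normsq (ip f (k x)) = nsq f)
  (c_gt0 : 0 < c) (s_ge0 : forall x, 0 <= sigma x) (sI : rI sigma).
Variable e : nat -> V.
Hypothesis eB : orthonormal_basis ip H e.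

Definition toeplitz_form f g x := (sigma x)%:C * ip f (k x) * ip (k x) g * c%:C.

Let Nk x : N (k x) = 1.
Proof. by rewrite /ip_norm k1 sqrtr1. Qed.

Let kmeas' f : H f -> cmeas (fun x => ip (k x) f).
Proof.
move=> fH; have := cmeasJ (kmeas fH); congr cmeas; apply/funext => x.
by rewrite -(ip_conj hH fH (kH x)).
Qed.

Let Fle f g x : H f -> H g ->
  Normc.normc (toeplitz_form f g x) <= N f * N g * c * sigma x.
Proof.
move=> fH gH; rewrite /toeplitz_form !Normc.normcM !normc_real !ger0_norm ?(ltW c_gt0)//.
have h1 := cauchy_schwarz hH fH (kH x); have h2 := cauchy_schwarz hH (kH x) gH.
rewrite Nk mulr1 in h1; rewrite Nk mul1r in h2.
have := ler_pM (normc_ge0 _) (normc_ge0 _) h1 h2.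
move: (s_ge0 x) (ltW c_gt0) (Normc.normc _) (Normc.normc _) (N f * N g) => s0 c0 a b B ab.
have -> : sigma x * b * a * c = b * a * (c * sigma x) by ring.
by rewrite -[leRHS]mulrA ler_wpM2r// mulr_ge0.
Qed.

Let FI f g : H f -> H g -> cI m (toeplitz_form f g).
Proof.
move=> fH gH; apply: (cI_le (g := fun x => N f * N g * c * sigma x)).
- apply: cmeasM; last exact: cmeas_cst.
  by apply: cmeasM; [apply: cmeasM; [exact: cmeas_real (rI_meas sI)|exact: kmeas]|exact: kmeas'].
- by move=> x; exact: Fle.
- exact: rIZ.
Qed.

Let eH j : H (e j). Proof. by case: eB. Qed.
Let eo : orthonormal ip H e. Proof. by case: eB. Qed.
Let ecvg f : H f -> N (f - onproj ip e n f) @[n --> \oo] --> (0 : R).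
Proof. by case: eB => _ _; exact. Qed.

(** A crude bound from |<f, k_x>| <= |f|, where the 2 comes from splitting a complex integral. Only
    its finiteness for each alpha matters. *)
Definition toeplitz_norm : R := 2 * (c * \int[m]_x sigma x).

Let int_s_ge0 : 0 <= \int[m]_x sigma x.
Proof. by apply: Rintegral_ge0 => x _. Qed.

Lemma toeplitz_norm_ge0 : 0 <= toeplitz_norm.
Proof. by rewrite mulr_ge0// mulr_ge0// ltW. Qed.

Let normc_form f g : H f -> H g ->
  Normc.normc (cint m (toeplitz_form f g)) <= toeplitz_norm * N f * N g.
Proof.
move=> fH gH; have I := rIZ (N f * N g * c) sI.
apply: (le_trans (normc_cint_le (FI fH gH) I (fun x => Fle x fH gH))).
rewrite RintegralZl// /toeplitz_norm le_eqVlt; apply/orP; left; apply/eqP; ring.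
Qed.

Lemma toeplitz_exists f : H f ->
  exists2 h, H h & forall g, H g -> ip h g = cint m (toeplitz_form f g).
Proof.
move=> fH; apply: (riesz hH eo ecvg (C := toeplitz_norm * N f)).
- by rewrite mulr_ge0 ?toeplitz_norm_ge0 ?ip_norm_ge0.
- move=> a g h gH hH'; rewrite -cintZ; last exact: FI.
  rewrite -cintD; [|by apply: cIZ; exact: FI|exact: FI].
  congr (cint m _); apply/funext => x; rewrite /toeplitz_form.
  by rewrite (ipDr hH (hZ hH _ gH) hH' (kH x)) (ipZr hH _ gH (kH x)); ring.
- by move=> g gH; exact: normc_form.
Qed.

Variable T : V -> V.
Hypothesis TP : forall f, H f -> H (T f) /\
  forall g, H g -> ip (T f) g = cint m (toeplitz_form f g).

Let TH f : H f -> H (T f). Proof. by move=> /TP[]. Qed.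

Lemma toeplitz_sym f g : H f -> H g -> ip (T f) g = ip f (T g).
Proof.
move=> fH gH; rewrite (ip_conj hH (TH gH) fH) (TP fH).2// (TP gH).2//.
rewrite -cintJ; last exact: FI.
congr (cint m _); apply/funext => x; rewrite /toeplitz_form !rmorphM/=.
by rewrite (conjcR (sigma x)) (conjcR c) -(ip_conj hH gH (kH x)) -(ip_conj hH (kH x) fH); ring.
Qed.

Lemma toeplitz_form_self f x : H f ->
  toeplitz_form f f x = (c * sigma x * normsq (ip f (k x)))%:C.
Proof.
move=> fH; rewrite /toeplitz_form (ip_conj hH fH (kH x)) -[_ * ip f (k x) * _]mulrA mulcJ.
by rewrite -!rmorphM; congr (_%:C); ring.
Qed.

Lemma toeplitz_ge0 f : H f -> 0 <= complex.Re (ip (T f) f).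
Proof.
move=> fH; rewrite (TP fH).2//.
rewrite (_ : toeplitz_form f f = fun x => (c * sigma x * normsq (ip f (k x)))%:C); last first.
  by apply/funext => x; exact: toeplitz_form_self.
rewrite cint_real /=; apply: Rintegral_ge0 => x _.
by rewrite mulr_ge0 ?normsq_ge0// mulr_ge0 ?(ltW c_gt0).
Qed.

Lemma toeplitz_bound : op_bound ip H T toeplitz_norm.
Proof.
move=> f fH; have TfH := TH fH; split=> //.
have [->|N0] := eqVneq (N (T f)) 0.
  by rewrite mulr_ge0 ?toeplitz_norm_ge0 ?ip_norm_ge0.
have Npos : 0 < N (T f) by rewrite lt_neqAle eq_sym N0 ip_norm_ge0.
rewrite -(ler_pM2r Npos) -expr2 (sqr_ip_norm hH TfH).
apply: le_trans (normc_form fH TfH); rewrite -(TP fH).2//.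
exact: le_trans (ler_norm _) (ler_normc_Re _).
Qed.

Section trace_formula.
Variables (Q : V -> V) (B : R).
Hypotheses (QH : forall f, H f -> H (Q f))
  (Qsym : forall f g, H f -> H g -> ip (Q f) g = ip f (Q g))
  (QB : forall f, H f -> N (Q f) <= B * N f).

Definition berezin x : R := complex.Re (ip (Q (k x)) (k x)).

Let berezinE x : ip (k x) (Q (k x)) = (berezin x)%:C.
Proof.
have QkH := QH (kH x).
have E : ip (k x) (Q (k x)) = ((ip (k x) (Q (k x)))^*)%R.
  by rewrite -(ip_conj hH (kH x) QkH) Qsym.
apply: complex_eqP; first by rewrite -Qsym.
by have := congr1 (@complex.Im R) E; rewrite cImJ /=; lra.
Qed.

Lemma berezin_le x : `|berezin x| <= B.
Proof.
rewrite -normc_real -berezinE; apply: le_trans (cauchy_schwarz hH (kH x) (QH (kH x))) _.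
by rewrite Nk mul1r; have := QB (kH x); rewrite Nk mulr1.
Qed.

Let partial n x : R[i] := \sum_(j < n) ip (k x) (e j) * ip (e j) (Q (k x)).

Let partial_cvg x : Normc.normc (partial n x - (berezin x)%:C) @[n --> \oo] --> (0 : R).
Proof. by rewrite -berezinE; exact: (parseval hH eo ecvg (kH x) (QH (kH x))). Qed.

Let partial_meas n : cmeas (partial n).
Proof.
apply: (cmeas_sum (F := fun j x => ip (k x) (e j) * ip (e j) (Q (k x)))) => j _.
apply: cmeasM; first exact: kmeas'.
by under eq_fun do rewrite -(Qsym (eH j) (kH _)); apply: kmeas; exact: QH.
Qed.

Let berezin_cmeas : cmeas (fun x => (berezin x)%:C).
Proof. exact: (cmeas_cvg partial_meas partial_cvg). Qed.

Lemma measurable_berezin : measurable_fun setT berezin.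
Proof. exact: berezin_cmeas.1. Qed.

Lemma rI_berezin : rI (fun x => sigma x * berezin x).
Proof.
apply: rI_le _ _ (rIZ B sI).
  by apply: measurable_funM; [exact: rI_meas sI|exact: measurable_berezin].
by move=> x; rewrite normrM ger0_norm// mulrC ler_wpM2r// berezin_le.
Qed.

(** The weak definition at Q e_j, summed over j < n, produces partial sums of Parseval's series for
    <k_x, Q k_x>, which are bounded by |k_x| |Q k_x| <= B. So a multiple of sigma dominates and the
    limit passes under the integral. *)
Lemma toeplitz_trace :
  Normc.normc (\sum_(j < n) ip (T (Q (e j))) (e j) -
    (c * \int[m]_x (sigma x * berezin x))%:C) @[n --> \oo] --> (0 : R).
Proof.
have [|||||_] := @cdct _ _ _ m (fun n x => (sigma x * c)%:C * partial n x)
  (fun x => (c * (sigma x * berezin x))%:C) (fun x => (B * c) * sigma x).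
- by move=> n; apply: cmeasM => //; apply: cmeas_real; apply: measurable_funM => //; exact: rI_meas sI.
- by apply: cmeas_real; exact: rI_meas (rIZ c rI_berezin).
- apply: aeW => x.
  have E n : Normc.normc ((sigma x * c)%:C * partial n x - (c * (sigma x * berezin x))%:C) =
      sigma x * c * Normc.normc (partial n x - (berezin x)%:C).
    have -> : (c * (sigma x * berezin x))%:C = (sigma x * c)%:C * (berezin x)%:C.
      by rewrite -rmorphM mulrA [c * _]mulrC.
    rewrite -mulrBr Normc.normcM normc_real ger0_norm//.
    by rewrite mulr_ge0// ltW.
  have cv : sigma x * c * Normc.normc (partial n x - (berezin x)%:C) @[n --> \oo] --> (0 : R).
    by rewrite -[X in _ --> X](mulr0 (sigma x * c)); exact: cvgMr.
  by apply: cvg_trans cv; apply: near_eq_cvg; apply: nearW => n; rewrite E.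
- move=> n x; rewrite Normc.normcM normc_real ger0_norm ?mulr_ge0 ?(ltW c_gt0)//.
  have pB : Normc.normc (partial n x) <= B.
    apply: le_trans (parseval_partial_le hH eo n (kH x) (QH (kH x))) _.
    by rewrite Nk mul1r; have := QB (kH x); rewrite Nk mulr1.
  by rewrite mulrC [sigma x * c]mulrC mulrA ler_wpM2r// ler_wpM2r// ltW.
- exact: rIZ.
have -> : (c * \int[m]_x (sigma x * berezin x))%:C = cint m (fun x => (c * (sigma x * berezin x))%:C).
  by rewrite cint_real RintegralZl//; exact: rI_berezin.
have E n : \sum_(j < n) ip (T (Q (e j))) (e j) = cint m (fun x => (sigma x * c)%:C * partial n x).
  transitivity (\sum_(j < n) cint m (toeplitz_form (Q (e j)) (e j))).
    by apply: eq_bigr => j _; rewrite (TP (QH (eH j))).2.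
  rewrite -(cint_sum (F := fun j => toeplitz_form (Q (e j)) (e j))).
  2: by move=> j _; apply: FI => //; exact: QH.
  congr (cint m _); apply/funext => x; rewrite /partial big_distrr; apply: eq_bigr => j _ /=.
  by rewrite /toeplitz_form (Qsym (eH j) (kH x)) rmorphM; ring.
by apply: cvg_trans; apply: near_eq_cvg; apply: nearW => n; rewrite E.
Qed.

End trace_formula.

Let Tbez := berezin T.

(** Expand |T k_x|^2 in the basis; by symmetry its coefficients have the moduli |<T e_j, k_x>|.
    Integrating, c times each squared modulus gives |T e_j|^2 = <T T e_j, e_j>, and these sum up to
    the trace formula with Q = T. Monotone convergence exchanges sum and integral. *)
Lemma rint_nsq_toeplitz : rI (fun x => nsq (T (k x))) /\
  \int[m]_x nsq (T (k x)) = \int[m]_x (sigma x * Tbez x).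
Proof.
have tr := toeplitz_trace TH toeplitz_sym (fun f fH => (toeplitz_bound fH).2).
pose f_ n x := \sum_(j < n) normsq (ip (T (e j)) (k x)).
have f_I n : rI (f_ n).
  apply: (rI_sum (F := fun j x => normsq (ip (T (e j)) (k x)))) => j _.
   exact: (kint (TH (eH j))).1.
have Tsw x j : normsq (ip (T (e j)) (k x)) = normsq (ip (T (k x)) (e j)).
  by rewrite (toeplitz_sym (eH j) (kH x)) (ip_conj hH (TH (kH x)) (eH j)) normsqJ.
have f_E n : \int[m]_x f_ n x = c^-1 * complex.Re (\sum_(j < n) ip (T (T (e j))) (e j)).
  rewrite (rint_sum (F := fun j x => normsq (ip (T (e j)) (k x)))); last by move=> j _; exact: (kint (TH (eH j))).1.
  rewrite Re_sum big_distrr; apply: eq_bigr => j _ /=.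
  rewrite (toeplitz_sym (TH (eH j)) (eH j)) -(kint (TH (eH j))).2 mulrA mulVf ?mul1r//.
  exact: lt0r_neq0.
have [||||I E] := @rmct _ _ _ m f_ (fun x => nsq (T (k x))) (\int[m]_x (sigma x * Tbez x)) f_I.
- by move=> n x; apply: sumr_ge0 => j _; exact: normsq_ge0.
- move=> x; apply/nondecreasing_seqP => n; rewrite /f_ big_ord_recr lerDl; exact: normsq_ge0.
- move=> x; have TkH := TH (kH x); have := parseval hH eo ecvg TkH TkH => pc.
  apply/cvgrPdist_le => /= eps eps0; move/cvgr0Pnorm_le : pc => /(_ eps eps0).
  apply: filterS => n; rewrite ger0_norm ?normc_ge0// => h; rewrite distrC.
  have -> : f_ n x - nsq (T (k x)) =
      complex.Re (\sum_(j < n) ip (T (k x)) (e j) * ip (e j) (T (k x)) - ip (T (k x)) (T (k x))).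
    rewrite cReD cReN Re_sum; congr (_ - _); apply: eq_bigr => j _.
    by rewrite Tsw (ip_conj hH TkH (eH j)) mulcJ.
  exact: le_trans (ler_normc_Re _) h.
- rewrite (_ : (fun n => _) = fun n => c^-1 * complex.Re (\sum_(j < n) ip (T (T (e j))) (e j))).
    rewrite -[X in _ --> X](mulKf (lt0r_neq0 c_gt0)); apply: cvgMr.
  2: by apply/funext => n; exact: f_E.
  apply/cvgrPdist_le => /= eps eps0; move/cvgr0Pnorm_le : tr => /(_ eps eps0).
  apply: filterS => n; rewrite ger0_norm ?normc_ge0// => h; rewrite distrC.
  by apply: le_trans h; apply: le_trans (ler_normc_Re _); rewrite cReD cReN.
by split.
Qed.

Hypothesis s2I : rI (fun x => sigma x ^+ 2).

Let dev x := nsq (T (k x) - (sigma x)%:C *: k x).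

Let devE x : dev x = nsq (T (k x)) - 2 * (sigma x * Tbez x) + sigma x ^+ 2.
Proof.
have TkH := TH (kH x); rewrite /dev (nsqB hH TkH (hZ hH _ (kH x))).
rewrite (ipZr hH _ (kH x) TkH) conjcR cReM mul0r subr0 (nsqZ hH _ (kH x)) normsq_real k1.
by rewrite mulr1.
Qed.

Let TbI : rI (fun x => sigma x * Tbez x).
Proof. exact: (rI_berezin TH toeplitz_sym (fun f fH => (toeplitz_bound fH).2)). Qed.

(** In the expanded square the cross term contributes -2 times, and |T k_x|^2 once, the integral of
    sigma(x) <T k_x, k_x>. *)
Lemma rint_deviation : rI dev /\
  \int[m]_x dev x = \int[m]_x sigma x ^+ 2 - \int[m]_x (sigma x * Tbez x).
Proof.
have [I E] := rint_nsq_toeplitz.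
have J : rI (fun x => nsq (T (k x)) - 2 * (sigma x * Tbez x)).
  by apply: rIB => //; exact: rIZ.
have -> : dev = fun x => nsq (T (k x)) - 2 * (sigma x * Tbez x) + sigma x ^+ 2.
  by apply/funext => x; exact: devE.
split; first exact: rID.
rewrite RintegralD// RintegralB//; last exact: rIZ.
by rewrite RintegralZl// E; ring.
Qed.

Section functional_calculus.
Variables phi psi : R -> R.
Hypotheses (psiE : forall t, 0 <= t -> psi t = t * phi t)
  (phi_mod : forall eps : R, 0 < eps -> exists2 C : R, 0 <= C &
     forall s t : R, 0 <= s -> 0 <= t -> `|phi s - phi t| <= eps + C * `|s - t|)
  (psim : measurable_fun setT (fun x => psi (sigma x))).

(** The 1 keeps M positive, as [bern_weierstrass] requires, even when sigma vanishes almost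
    everywhere. *)
Let M : R := toeplitz_norm + 1.
Let M_gt0 : 0 < M. Proof. by rewrite ltr_wpDl// toeplitz_norm_ge0. Qed.
Let TM : op_bound ip H T M.
Proof.
move=> f fH; have [h1 h2] := toeplitz_bound fH; split=> //.
by apply: (le_trans h2); rewrite ler_wpM2r ?ip_norm_ge0// lerDl.
Qed.

Let phi_approx (eps : R) : 0 < eps ->
  exists p : {poly R}, forall t : R, 0 <= t <= M -> `|p.[t] - phi t| <= eps.
Proof.
apply: bern_weierstrass => // eta eta0.
have eta2 : 0 < eta / 2 by rewrite divr_gt0.
(* Completing the square, C a <= eta / 2 + C^2 a^2 / (2 eta) makes the linear modulus quadratic. *)
have [C C0 CP] := phi_mod eta2; exists (C ^+ 2 / (2 * eta)).
  by rewrite divr_ge0 ?sqr_ge0// mulr_ge0// ltW.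
move=> s t /andP[s0 _] /andP[t0 _]; apply: (le_trans (CP s t s0 t0)).
rewrite -[X in _ * X ^+ 2]/(s - t) -(real_normK (num_real (s - t))).
move: `|s - t| => a; rewrite -subr_ge0.
have -> : eta + C ^+ 2 / (2 * eta) * a ^+ 2 - (eta / 2 + C * a) =
    (eta - C * a) ^+ 2 / (2 * eta) by field; rewrite gt_eqF.
by rewrite divr_ge0 ?sqr_ge0// mulr_ge0// ltW.
Qed.

Let phi_bounded : exists2 B : R, 0 <= B & forall t : R, 0 <= t <= M -> `|phi t| <= B.
Proof.
have [C C0 CP] := phi_mod ltr01; exists (`|phi 0| + (1 + C * M)).
  by rewrite addr_ge0// addr_ge0// mulr_ge0// ltW.
move=> t /andP[t0 tM]; have h := CP t 0 t0 (lexx 0).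
rewrite subr0 (ger0_norm t0) in h; have := ler_normD (phi t - phi 0) (phi 0).
rewrite subrK => h2; apply: (le_trans h2); rewrite addrC lerD2l; apply: (le_trans h).
by rewrite lerD2l ler_wpM2l.
Qed.

Lemma toeplitz_op_limit_exists : exists Q, op_limit ip H T M phi Q.
Proof. exact: (op_limit_exists hH TH toeplitz_sym toeplitz_ge0 (ltW M_gt0) TM phi_approx). Qed.

Variable Q : V -> V.
Hypothesis QP : op_limit ip H T M phi Q.

Let QH f (fH : H f) : H (Q f) := (QP fH).1.
Let Qsym f g (fH : H f) (gH : H g) : ip (Q f) g = ip f (Q g) :=
  op_limit_sym hH TH toeplitz_sym phi_approx QP fH gH.
Let Qbounded : exists B : R, forall f, H f -> N (Q f) <= B * N f.
Proof.
have [B B0 phiB] := phi_bounded; exists B => f fH.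
exact: (op_limit_norm_le hH TH toeplitz_sym toeplitz_ge0 (ltW M_gt0) TM phi_approx QP fH phiB).
Qed.

Lemma fcalc_trace_cvg :
  Normc.normc (\sum_(j < n) ip (fcalc ip H psi T (e j)) (e j) -
    (c * \int[m]_x (sigma x * berezin Q x))%:C) @[n --> \oo] --> (0 : R).
Proof.
have [B QB] := Qbounded.
have psiE' t : 0 <= t <= M -> psi t = t * phi t by move=> /andP[t0 _]; exact: psiE.
have := toeplitz_trace QH Qsym QB; apply: cvg_trans; apply: near_eq_cvg; apply: nearW => n.
congr (Normc.normc (_ - _)); apply: eq_bigr => j _.
have [SH S0] := fcalcE hH TH toeplitz_sym toeplitz_ge0 (ltW M_gt0) TM phi_approx QP psiE' (eH j).
have TQH := TH (QH (eH j)).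
have := ip_norm0_ip hH (hB hH SH TQH) (eH j) S0; rewrite (ipBl hH SH TQH (eH j)) => /eqP.
by rewrite subr_eq0 => /eqP.
Qed.

(* For [sigma x > 0], the modulus of [phi] is turned into a quadratic one by
   [|t - s| <= (delta + (t - s)^2 / delta) / 2] with [delta = tau * sigma x]. *)
Lemma berezin_estimate (eps C tau : R) : 0 <= C -> 0 < tau ->
  (forall s t : R, 0 <= s -> 0 <= t -> `|phi s - phi t| <= eps + C * `|s - t|) ->
  `|\int[m]_x (sigma x * berezin Q x) - \int[m]_x psi (sigma x)| <=
   eps * \int[m]_x sigma x +
   C / 2 * (tau * \int[m]_x sigma x ^+ 2 + (\int[m]_x dev x) / tau).
Proof.
move=> C0 tau0 modP; have [B QB] := Qbounded.
have bI := rI_berezin QH Qsym QB.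
have [dI _] := rint_deviation.
have psiI : rI (fun x => psi (sigma x)).
  (* Compared with its value at 0, phi grows at most linearly, so psi(sigma) is dominated by a
     combination of sigma and sigma^2. *)
  have [C1 C10 C1P] := phi_mod ltr01.
  apply: rI_le psim _ (rID (rIZ (1 + `|phi 0|) sI) (rIZ C1 s2I)) => x.
  rewrite psiE// normrM (ger0_norm (s_ge0 x)).
  have := C1P (sigma x) 0 (s_ge0 x) (lexx 0); rewrite subr0 (ger0_norm (s_ge0 x)).
  have := ler_normD (phi (sigma x) - phi 0) (phi 0); rewrite subrK => h1 h2.
  have : sigma x * `|phi (sigma x)| <= sigma x * (1 + `|phi 0| + C1 * sigma x).
    by rewrite ler_wpM2l//; lra.
  by move=> h; apply: (le_trans h); rewrite le_eqVlt; apply/orP; left; apply/eqP; ring.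
rewrite -RintegralB//; apply: (le_trans (le_normr_Rintegral measurableT _)); first exact: rIB.
pose G x := eps * sigma x + (C / 2) * (tau * sigma x ^+ 2 + tau^-1 * dev x).
have GI : rI G.
  by apply: rID; [exact: rIZ|apply: rIZ; apply: rID; exact: rIZ].
have <- : \int[m]_x G x = eps * \int[m]_x sigma x +
     C / 2 * (tau * \int[m]_x sigma x ^+ 2 + (\int[m]_x dev x) / tau).
  rewrite /G RintegralD//; [|exact: rIZ|by apply: rIZ; apply: rID; exact: rIZ].
  rewrite RintegralZl// RintegralZl//; last by apply: rID; exact: rIZ.
  rewrite RintegralD//; [|exact: rIZ|exact: rIZ].
  by rewrite !RintegralZl// [tau^-1 * _]mulrC.
apply: le_Rintegral => //; first by apply: rI_norm; exact: rIB.
move=> x _; rewrite psiE// -mulrBr normrM (ger0_norm (s_ge0 x)) /G.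
have dev0 : 0 <= dev x by exact: (ip_ge0 hH (hB hH (TH (kH x)) (hZ hH _ (kH x)))).
(* Where sigma x = 0 the left-hand side is 0; elsewhere division by sigma x is allowed. *)
have := s_ge0 x; rewrite le_eqVlt => /orP[/eqP s0|s0].
  rewrite -s0 mul0r mulr0 add0r expr0n/= mulr0 add0r mulr_ge0 ?divr_ge0//.
  by rewrite mulr_ge0// invr_ge0 ltW.
have q t : 0 <= t <= M -> `|phi t - phi (sigma x)| <=
    (eps + C / 2 * (tau * sigma x)) + C / (2 * (tau * sigma x)) * (t - sigma x) ^+ 2.
  move=> /andP[t0 _]; apply: (le_trans (modP t (sigma x) t0 (s_ge0 x))).
  rewrite -addrA lerD2l -(real_normK (num_real (t - sigma x))).
  have ds0 : 0 < tau * sigma x by rewrite mulr_gt0.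
  move: `|t - sigma x| (tau * sigma x) ds0 => a ds ds0; rewrite -subr_ge0.
  have -> : C / 2 * ds + C / (2 * ds) * a ^+ 2 - C * a = C * ((ds - a) ^+ 2 / (2 * ds)).
    by field; rewrite gt_eqF.
  by rewrite mulr_ge0// divr_ge0 ?sqr_ge0// mulr_ge0// ltW.
have C20 : 0 <= C / (2 * (tau * sigma x)).
  by rewrite divr_ge0// mulr_ge0// mulr_ge0// ltW.
have := op_limit_dist hH TH toeplitz_sym toeplitz_ge0 (ltW M_gt0) TM phi_approx QP (kH x) C20 q.
rewrite k1 !mulr1 -/(berezin Q x) -/(dev x) => h.
have := ler_wpM2l (s_ge0 x) h => {}h; apply: (le_trans h).
rewrite le_eqVlt; apply/orP; left; apply/eqP; field.
by rewrite !gt_eqF.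
Qed.

End functional_calculus.

End toeplitz_trace.

(** * Asymptotics *)

Section modulus.
Context {R : realType}.

(** Extending by the value at 0 gives a function continuous on the whole line, to which the extreme
    value theorem and measurability of continuous functions apply. *)
Lemma continuous_clamp (phi : R -> R) : {within `[0, +oo[, continuous phi} ->
  continuous (fun t : R => phi (Num.max t 0)).
Proof.
move=> /continuous_within_itvcyP[cp c0] t; apply/cvgrPdist_le => e e0.
have [t0|t0|->] := ltgtP t 0.
- apply/nbhs_ballP; exists (- t); first by rewrite /= oppr_gt0.
  move=> x; rewrite -?ball_normE /= ltr_distl => /andP[x1 x2].
  have x0 : x < 0 by lra.
  by rewrite !max_r ?subrr ?normr0 ?(ltW e0)// ltW.
- have tin : t \in `]0, +oo[ by rewrite in_itv/= t0.
  have /cvgrPdist_le/(_ e e0)/nbhs_ballP[r /= r0 rP] := cp t tin.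
  apply/nbhs_ballP; exists (Num.min r t); first by rewrite /= lt_min r0.
  move=> x; rewrite -?ball_normE /= lt_min => /andP[xr]; rewrite ltr_distl => /andP[x1 x2].
  have x0 : 0 < x by lra.
  by rewrite !max_l ?(ltW t0) ?(ltW x0)//; apply: rP; rewrite -?ball_normE.
- have /cvgrPdist_le/(_ e e0) := c0; rewrite near_withinE => /nbhs_ballP[r /= r0 rP].
  apply/nbhs_ballP; exists r => // x xr; rewrite /=; have [x0|x0] := ltP 0 x; first exact: rP.
  by rewrite subrr normr0 ltW.
Qed.

(** Uniform continuity on a compact [0, K], together with oscillation at most eps beyond K, handles
    |s - t| < d1; for larger distances the global bound 2 B is absorbed into (2 B / d1) |s - t|. *)
Lemma uniform_modulus (phi : R -> R) : {within `[0, +oo[, continuous phi} ->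
  cvg (phi t @[t --> +oo]) -> forall eps : R, 0 < eps -> exists2 C : R, 0 <= C &
  forall s t : R, 0 <= s -> 0 <= t -> `|phi s - phi t| <= eps + C * `|s - t|.
Proof.
move=> cphi /cvg_ex[L /= phiL] eps eps0; pose f t := phi (Num.max t 0).
have cf : continuous f by exact: continuous_clamp.
have fE t : 0 <= t -> phi t = f t by move=> t0; rewrite /f max_l.
have eps2 : 0 < eps / 2 by rewrite divr_gt0.
have [K K0 KL] : exists2 K : R, 0 <= K & forall t : R, K <= t -> `|L - phi t| <= eps / 2.
  move/cvgrPdist_le : phiL => /(_ _ eps2)[K [_ KP]].
  exists (Num.max 0 (K + 1)); first by rewrite le_max lexx.
  by move=> t; rewrite ge_max => /andP[_ Kt]; apply: KP; lra.
have [c _ cmax] := EVT_max K0 (continuous_subspaceT (fun t => cvg_norm (cf t))).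
have [delta delta0 dP] : exists2 delta : R, 0 < delta &
    forall s t : R, 0 <= s <= K -> `|t - s| < delta -> `|f t - f s| <= eps.
  (* Compactness in near-covering form: radii that work around each point of [0, K] yield one that
     works for all points. *)
  have h : \forall d \near 0^'+, `[0, K]%classic `<=`
     (fun s : R => forall t : R, `|t - s| < d -> `|f t - f s| <= eps).
    apply: ((compact_near_coveringP _).1 (@segment_compact R 0 K) R (0^'+)
      (fun d s => forall t : R, `|t - s| < d -> `|f t - f s| <= eps)) => x _.
    have /cvgrPdist_le/(_ _ eps2)/nbhs_ballP[r /= r0 rP] := cf x.
    have r2 : 0 < r / 2 by rewrite divr_gt0.
    exists (ball x (r / 2), [set d : R | d < r / 2]).
      split => /=; first exact: nbhsx_ballx.
      exact: nbhs_right_lt.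
    move=> [y d] [/= xy dr] t td.
    rewrite -ball_normE /= in xy.
    have h1 : `|f x - f y| <= eps / 2.
      by apply: rP; rewrite -ball_normE /=; lra.
    have h2 : `|f x - f t| <= eps / 2.
      apply: rP; rewrite -ball_normE /=.
      have -> : x - t = (x - y) - (t - y) by ring.
      by apply: (le_lt_trans (ler_normB _ _)); lra.
    have -> : f t - f y = (f x - f y) - (f x - f t) by ring.
    by apply: (le_trans (ler_normB _ _)); lra.
  have [d0 [d0P d00]] : exists d : R, (`[0, K]%classic `<=`
     (fun s : R => forall t : R, `|t - s| < d -> `|f t - f s| <= eps)) /\ 0 < d.
    have hd : \forall d \near (0 : R)^'+, 0 < d by exact: nbhs_right_gt.
    by have [d ?] := filter_ex (filterI h hd); exists d.
  by exists d0 => // s t s0; apply: d0P; rewrite /= in_itv.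
pose d1 := Num.min delta 1; have d10 : 0 < d1 by rewrite lt_min delta0 ltr01.
pose B := `|f c| + (`|L| + eps / 2).
have fB t : 0 <= t -> `|f t| <= B.
  move=> t0; have [tK|Kt] := leP t K.
    have := cmax t; rewrite in_itv/= t0 tK => /(_ isT) h.
    by apply: (le_trans h); rewrite lerDl addr_ge0// ltW.
  have := KL t (ltW Kt); rewrite fE// => h.
  have := ler_normB L (L - f t); rewrite subKr => h2.
  by rewrite /B; have := normr_ge0 (f c); lra.
have B0 : 0 <= B by exact: le_trans (fB 0 (lexx 0)).
exists (2 * B / d1); first by rewrite divr_ge0 ?mulr_ge0// ltW.
move=> s t s0 t0; rewrite !fE//.
have [st|st] := ltP `|s - t| d1; last first.
  have h1 : `|f s - f t| <= 2 * B.
    by apply: (le_trans (ler_normB _ _)); have := fB s s0; have := fB t t0; lra.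
  apply: (le_trans h1); apply: (@le_trans _ _ (2 * B / d1 * `|s - t|)); last by rewrite lerDr ltW.
  rewrite -mulrA ler_peMr ?mulr_ge0//.
  by rewrite mulrC ler_pdivlMr// mul1r.
have st1 : `|s - t| < delta by move: st; rewrite lt_min => /andP[].
apply: (@le_trans _ _ eps); last by rewrite lerDl mulr_ge0// divr_ge0 ?mulr_ge0// ltW.
(* As soon as one of the points lies in [0, K] uniform continuity applies; otherwise both values are
   within eps / 2 of the limit at infinity. *)
have [sK|Ks] := leP s K; first by rewrite distrC; apply: dP; rewrite ?s0// distrC.
have [tK|Kt] := leP t K; first by apply: dP; rewrite ?t0.
have h1 := KL s (ltW Ks); have h2 := KL t (ltW Kt); rewrite !fE// in h1 h2.
have -> : f s - f t = (L - f t) - (L - f s) by ring.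
by apply: (le_trans (ler_normB _ _)); lra.
Qed.

End modulus.

(** * Toeplitz operators on dilated Paley-Wiener spaces *)

Section toeplitz_paley_wiener.
Context {R : realType} {n : nat}.
Local Notation V := 'rV[R]_n.
Local Notation mu := (@lebesgue_rV R n).
Local Notation rI f := (mu.-integrable setT (EFin \o f)).
Local Notation twopi := (@twopi R n).
Hypothesis n_gt0 : (0 < n)%N.
Variables (Omega : set V) (sigma : V -> R).
Hypotheses (bOmega : bounded_set Omega) (cOmega : convex_set Omega) (Omega0 : Omega° !=set0).
Hypotheses (sI : rI sigma) (s2I : rI (fun x => sigma x ^+ 2))
  (sae : {ae mu, forall x, 0 <= sigma x}).

(** sigma is nonnegative only almost everywhere, and psi and phi are controlled only on [0, +oo[;
    the positive part makes all pointwise estimates legitimate and has the same integrals. *)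
Definition pos_part (x : V) : R := Num.max (sigma x) 0.
Local Notation sp := pos_part.

Let sp0 x : 0 <= sp x. Proof. by rewrite /sp le_max lexx orbT. Qed.

Let spm : measurable_fun setT sp.
Proof. by apply: measurable_maxr; [exact: rI_meas sI|exact: measurable_cst]. Qed.

Let sp_ae : {ae mu, forall x, sigma x = sp x}.
Proof. by apply: filterS sae => x s0; rewrite /sp max_l. Qed.

Let spI : rI sp. Proof. exact: rI_ae sp_ae spm sI. Qed.

Let sp2I : rI (fun x => sp x ^+ 2).
Proof.
apply: rI_ae _ _ s2I; first by apply: filterS sp_ae => x <-.
exact: measurable_funX.
Qed.

Let g x : R[i] := (sp x)%:C.

Let gL : L2 g.
Proof.
apply/L2P; split; first exact: cmeas_real.
by under eq_fun do rewrite normsq_real.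
Qed.

Let O1 : set V := Omega°.
Let oO1 : box_open O1. Proof. exact: box_open_interior. Qed.
Let mO1 : measurable O1. Proof. exact: box_open_measurable. Qed.

Let O1oo : (mu O1 < +oo)%E.
Proof.
have [B _ OB] := bounded_coord bOmega; apply: (@bounded_lty _ _ _ B) => // x.
by move=> /interior_subset; exact: OB.
Qed.

Let muO1 : 0 < fine (mu O1).
Proof. by rewrite fine_gt0// O1oo andbT interior_lebesgue_gt0. Qed.

Definition unit_density : R := twopi^-1 * fine (mu O1).
Local Notation c1 := unit_density.

Let c1_gt0 : 0 < c1. Proof. by rewrite mulr_gt0// invr_gt0 twopi_gt0. Qed.

(* [Phi_alpha(x - y) = alpha^n Phi(alpha (x - y))] is the squared modulus of the
   normalized kernels, multiplied by the density. *)
Definition berezin_kernel (z : V) : R :=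
  c1 * (twopi^-1 / c1) ^+ 2 * normsq (fint (cind O1) z).
Local Notation Phi := berezin_kernel.

Let Phi0 z : 0 <= Phi z.
Proof. by rewrite mulr_ge0 ?normsq_ge0// mulr_ge0 ?sqr_ge0// ltW. Qed.

(** By Plancherel for the indicator of [O1] the mass is c1 (twopi^-1 / c1)^2 twopi |O1|, which is 1
    since c1 = twopi^-1 |O1|. *)
Lemma rint_berezin_kernel : rI Phi /\ \int[mu]_z Phi z = 1.
Proof.
have cL : L2 (cind O1) by exact: L2_cind.
have cI1 : cI mu (cind O1) by apply: cI_real; exact: rI_indic.
have [FL E] := plancherel n_gt0 cI1 cL.
split; first by apply: rIZ; exact: L2_normsq.
rewrite RintegralZl//; last exact: L2_normsq.
rewrite E; under eq_Rintegral do rewrite normsq_cind.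
rewrite rint_indic// -/twopi /c1.
have t0 := lt0r_neq0 (@twopi_gt0 R n); have m0 := lt0r_neq0 muO1.
move: twopi (fine (mu O1)) t0 m0 => p m p0 m0; field.
by rewrite p0 m0.
Qed.

(** At a = 1 / alpha this is the integral of |(T - sigma(x)) k_x|^2. Written with the undilated
    kernel it depends on alpha only through the translations, so the approximate identity
    applies. *)
Definition deviation (a : R) : R := \int[mu]_x sp x ^+ 2 -
  complex.Re (cint mu (fun z => (Phi z)%:C * inner (translate (a *: z) g) g)).

Lemma deviation_cvg (u : nat -> R) : u j @[j --> \oo] --> (0 : R) ->
  deviation (u j) @[j --> \oo] --> (0 : R).
Proof.
move=> u0; have [PI P1] := rint_berezin_kernel.
have := approximate_identity n_gt0 PI Phi0 gL u0; rewrite P1 => cv.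
have gg : inner g g = (\int[mu]_x sp x ^+ 2)%:C.
  rewrite (ip_self (hilbert_L2)) // inner_self; congr (_%:C).
  by apply: eq_Rintegral => x _; rewrite normsq_real.
rewrite gg -[X in _ * X]/(_%:C) mul1r in cv.
apply/cvgr0Pnorm_le => e e0; move/cvgr0Pnorm_le : cv => /(_ e e0).
apply: filterS => j; rewrite ger0_norm ?normc_ge0// => h.
apply: le_trans h; rewrite /deviation distrC; apply: le_trans (ler_normc_Re _).
by rewrite cReD cReN.
Qed.

Section dilated.
Variable alpha : R.
Hypothesis alpha_gt0 : 0 < alpha.
Let A := dilation alpha Omega.
Let O := dilation alpha O1.
Let H := PW A.
Local Notation k := (normalized_kernel A).

Let oO : box_open O. Proof. exact: box_open_dilation. Qed.

Let OA : O `<=` A.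
Proof. by move=> _ [x Ox <-]; exists x => //; exact: interior_subset. Qed.

Let O0 : O !=set0. Proof. by have [x Ox] := Omega0; exists (alpha *: x); exists x. Qed.

Let OB : exists B : R, forall x, O x -> forall i, `|x ord0 i| <= B.
Proof.
have [B B0 OB] := bounded_coord bOmega; exists (alpha * B) => _ [x Ox <-] i.
rewrite mxE normrM (ger0_norm (ltW alpha_gt0)) ler_pM2l//; apply: OB.
exact: interior_subset.
Qed.

Let AO : exists Z, [/\ measurable Z, mu Z = 0%E & A `<=` O `|` Z].
Proof.
have [Z [mZ Z0 UZ]] := convex_boundary_null bOmega cOmega Omega0.
exists (dilation alpha Z); split.
- exact: measurable_dilation.
- by rewrite lebesgue_dilation// Z0 mule0.
- by move=> _ [x /UZ[Ox|Zx] <-]; [left|right]; exists x.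
Qed.

Let muO : fine (mu O) = alpha ^+ n * fine (mu O1).
Proof.
have fO1 : mu O1 \is a fin_num by rewrite ge0_fin_numE.
have := lebesgue_dilation alpha_gt0 mO1; rewrite -[mu O1]fineK// -EFinM.
by move=> E; apply: EFin_inj; rewrite fineK ?[mu O]E.
Qed.

Lemma density_kdensity : density Omega alpha = kdensity O.
Proof. by rewrite /density convex_volume// /kdensity muO mulrA. Qed.

Let ccE : kdensity O = alpha ^+ n * c1.
Proof. by rewrite /kdensity muO /unit_density mulrCA. Qed.

Let cc_gt0 : 0 < kdensity O.
Proof. by rewrite ccE mulr_gt0// exprn_gt0. Qed.

Let hH : hilbert (@inner R n) H.
Proof. by have [B ?] := OB; have [Z [? ? ?]] := AO; exact: (@hilbert_PW _ _ _ A O Z B). Qed.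

Let kH x : H (k x).
Proof. by have [B ?] := OB; have [Z [? ? ?]] := AO; exact: (@PW_kernel _ _ _ A O Z B). Qed.

Let k1 x : inner (k x) (k x) = 1.
Proof. by have [B ?] := OB; have [Z [? ? ?]] := AO; exact: (@kernel_unit _ _ _ A O Z B). Qed.

Let kmeas f : H f -> cmeas (fun x => inner f (k x)).
Proof. by have [B ?] := OB; have [Z [? ? ?]] := AO; exact: (@cmeas_inner_kernel _ _ _ A O Z B). Qed.

Let kint f : H f -> rI (fun x => normsq (inner f (k x))) /\
  kdensity O * \int[mu]_x normsq (inner f (k x)) = complex.Re (inner f f).
Proof. by have [B ?] := OB; have [Z [? ? ?]] := AO; exact: (@rint_inner_kernel _ _ _ A O Z B). Qed.

Let basis : exists e, orthonormal_basis (@inner R n) H e.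
Proof. by have [B ?] := OB; have [Z [? ? ?]] := AO; exact: (@PW_basis _ _ _ A O Z B). Qed.

Let kk x y : normsq (inner (k x) (k y)) * kdensity O = alpha ^+ n * Phi (alpha *: (y - x)).
Proof.
have [B ?] := OB; have [Z [? ? ?]] := AO.
rewrite (@inner_kernels _ _ _ A O Z B)// fint_dilation// !normsqM !normsq_real ccE /Phi.
have a0 := lt0r_neq0 (exprn_gt0 n alpha_gt0); have c0 := lt0r_neq0 c1_gt0.
move: (normsq _) (alpha ^+ n) c1 twopi^-1 a0 c0 => q a c p a0 c0; field.
by rewrite a0 c0.
Qed.

Local Notation T := (toeplitz Omega sigma alpha).

(** [toeplitz] picks a representative by choice; Riesz representation provides a candidate, so the
    choice does satisfy the weak equation. Here sigma is also replaced by its positive part, which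
    does not change the integrals. *)
Lemma toeplitzP f : H f -> H (T f) /\ forall h, H h ->
  inner (T f) h = cint mu (toeplitz_form (@inner R n) k (kdensity O) sp f h).
Proof.
move=> fH; have [e eB] := basis.
have formE f' h : H f' -> H h -> cintegral setT (fun x => (sigma x)%:C * inner f' (k x) *
      inner (k x) h * (density Omega alpha)%:C) =
    cint mu (toeplitz_form (@inner R n) k (kdensity O) sp f' h).
  move=> fH' hH'; rewrite density_kdensity.
  have m (s : V -> R) : measurable_fun setT s ->
      cmeas (fun x => (s x)%:C * inner f' (k x) * inner (k x) h * (kdensity O)%:C).
    move=> ms; apply: cmeasM; last exact: cmeas_cst.
    apply: cmeasM; first by apply: cmeasM; [exact: cmeas_real|exact: kmeas].
    have := cmeasJ (kmeas hH'); congr cmeas; apply/funext => x.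
    by rewrite -(ip_conj hH hH' (kH x)).
  apply: cint_ae; [|exact: m (rI_meas sI)|exact: m].
  by apply: filterS sp_ae => x ->.
have [h hH' hE] := toeplitz_exists hH kH k1 kmeas cc_gt0 sp0 spI eB fH.
have : is_toeplitz Omega sigma alpha f (T f).
  apply: (@xgetPex _ 0 [set h | is_toeplitz Omega sigma alpha f h]).
  by exists h; split => // h' hH''; rewrite hE// formE.
by move=> [TH TE]; split=> // h' hH''; rewrite TE// formE.
Qed.

Let TH f (fH : H f) : H (T f) := (toeplitzP fH).1.

(** The substitution y = x + z / alpha turns c |<k_x, k_y>|^2 dy into the fixed measure Phi(z) dz,
    so that alpha is left only in the argument of sigma. *)
Lemma berezin_toeplitz x :
  rI (fun z => Phi z * sp (alpha^-1 *: z + x)) /\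
  berezin (@inner R n) k T x = \int[mu]_z (Phi z * sp (alpha^-1 *: z + x)).
Proof.
pose f y := kdensity O * sp y * normsq (inner (k x) (k y)).
have fI : rI f.
  apply: rI_le _ _ (rIZ (kdensity O) spI).
    apply: measurable_funM; first exact: rI_meas (rIZ (kdensity O) spI).
    by apply: measurable_normsq; exact: kmeas (kH x).
  move=> y; have cs0 := mulr_ge0 (ltW cc_gt0) (sp0 y).
  rewrite (ger0_norm (mulr_ge0 cs0 (normsq_ge0 _))) (ler_piMr cs0)//.
  have alg (a b c : R) : a <= b * c -> b = 1 -> c = 1 -> a <= 1 by move=> h b1 c1; rewrite b1 c1 mulr1 in h.
  exact: (alg _ _ _ (cauchy_schwarz_sq hH (kH x) (kH y)) (congr1 (@complex.Re R) (k1 x))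
    (congr1 (@complex.Re R) (k1 y))).
have ai0 : 0 < alpha^-1 by rewrite invr_gt0.
have fE z : f (x + alpha^-1 *: z) = alpha ^+ n * (Phi z * sp (alpha^-1 *: z + x)).
  have -> : f (x + alpha^-1 *: z) = normsq (inner (k x) (k (x + alpha^-1 *: z))) *
      kdensity O * sp (x + alpha^-1 *: z) by rewrite /f mulrC mulrA.
  have -> : Phi z = Phi (alpha *: (x + alpha^-1 *: z - x)).
    by rewrite addrAC subrr add0r scalerA divff ?gt_eqF// scale1r.
  by rewrite kk mulrA [alpha^-1 *: z + x]addrC.
have an0 : alpha ^+ n != 0 by rewrite expf_neq0// gt_eqF.
have gI : rI (fun z => Phi z * sp (alpha^-1 *: z + x)).
  have := rIZ (alpha ^+ n)^-1 (rI_affine x ai0 fI).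
  by under eq_fun do rewrite fE mulKf//.
split=> //; rewrite /berezin (toeplitzP (kH x)).2//.
rewrite (_ : toeplitz_form _ _ _ _ _ _ = fun y => (f y)%:C); last first.
  by apply/funext => y; rewrite (toeplitz_form_self hH _ _ kH _ (kH x)).
rewrite cint_real /= -(rint_affine x ai0 fI).
under eq_Rintegral do rewrite fE.
by rewrite RintegralZl// mulrA -exprMn mulVf ?gt_eqF// expr1n mul1r.
Qed.

Lemma rint_berezin_toeplitz :
  \int[mu]_x sp x ^+ 2 - \int[mu]_x (sp x * berezin (@inner R n) k T x) = deviation alpha^-1.
Proof.
have [PI _] := rint_berezin_kernel.
rewrite /deviation -(cint_shear alpha^-1 PI Phi0 gL); congr (_ - _).
rewrite (_ : (fun x => cint mu _) = fun x => (sp x * berezin (@inner R n) k T x)%:C).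
  by rewrite cint_real.
apply/funext => x; have [I ->] := berezin_toeplitz x.
rewrite -RintegralZl// -cint_real; congr (cint mu _); apply/funext => z.
by rewrite /g conjcR -!rmorphM; congr (_%:C); ring.
Qed.

(** The normalized trace t is produced before eps, C and tau, so that one number obeys all the
    estimates at the given alpha. *)
Lemma trace_toeplitz_estimate (varphi psi : R -> R) :
  (forall t, 0 <= t -> psi t = t * varphi t) ->
  (forall eps : R, 0 < eps -> exists2 C : R, 0 <= C &
     forall s t : R, 0 <= s -> 0 <= t -> `|varphi s - varphi t| <= eps + C * `|s - t|) ->
  measurable_fun setT (fun x => psi (sp x)) ->
  exists2 t : R, trace (@inner R n) H (fcalc (@inner R n) H psi T) / (density Omega alpha)%:C = t%:C &
  forall eps C tau : R, 0 <= C -> 0 < tau ->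
  (forall s t : R, 0 <= s -> 0 <= t -> `|varphi s - varphi t| <= eps + C * `|s - t|) ->
  `|t - \int[mu]_x psi (sp x)| <= eps * \int[mu]_x sp x +
   C / 2 * (tau * \int[mu]_x sp x ^+ 2 + deviation alpha^-1 / tau).
Proof.
move=> psiE phi_mod psim; have [e eB] := basis.
have [Q QP] := toeplitz_op_limit_exists hH kH k1 kmeas cc_gt0 sp0 spI toeplitzP phi_mod.
exists (\int[mu]_x (sp x * berezin (@inner R n) k Q x)); last first.
  move=> eps C tau C0 tau0 modP.
  rewrite -rint_berezin_toeplitz.
  rewrite -(rint_deviation hH kH k1 kmeas kint cc_gt0 sp0 spI eB toeplitzP sp2I).2.
  exact: (berezin_estimate hH kH k1 kmeas kint cc_gt0 sp0 spI eB toeplitzP sp2I psiE phi_mod psim QP C0 tau0 modP).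
set S := fcalc _ _ _ _; set t := \int[mu]_x _.
have tr : has_trace (@inner R n) H S (kdensity O * t)%:C.
  split; first by exists e.
  move=> e' eB'; apply: cvg_complex.
  exact: (fcalc_trace_cvg hH kH k1 kmeas cc_gt0 sp0 spI eB' toeplitzP psiE phi_mod QP).
(* Any number that [has_trace] accepts is the limit of the sums along the one basis e, hence
   unique. *)
have trE : trace (@inner R n) H S = (kdensity O * t)%:C.
  have [_ h1] : has_trace (@inner R n) H S (trace (@inner R n) H S).
    by apply: (@xgetPex _ 0 [set t | has_trace (@inner R n) H S t]); exists (kdensity O * t)%:C.
  exact: (cvg_unique _ (h1 e eB) (tr.2 e eB)).
rewrite trE density_kdensity -fmorphV -rmorphM; congr (_%:C).
by rewrite mulrAC divff ?mul1r// lt0r_neq0.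
Qed.

End dilated.

End toeplitz_paley_wiener.

Theorem theorem6p2 (R : realType) (n : nat) (Omega : set 'rV[R]_n)
    (sigma : 'rV[R]_n -> R) (psi : R -> R) :
  (0 < n)%N ->
  bounded_set Omega -> convex_set Omega -> Omega° !=set0 ->
  sigma \in Lfun (lebesgue_rV n) 1%:E -> sigma \in Lfun (lebesgue_rV n) 2%:E ->
  {ae lebesgue_rV n, forall x, 0 <= sigma x} ->
  {within `[0, +oo[, continuous psi} -> psi 0 = 0 ->
  cvg (psi s / s @[s --> 0^'+]) ->
  {within `[0, +oo[, continuous (phi psi)} ->
  cvg (psi t / t @[t --> +oo]) ->
  (let H := PW (dilation alpha Omega) in
   trace inner H (fcalc inner H psi (toeplitz Omega sigma alpha)) /
     (density Omega alpha)%:C : R[i]^o) @[alpha --> +oo] -->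
  ((\int[lebesgue_rV n]_x psi (sigma x))%:C : R[i]^o).
Proof.
move=> n0 bO cO O0 /Lfun1_integrable sI /Lfun2P[_ s2I] sae _ psi0 _ cphi psiy.
set mu := lebesgue_rV n.
have psiE t : 0 <= t -> psi t = t * phi psi t.
  rewrite le_eqVlt => /orP[/eqP<-|t0]; first by rewrite mul0r.
  by rewrite /phi gt_eqF// mulrC divfK// gt_eqF.
have phiy : cvg (phi psi t @[t --> +oo]).
  have [l lP] := (cvg_ex _).1 psiy; apply/cvg_ex; exists l.
  apply: cvg_trans lP; apply: near_eq_cvg; near=> t.
  by rewrite /phi gt_eqF//; near: t; exact: nbhs_pinfty_gt.
have phi_mod := uniform_modulus cphi phiy.
have spm : measurable_fun setT (pos_part sigma).
  by apply: measurable_maxr; [exact: rI_meas sI|exact: measurable_cst].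
have psim : measurable_fun setT (fun x => psi (pos_part sigma x)).
  have sp0 x : 0 <= pos_part sigma x by rewrite /pos_part le_max lexx orbT.
  (* psi may be anything on the negative reals, so measurability goes through the continuous
     extension of phi. *)
  rewrite (_ : (fun x => _) = (fun x => pos_part sigma x * phi psi (Num.max (pos_part sigma x) 0))).
    apply: measurable_funM => //.
    exact: (measurableT_comp (continuous_measurable_fun (continuous_clamp cphi)) spm).
  by apply/funext => x; rewrite psiE// max_l.
have -> : \int[mu]_x psi (sigma x) = \int[mu]_x psi (pos_part sigma x).
  have [Z [mZ Z0 sZ]] := sae; apply: (rint_null psim mZ Z0) => x Zx.
  rewrite /pos_part max_l//; apply: contrapT => h; exact: Zx (sZ _ h).
apply: cvg_complex; apply/cvgr0Pnorm_le => e e0.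
set S1 := \int[mu]_x pos_part sigma x; set S2 := \int[mu]_x pos_part sigma x ^+ 2.
have S10 : 0 <= S1 by apply: Rintegral_ge0 => x _; rewrite /pos_part le_max lexx orbT.
have S20 : 0 <= S2 by apply: Rintegral_ge0 => x _; rewrite sqr_ge0.
(* Three error terms share e equally: this eps serves the term with the integral of sigma, [tau] the
   one with sigma^2, and [d0] the deviation. The 1 added in the denominators covers vanishing
   integrals and C = 0. *)
have eps0 : 0 < e / 3 / (S1 + 1) by rewrite !divr_gt0// ltr_wpDl.
have [C C0 CP] := phi_mod _ eps0.
pose tau : R := e / 3 / ((C + 1) * (S2 + 1)).
have tau0 : 0 < tau by rewrite !divr_gt0// mulr_gt0// ltr_wpDl.
have dev0 : deviation Omega sigma alpha^-1 @[alpha --> +oo] --> (0 : R).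
  apply/cvg_pinftyP => u uoo; apply: deviation_cvg => //.
  apply/cvgr0Pnorm_le => r r0; move/cvgryPgt : uoo => /(_ r^-1).
  apply: filterS => j ru; have u0 : 0 < u j by apply: lt_trans ru; rewrite invr_gt0.
  by rewrite ger0_norm ?invr_ge0 ?(ltW u0)// -[r]invrK lef_pV2 ?posrE ?invr_gt0// ltW.
have C1 : 0 < C + 1 by rewrite ltr_wpDl.
have e3 : 0 < e / 3 by rewrite divr_gt0.
have d0 : 0 < tau * (e / 3) / (C + 1) by exact: divr_gt0 (mulr_gt0 tau0 e3) C1.
move/cvgr0Pnorm_le : dev0 => /(_ _ d0) dev0.
near=> alpha.
have a0 : 0 < alpha by near: alpha; exact: nbhs_pinfty_gt.
have [t tE /(_ _ C tau C0 tau0 CP)] :=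
  trace_toeplitz_estimate n0 bO cO O0 sI s2I sae a0 psiE phi_mod psim.
cbv zeta; rewrite tE -rmorphB normc_real normr_id -/S1 -/S2 => h; apply: (le_trans h).
have dv : deviation Omega sigma alpha^-1 <= tau * (e / 3) / (C + 1).
  by apply: le_trans (ler_norm _) _; near: alpha; exact: dev0.
have h1 : e / 3 / (S1 + 1) * S1 <= e / 3.
  rewrite -mulrA ler_piMr ?divr_ge0 ?(ltW e0)// mulrC ler_pdivrMr ?ltr_wpDl//; lra.
have h2 : C / 2 * (tau * S2) <= e / 3.
  rewrite /tau; have -> : C / 2 * (e / 3 / ((C + 1) * (S2 + 1)) * S2) =
      e / 3 * ((C / 2 / (C + 1)) * (S2 / (S2 + 1))).
    by field; rewrite !gt_eqF// ltr_wpDl.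
  rewrite ler_piMr ?divr_ge0 ?(ltW e0)// mulr_ile1 ?divr_ge0 ?addr_ge0//.
    by rewrite ler_pdivrMr//; lra.
  by rewrite ler_pdivrMr ?ltr_wpDl//; lra.
have h3 : C / 2 * (deviation Omega sigma alpha^-1 / tau) <= e / 3.
  apply: (@le_trans _ _ (C / 2 * (e / 3 / (C + 1)))).
    rewrite ler_wpM2l ?divr_ge0// ler_pdivrMr//; apply: (le_trans dv).
    by rewrite le_eqVlt; apply/orP; left; apply/eqP; ring.
  have -> : C / 2 * (e / 3 / (C + 1)) = e / 3 * (C / 2 / (C + 1)) by ring.
  by rewrite ler_piMr ?divr_ge0 ?(ltW e0)// ler_pdivrMr//; lra.
by rewrite mulrDr; lra.
Unshelve. all: by end_near. Qed.
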